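(* There is an Iwasawa decomposition $G_{\mathbb{F}}(O)=U_{\mathbb{F}}(O)A_{\mathbb{F}}(O)K_{\mathbb{F}}$, meaning that for every $g\in G_{\mathbb{F}}(O)$ there are unique $u\in U_{\mathbb{F}}(O)$, $a\in A_{\mathbb{F}}(O)$, $k\in K_{\mathbb{F}}=K_{\mathbb{F}}(O)$ with $g=uak$.
   Context: Let $\mathbb{K},\mathbb{F}$ be real closed fields with $\mathbb{K}\subseteq\mathbb{R}\cap\mathbb{F}$. Let $O\subsetneq\mathbb{F}$ be an order convex subring ($a,b\in O$ and $a\le c\le b$ imply $c\in O$); it is a valuation ring. For a semialgebraic set $V$ defined over $\mathbb{K}$, $V_{\mathbb{F}}$ denotes its $\mathbb{F}$-extension (the set defined over $\mathbb{F}$ by the same formula). $G<\operatorname{SL}_n$ is a connected semisimple algebraic group over $\mathbb{K}$, self-adjoint ($g\in G$ implies $g^{\mathsf T}\in G$). $S<G$ is a maximal $\mathbb{K}$-split torus with $s=s^{\mathsf T}$ for all $s\in S$; $A_{\mathbb{F}}$ is the $\mathbb{F}$-extension of the semialgebraic connected component of $S_{\mathbb{K}}$ containing $\operatorname{Id}$; $K_{\mathbb{F}}=G_{\mathbb{F}}\cap\operatorname{SO}_n(\mathbb{F})$. Let $\mathfrak{g}=\operatorname{Lie}(G_{\mathbb{R}})$, $\mathfrak{a}=\operatorname{Lie}(A_{\mathbb{R}})$; $\Sigma\subseteq\mathfrak{a}^\star$ is the root system of $\mathfrak{g}$ with respect to $\mathfrak{a}$, with root spaces $\mathfrak{g}_\alpha$.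 Fix a basis of $\Sigma$ with positive roots $\Sigma_{>0}$ and let $U_{\mathbb{F}}=\exp(\bigoplus_{\alpha\in\Sigma_{>0}}(\mathfrak{g}_\alpha)_{\mathbb{F}})$. For a semialgebraic subset $H_{\mathbb{F}}\subseteq G_{\mathbb{F}}$, $H_{\mathbb{F}}(O)=H_{\mathbb{F}}\cap O^{n\times n}$. *)

(* Defs.v *)
From HB Require Import structures.
From mathcomp Require Import all_boot all_order all_algebra.
From mathcomp Require Import complex.
From mathcomp Require Import all_classical all_reals all_analysis.
(* Without its notations, which clash with those of the analysis library. *)
From mathcomp Require Import -(notations) mpoly.
Set Implicit Arguments.
Unset Strict Implicit.
Unset Printing Implicit Defensive.
Import Order.TTheory GRing.Theory Num.Theory.
Import numFieldNormedType.Exports.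
Local Open Scope classical_set_scope.
Local Open Scope ring_scope.

Notation mxpoly K n := (mpoly (n * n) K).

(* [p] in [K[x_ij]], evaluated at a matrix over [L], its coefficients being
   mapped by [i]. *)
Definition eval_mx (K L : fieldType) (n : nat) (i : K -> L) (M : 'M[L]_n)
    (p : mxpoly K n) : L :=
  mmap i (fun k => mxvec M 0 k) p.

Definition zeros (K L : fieldType) (n : nat) (i : K -> L)
    (P : set (mxpoly K n)) : set 'M[L]_n :=
  [set M | forall p, P p -> eval_mx i M p = 0].

Section Groups.
Variables (L : fieldType) (n : nat).
Implicit Types X Y Z N G : set 'M[L]_n.

Definition zariski_closed X : Prop :=
  exists P : set (mxpoly L n), X = zeros idfun P.

Definition zariski_connected X : Prop :=
  forall Y Z, zariski_closed Y -> zariski_closed Z ->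
    Y `|` Z = X -> Y `&` Z = set0 -> Y = set0 \/ Z = set0.

Definition is_subgroup X : Prop :=
  [/\ X `<=` [set M | M \in unitmx],
      X 1%:M,
      forall x y, X x -> X y -> X (x *m y) &
      forall x, X x -> X (invmx x)].

Definition generated X : set 'M[L]_n :=
  [set x | forall Y, is_subgroup Y -> X `<=` Y -> Y x].

Definition derived X : set 'M[L]_n :=
  generated [set x *m y *m invmx x *m invmx y | x in X & y in X].

Definition solvable_group X : Prop :=
  exists m, iter m derived X = [set 1%:M].

Definition normal_in N G : Prop :=
  [/\ is_subgroup N, N `<=` G &
      forall g x, G g -> N x -> N (g *m x *m invmx g)].

(* Over an algebraically closed [L]: the radical of [G] is trivial. *)
Definition semisimple_group G : Prop :=
  forall N, normal_in N G -> zariski_closed N -> zariski_connected N ->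
    solvable_group N -> N = [set 1%:M].

End Groups.

(* An algebraic group over [K] is given by polynomials over [K]; its geometric
   points are those over [K[i]], the algebraic closure of the real closed field
   [K]. Since [K] has characteristic 0, being cut out by polynomials over [K] is
   the same as being defined over [K]. *)
Section KGroups.
Variables (K : rcfType) (n : nat).
Implicit Types G S : set (mxpoly K n).

Definition geom G : set 'M[K[i]]_n := zeros (real_complex K) G.

Definition torus_points (r : nat) : set 'rV[K[i]]_r :=
  [set t | forall i, t 0 i != 0].

(* [S] is isomorphic, as an algebraic group over [K], to a power of the
   multiplicative group. As [S] is closed in the space of matrices, its regular
   functions are the polynomials in the entries; those of the power of the
   multiplicative group are the polynomials in [t_1, ..., t_r] and
   [t_1^-1, ..., t_r^-1]. *)
Definition split_torus S : Prop :=
  is_subgroup (geom S) /\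
  exists (r : nat) (phi : 'I_r -> mxpoly K n)
         (psi : 'I_n -> 'I_n -> mpoly (r + r) K),
    let f (s : 'M[K[i]]_n) : 'rV[K[i]]_r :=
      \row_i eval_mx (real_complex K) s (phi i) in
    let h (t : 'rV[K[i]]_r) : 'M[K[i]]_n :=
      \matrix_(i, j) mmap (real_complex K)
        (fun k => row_mx t (map_mx GRing.inv t) 0 k) (psi i j) in
    [/\ forall s, geom S s -> torus_points (f s),
        forall t, torus_points t -> geom S (h t),
        forall s, geom S s -> h (f s) = s,
        forall t, torus_points t -> f (h t) = t &
        forall s s', geom S s -> geom S s' ->
          forall i, f (s *m s') 0 i = f s 0 i * f s' 0 i].

Definition maximal_split_torus G S : Prop :=
  [/\ split_torus S, geom S `<=` geom G &
      forall S', split_torus S' -> geom S `<=` geom S' ->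
        geom S' `<=` geom G -> geom S' = geom S].

End KGroups.

(* The finite union, over the pairs [(ps, qs)] of the list, of the sets given by
   [p = 0] for [p] in [ps] and [0 < q] for [q] in [qs]. *)
Notation sa_formula K n := (seq (seq (mxpoly K n) * seq (mxpoly K n))).

Definition sa_points (K L : rcfType) (n : nat) (i : K -> L)
    (d : sa_formula K n) : set 'M[L]_n :=
  [set M | exists2 c, c \in d &
     (forall p, p \in c.1 -> eval_mx i M p = 0) /\
     (forall q, q \in c.2 -> 0 < eval_mx i M q)].

Section Components.
Variables (K : rcfType) (n : nat).
Implicit Types V C : set 'M[K]_n.

Definition semialgebraic V : Prop := exists d, V = sa_points idfun d.

Definition sa_connected V : Prop :=
  forall C1 C2, semialgebraic C1 -> semialgebraic C2 ->
    (exists2 E : set 'M[K]_n, closed E & C1 = V `&` E) ->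
    (exists2 E : set 'M[K]_n, closed E & C2 = V `&` E) ->
    C1 `|` C2 = V -> C1 `&` C2 = set0 -> C1 = V \/ C2 = V.

Definition sa_component V (x : 'M[K]_n) : set 'M[K]_n :=
  [set y | exists C, [/\ semialgebraic C, sa_connected C, C `<=` V, C x & C y]].

End Components.

(* The [F]-extension of a subset [V] of [L^(n x n)] that is defined by a formula
   over [K]; the result does not depend on the formula, by the transfer
   principle. It is empty if no formula over [K] defines [V]. *)
Definition extension (K L F : rcfType) (n : nat) (iL : K -> L) (iF : K -> F)
    (V : set 'M[L]_n) : set 'M[F]_n :=
  [set M | exists2 d : sa_formula K n, V = sa_points iL d & sa_points iF d M].

Definition exp_trunc (L : fieldType) (n m : nat) (X : 'M[L]_n) : 'M[L]_n :=
  \sum_(k < m) (k`!%:R)^-1 *: X ^+ k.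

Definition expmx (R : realType) (n : nat) (X : 'M[R]_n) : 'M[R]_n :=
  \matrix_(i, j) limn (fun m : nat => exp_trunc m X i j).

(* A nilpotent matrix of size [n] has zero [n]-th power. *)
Definition exp_nilp (L : fieldType) (n : nat) (X : 'M[L]_n) : 'M[L]_n :=
  exp_trunc n X.

Definition lie_algebra (R : realType) (n : nat) (H : set 'M[R]_n) :
    set 'M[R]_n :=
  [set X | forall t : R, H (expmx (t *: X))].

Section Roots.
Variables (R : realType) (n : nat) (g : set 'M[R]_n) (a : {vspace 'M[R]_n}).
Local Notation dual := 'Hom(subvs_of a, R^o).
Implicit Types (alpha : dual) (Delta : seq dual).

Definition root_space alpha : set 'M[R]_n :=
  [set X | g X /\ forall H : subvs_of a,
     vsval H *m X - X *m vsval H = (alpha H : R) *: X].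

Definition is_root alpha : Prop :=
  alpha != 0 /\ exists2 X, X != 0 & root_space alpha X.

Definition nonneg_comb Delta alpha : Prop :=
  exists c : nat -> nat, alpha = \sum_(i < size Delta) Delta`_i *+ c i.

Definition root_basis Delta : Prop :=
  [/\ basis_of fullv Delta,
      forall alpha, alpha \in Delta -> is_root alpha &
      forall alpha, is_root alpha ->
        nonneg_comb Delta alpha \/ nonneg_comb Delta (- alpha)].

Definition positive_root Delta alpha : Prop :=
  is_root alpha /\ nonneg_comb Delta alpha.

Definition unipotent_part (K F : rcfType) (iR : K -> R) (iF : K -> F) Delta :
    set 'M[F]_n :=
  [set u | exists (r : seq dual) (X : dual -> 'M[F]_n),
     [/\ uniq r,
         forall alpha, alpha \in r -> positive_root Delta alpha,
         forall alpha, alpha \in r ->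
           extension iR iF (root_space alpha) (X alpha) &
         u = exp_nilp (\sum_(alpha <- r) X alpha)]].

End Roots.

Definition integral_points (F : rcfType) (n : nat) (O : {pred F})
    (H : set 'M[F]_n) : set 'M[F]_n :=
  [set M | H M /\ forall i j, M i j \in O].

Definition order_convex (F : rcfType) (O : {pred F}) : Prop :=
  forall a b c, a \in O -> b \in O -> a <= c <= b -> c \in O.

Definition SO (F : rcfType) (n : nat) : set 'M[F]_n :=
  [set k | k *m k^T = 1%:M /\ \det k = 1].
Arguments SO : clear implicits.

(* Main.v *)
Require Import Defs.
From HB Require Import structures.
From mathcomp Require Import all_boot all_order all_algebra.
From mathcomp Require Import complex.
From mathcomp Require Import all_classical all_reals all_analysis.
From mathcomp Require Import -(notations) mpoly.
From mathcomp Require polyrcf qe_rcf_th qe_rcf.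
From mathcomp Require Import ring lra.
Set Implicit Arguments.
Unset Strict Implicit.
Unset Printing Implicit Defensive.
Import Order.TTheory GRing.Theory Num.Theory.
Import numFieldNormedType.Exports.
Local Open Scope classical_set_scope.
Local Open Scope ring_scope.

(* By quantifier elimination, sign conditions solvable in a real closed extension
   are solvable in the field itself, so universal semialgebraic facts proved over
   [R] or over [K] hold over [F]. The group is the stabilizer of a subspace [E] of
   a tensor power; hence for diagonalizable or unipotent elements it is compatible
   with logarithms and with the weight decomposition under [a]. All of [A] is diagonal in one orthonormal basis; let
   [h] be the diagonal of an [H0] in [a] on which every simple root is [1].

   For [y] in the group, block Cholesky with respect to the order given by [h]
   gives [y *m y^T = u *m l *m u^T] with [u] unipotent triangular and [l]
   commuting with [H0]. Contracting by [exp (t H0)] shows that [u], hence [l], is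
   in the group. As no root vanishes on [H0], [ln l] commutes with [a]; so [l],
   together with [A], generates a split torus, and [l] is in [A] by maximality of
   [S]. With [b] the root of [l] in [A], [(u b)^-1 y] is orthogonal.

   Over [F], orthogonal matrices have entries in [-1, 1], so [u b = y k^T] is
   integral; its diagonal is that of [b], and [\det b = 1] makes [b^-1] and [u]
   integral. Uniqueness holds because [u b^2 u^T] determines [u] and [b]. *)

(** * Transfer between real closed fields *)

(** Three fields have to cooperate. Exponentials, and with them the Lie algebras of the statement,
    exist over [R] only; maximality of [S] speaks about [K]; the conclusion concerns [F], which need
    not be comparable with [R]. Only universal statements transfer, so whatever asserts existence,
    such as block Cholesky factors, roots of positive definite matrices and logarithms of unipotent
    ones, is constructed by linear algebra over an arbitrary field of the required kind. What
    transfers is that the constructed factors lie in the group and in the torus. This is proved for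
    matrices over [K]: they are mapped into [R] for the Lie theory, and the outcome is brought back
    to [K] to meet maximality. Membership in the group is nonlinear, and the given Lie algebra is
    not visibly algebraic; in a tensor power, group elements and the nilpotent elements in question
    are both recognized by stability of one subspace, to which polynomial identities in one variable
    and spectral projections apply. *)

Module QE := qe_rcf.
Section QENaturality.
Variables (K F : rcfType) (i : {rmorphism K -> F}).

(** [QE] eliminates a variable by a procedure written for one field. That the procedure commutes
    with a change of coefficients lets its outcomes over [K] and over [F] be compared. *)
Fixpoint map_qterm (t : QE.term K) : QE.term F :=
  match t with
  | QE.Var n => QE.Var _ n
  | QE.Const x => QE.Const (i x)
  | QE.NatConst n => QE.NatConst _ n
  | QE.Add u v => QE.Add (map_qterm u) (map_qterm v)
  | QE.Opp u => QE.Opp (map_qterm u)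
  | QE.NatMul u n => QE.NatMul (map_qterm u) n
  | QE.Mul u v => QE.Mul (map_qterm u) (map_qterm v)
  | QE.Exp u n => QE.Exp (map_qterm u) n
  end.

Fixpoint map_qform (f : QE.formula K) : QE.formula F :=
  match f with
  | QE.Bool b => QE.Bool b
  | QE.Equal u v => QE.Equal (map_qterm u) (map_qterm v)
  | QE.Lt u v => QE.Lt (map_qterm u) (map_qterm v)
  | QE.Le u v => QE.Le (map_qterm u) (map_qterm v)
  | QE.And f g => QE.And (map_qform f) (map_qform g)
  | QE.Or f g => QE.Or (map_qform f) (map_qform g)
  | QE.Implies f g => QE.Implies (map_qform f) (map_qform g)
  | QE.Not f => QE.Not (map_qform f)
  end.

Notation tK := (QE.term K).
Notation mt := map_qterm.
Notation mf := map_qform.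
Notation mp := (map map_qterm).
Notation mps := (map (map map_qterm)).

(** The procedures branch on unknown data by continuation passing, so each compatibility is stated
    for two continuations that correspond under the change of coefficients. *)
Lemma map_Size p k k' : (forall n, mf (k n) = k' n) ->
  mf (QE.Size p k) = QE.Size (mp p) k'.
Proof.
elim: p k k' => [|c p IH] k k' kk //=.
by apply: IH => -[|n] //=; rewrite !kk.
Qed.

Lemma map_Isnull p k k' : (forall b, mf (k b) = k' b) ->
  mf (QE.Isnull p k) = QE.Isnull (mp p) k'.
Proof. by move=> kk; apply: map_Size. Qed.

Lemma map_LeadCoef p k k' : (forall t, mf (k t) = k' (mt t)) ->
  mf (QE.LeadCoef p k) = QE.LeadCoef (mp p) k'.
Proof.
elim: p k k' => [|c p IH] k k' kk /=; first by rewrite kk /= rmorph0.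
by apply: IH => t /=; rewrite !kk.
Qed.

Lemma map_AmulXn a n : mp (QE.AmulXn a n) = QE.AmulXn (mt a) n.
Proof. by elim: n => //= n ->; rewrite rmorph0. Qed.

Lemma map_AddPoly p q : mp (QE.AddPoly p q) = QE.AddPoly (mp p) (mp q).
Proof. by elim: p q => [|a p IH] [|b q] //=; rewrite IH. Qed.

Lemma map_ScalPoly c p : mp (QE.ScalPoly c p) = QE.ScalPoly (mt c) (mp p).
Proof. by rewrite /QE.ScalPoly -!map_comp. Qed.

Lemma map_MulPoly p q : mp (QE.MulPoly p q) = QE.MulPoly (mp p) (mp q).
Proof. by elim: p => //= a p IH; rewrite map_AddPoly map_ScalPoly /= IH. Qed.

Lemma map_ExpPoly p n : mp (QE.ExpPoly p n) = QE.ExpPoly (mp p) n.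
Proof.
case: n => // n; rewrite /QE.ExpPoly !iteropS.
by elim: n => //= n IH; rewrite map_MulPoly IH.
Qed.

Lemma map_OppPoly p : mp (QE.OppPoly p) = QE.OppPoly (mp p).
Proof. by rewrite /QE.OppPoly map_ScalPoly /= rmorphN1. Qed.

Lemma map_NatMulPoly n p : mp (QE.NatMulPoly n p) = QE.NatMulPoly n (mp p).
Proof. by rewrite /QE.NatMulPoly map_ScalPoly. Qed.

Lemma map_Deriv p : mp (QE.Deriv p) = QE.Deriv (mp p).
Proof. by elim: p => //= a p IH; rewrite map_AddPoly /= IH. Qed.

Lemma map_Rediv_loop q sq cq c qq r n k k' :
  (forall d qq r, mf (k (d, qq, r)) = k' (d, mp qq, mp r)) ->
  mf (QE.Rediv_rec_loop q sq cq c qq r n k) =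
  QE.Rediv_rec_loop (mp q) sq (mt cq) c (mp qq) (mp r) n k'.
Proof.
elim: n c qq r k k' => [|n IH] c qq r k k' kk /=;
  apply: map_Size => m; case: ifP => // _; apply: map_LeadCoef => t.
- by rewrite kk !map_AddPoly map_OppPoly !map_MulPoly map_AmulXn.
- rewrite (IH _ _ _ _ k') // !map_AddPoly map_OppPoly !map_MulPoly.
  by rewrite map_AmulXn.
Qed.

Lemma map_Rediv p q k k' :
  (forall d qq r, mf (k (d, qq, r)) = k' (d, mp qq, mp r)) ->
  mf (QE.Rediv p q k) = QE.Rediv (mp p) (mp q) k'.
Proof.
move=> kk; apply: map_Isnull => -[]; first by rewrite kk /= rmorph0.
apply: map_Size => m; apply: map_Size => m'; apply: map_LeadCoef => t.
by rewrite (map_Rediv_loop _ _ _ _ _ _ _ kk) /= rmorph0.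
Qed.

Lemma map_Rmod p q k k' : (forall r, mf (k r) = k' (mp r)) ->
  mf (QE.Rmod p q k) = QE.Rmod (mp p) (mp q) k'.
Proof. by move=> kk; apply: map_Rediv => * /=. Qed.

Lemma map_Rscal p q k k' : (forall r, mf (k r) = k' r) ->
  mf (QE.Rscal p q k) = QE.Rscal (mp p) (mp q) k'.
Proof. by move=> kk; apply: map_Rediv => * /=. Qed.

Lemma map_Rgcd_loop n p q k k' : (forall r, mf (k r) = k' (mp r)) ->
  mf (QE.Rgcd_loop n p q k) = QE.Rgcd_loop n (mp p) (mp q) k'.
Proof.
elim: n p q k k' => [|n IH] p q k k' kk /=;
  apply: map_Rmod => r; apply: map_Isnull => -[] //.
exact: IH.
Qed.

Lemma map_Rgcd p q k k' : (forall r, mf (k r) = k' (mp r)) ->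
  mf (QE.Rgcd p q k) = QE.Rgcd (mp p) (mp q) k'.
Proof.
move=> kk; apply: map_Size => m; apply: map_Size => m'.
by case: ifP => _; apply: map_Isnull => -[] //; apply: map_Size => l;
  apply: map_Rgcd_loop.
Qed.

Lemma map_BigRgcd ps k k' : (forall r, mf (k r) = k' (mp r)) ->
  mf (QE.BigRgcd ps k) = QE.BigRgcd (mps ps) k'.
Proof.
elim: ps k k' => [|p ps IH] k k' kk /=; first by rewrite kk /= rmorph0.
by apply: IH => r; apply: map_Rgcd.
Qed.

Lemma map_Changes s k k' : (forall n, mf (k n) = k' n) ->
  mf (QE.Changes s k) = QE.Changes (mp s) k'.
Proof.
elim: s k k' => [|a s IH] k k' kk //=.
by apply: IH => n /=; rewrite !kk; case: s.
Qed.

Lemma map_SeqPInfty ps k k' : (forall s, mf (k s) = k' (mp s)) ->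
  mf (QE.SeqPInfty ps k) = QE.SeqPInfty (mps ps) k'.
Proof.
elim: ps k k' => [|p ps IH] k k' kk /=; first by rewrite kk.
by apply: map_LeadCoef => t; apply: IH => s; rewrite kk.
Qed.

Lemma map_SeqMInfty ps k k' : (forall s, mf (k s) = k' (mp s)) ->
  mf (QE.SeqMInfty ps k) = QE.SeqMInfty (mps ps) k'.
Proof.
elim: ps k k' => [|p ps IH] k k' kk /=; first by rewrite kk.
apply: map_LeadCoef => t; apply: map_Size => n; apply: IH => s.
by rewrite kk /= rmorphN1.
Qed.

Lemma map_ChangesPoly ps k k' : (forall n, mf (k n) = k' n) ->
  mf (QE.ChangesPoly ps k) = QE.ChangesPoly (mps ps) k'.
Proof.
move=> kk; apply: map_SeqMInfty => s; apply: map_SeqPInfty => s'.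
by apply: map_Changes => n; apply: map_Changes => n'.
Qed.

Lemma map_NextMod p q k k' : (forall r, mf (k r) = k' (mp r)) ->
  mf (QE.NextMod p q k) = QE.NextMod (mp p) (mp q) k'.
Proof.
move=> kk; apply: map_LeadCoef => t; apply: map_Rscal => n.
by apply: map_Rmod => r; rewrite kk map_ScalPoly.
Qed.

Lemma map_ModsAux p q n k k' : (forall s, mf (k s) = k' (mps s)) ->
  mf (QE.ModsAux p q n k) = QE.ModsAux (mp p) (mp q) n k'.
Proof.
elim: n p q k k' => [|n IH] p q k k' kk /=; first by rewrite kk.
apply: map_Isnull => -[]; first by rewrite kk.
by apply: map_NextMod => r; apply: IH => s; rewrite kk.
Qed.

Lemma map_Mods p q k k' : (forall s, mf (k s) = k' (mps s)) ->
  mf (QE.Mods p q k) = QE.Mods (mp p) (mp q) k'.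
Proof.
by move=> kk; apply: map_Size => m; apply: map_Size => m'; apply: map_ModsAux.
Qed.

Lemma map_TaqR p q k k' : (forall n, mf (k n) = k' n) ->
  mf (QE.TaqR p q k) = QE.TaqR (mp p) (mp q) k'.
Proof.
move=> kk; rewrite /QE.TaqR -map_Deriv -map_MulPoly.
by apply: map_Mods => s; apply: map_ChangesPoly.
Qed.

Lemma map_PolyComb sq sc : mp (QE.PolyComb sq sc) = QE.PolyComb (mps sq) sc.
Proof.
rewrite /QE.PolyComb size_map; elim: (iota _ _) => //= j s IH.
rewrite map_MulPoly map_ExpPoly IH; congr (QE.MulPoly (QE.ExpPoly _ _) _).
have [lt|ge] := ltnP j (size sq); first by rewrite (nth_map [::]).
by rewrite !nth_default // size_map.
Qed.

Lemma map_Pcq sq j : mp (QE.Pcq sq j) = QE.Pcq (mps sq) j.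
Proof.
rewrite /QE.Pcq size_map; elim: (qe_rcf_th.sg_tab _) j => [|s t IH] [|j] //=.
exact: map_PolyComb.
Qed.

Lemma map_TaqsR p sq j k k' : (forall t, mf (k t) = k' (mt t)) ->
  mf (QE.TaqsR p sq j k) = QE.TaqsR (mp p) (mps sq) j k'.
Proof.
move=> kk; rewrite /QE.TaqsR -map_Pcq.
by apply: map_TaqR => n; rewrite kk /= rmorph_int.
Qed.

Lemma map_BoundingPoly sq :
  mp (QE.BoundingPoly sq) = QE.BoundingPoly (mps sq).
Proof.
rewrite /QE.BoundingPoly map_Deriv; congr QE.Deriv.
by elim: sq => //= p sq IH; rewrite map_MulPoly IH.
Qed.

(** These constants are entries of the inverse of an integer matrix, hence rational, and every field
    morphism preserves them. *)
Lemma map_coefs n j : i (qe_rcf_th.coefs K n j) = qe_rcf_th.coefs F n j.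
Proof.
have [lt|ge] := ltnP j (size (enum 'I_(3 ^ n))); last first.
  by rewrite /qe_rcf_th.coefs !nth_default ?rmorph0 // size_map.
have e0 : 'I_(3 ^ n) by exists j; rewrite size_enum_ord in lt.
have E (L : numFieldType) : qe_rcf_th.coefs L n j =
    castmx (erefl, qe_rcf_th.exp3n n)
      (invmx (map_mx intr (qe_rcf_th.ctmat n))) (nth e0 (enum 'I_(3 ^ n)) j) ord0.
  exact: nth_map.
rewrite !E.
have -> : map_mx intr (qe_rcf_th.ctmat n) =
    map_mx i (map_mx intr (qe_rcf_th.ctmat n)) :> 'M[F]_(3 ^ n).
  by apply/matrixP => a b; rewrite !mxE rmorph_int.
by rewrite -map_invmx -map_castmx [RHS]mxE.
Qed.

Lemma map_Coefs n j : mt (QE.Coefs K n j) = QE.Coefs F n j.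
Proof.
case: n => [|[|n]]; rewrite /QE.Coefs //=; congr QE.Const.
- by rewrite rmorph_nat.
- by case: j => [|[|[|j]]]; rewrite /= ?nth_nil ?fmorphV ?rmorph_nat ?rmorph0.
- exact: map_coefs.
Qed.

Lemma map_CcountWeak p sq k k' : (forall t, mf (k t) = k' (mt t)) ->
  mf (QE.CcountWeak p sq k) = QE.CcountWeak (mp p) (mps sq) k'.
Proof.
move=> kk; rewrite /QE.CcountWeak size_map.
rewrite -[QE.NatConst F 0]/(mt (QE.NatConst K 0)); move: (QE.NatConst K 0) => s.
elim: (_ ^ _)%N k k' kk s => [|n IH] k k' kk s //=.
by apply: map_TaqsR => t; rewrite (IH _ k') // -map_Coefs.
Qed.

Lemma map_CcountGt0 sp sq :
  mf (QE.CcountGt0 sp sq) = QE.CcountGt0 (mps sp) (mps sq).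
Proof.
apply: map_BigRgcd => p; apply: map_Isnull => -[] /=; last first.
  exact: map_CcountWeak.
rewrite -map_BoundingPoly; apply: map_CcountWeak => t /=; congr (QE.Or _ _).
  elim: sq => //= q sq ->; congr (QE.And _ _).
  exact: map_LeadCoef.
congr (QE.Or _ _); elim: sq => //= q sq ->; congr (QE.And _ _).
by apply: map_Size => n; apply: map_LeadCoef.
Qed.

Lemma map_abstrX n t : mp (QE.abstrX n t) = QE.abstrX n (mt t).
Proof.
elim: t => //=.
- by move=> m; case: ifP.
- by move=> u <- v <-; rewrite map_AddPoly.
- by move=> u <-; rewrite map_OppPoly.
- by move=> u <- m; rewrite map_NatMulPoly.
- by move=> u <- v <-; rewrite map_MulPoly.
- by move=> u <- m; rewrite map_ExpPoly.
Qed.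

End QENaturality.
(** In a real closed field the positive elements are the nonzero squares, so every ring morphism
    preserves the order. *)
Lemma rcf_rmorph_gt0 (K F : rcfType) (i : {rmorphism K -> F}) (x : K) :
  (0 < i x) = (0 < x).
Proof.
have pos y : 0 < y -> 0 < i y.
  move=> y0; rewrite lt0r fmorph_eq0 gt_eqF //=.
  by rewrite -(sqr_sqrtr (ltW y0)) rmorphXn sqr_ge0.
have [x0|x0|<-] := ltrgtP 0 x; first exact: pos.
  by apply/negbTE; rewrite -leNgt -oppr_ge0 -rmorphN ltW // pos // oppr_gt0.
by rewrite rmorph0 ltxx.
Qed.

Lemma rcf_rmorph_sgz (K F : rcfType) (i : {rmorphism K -> F}) (x : K) :
  sgz (i x) = sgz x.
Proof. by apply/eqP; rewrite sgz_eq fmorph_eq0 rcf_rmorph_gt0 !eqxx. Qed.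

Section Transfer.
Variables (K F : rcfType) (i : {rmorphism K -> F}).
Notation mt := (map_qterm i).
Notation mf := (map_qform i).
Implicit Types (t : QE.term K) (f : QE.formula K) (T : seq (QE.term K)).

(** Each comparison is represented by the difference of its two sides, whose sign decides it. *)
Fixpoint qatoms f : seq (QE.term K) :=
  match f with
  | QE.Bool b => [::]
  | QE.Equal u v | QE.Lt u v | QE.Le u v => [:: QE.Add v (QE.Opp u)]
  | QE.And f g | QE.Or f g | QE.Implies f g => qatoms f ++ qatoms g
  | QE.Not f => qatoms f
  end.

Definition same_signs (e : seq F) (e' : seq K) T :=
  all (fun t => sgz (QE.eval e (mt t)) == sgz (QE.eval e' t)) T.

Lemma same_signs_eval e e' f : same_signs e e' (qatoms f) ->
  QE.qf_eval e (mf f) = QE.qf_eval e' f.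
Proof.
elim: f => //= [u v|u v|u v|f IHf g IHg|f IHf g IHg|f IHf g IHg|f IHf].
- rewrite andbT sgz_eq => /andP[/eqP E _].
  by rewrite eq_sym -subr_eq0 E subr_eq0 eq_sym.
- by rewrite andbT sgz_eq => /andP[_ /eqP]; rewrite !subr_gt0.
- rewrite andbT sgz_eq => /andP[/eqP E1 /eqP E2].
  by rewrite -subr_ge0 le0r E1 E2 -le0r subr_ge0.
- by rewrite /same_signs all_cat => /andP[/IHf -> /IHg ->].
- by rewrite /same_signs all_cat => /andP[/IHf -> /IHg ->].
- by rewrite /same_signs all_cat => /andP[/IHf -> /IHg ->].
- by move/IHf ->.
Qed.

Lemma set_nth_size (L : rcfType) (e : seq L) x :
  set_nth 0 e (size e) x = rcons e x.
Proof. by elim: e => //= y e ->. Qed.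

(* The signs of [T] at the last coordinate form a system in one variable, whose
   solvability is decided by signs of terms in the other coordinates. *)
Lemma same_signs_ex e : forall T, exists2 e', size e' = size e &
  same_signs e e' T.
Proof.
elim/last_ind: e => [|e x IH] T.
  exists [::] => //; elim: T => //= t T ->; rewrite andbT.
  suff -> : QE.eval [::] (mt t) = i (QE.eval [::] t) by rewrite rcf_rmorph_sgz.
  elim: t => //=.
  - by move=> n; rewrite !nth_nil rmorph0.
  - by move=> n; rewrite rmorph_nat.
  - by move=> u -> v ->; rewrite rmorphD.
  - by move=> u ->; rewrite rmorphN.
  - by move=> u -> n; rewrite rmorphMn.
  - by move=> u -> v ->; rewrite rmorphM.
  - by move=> u -> n; rewrite rmorphXn.
pose sg t := sgz (QE.eval (rcons e x) (mt t)).
pose sp := [seq t <- T | sg t == 0].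
pose sq := [seq t <- T | sg t == 1] ++
           [seq QE.Opp t | t <- [seq t <- T | sg t == -1]].
pose n := size e.
pose psi := QE.CcountGt0 (map (QE.abstrX n) sp) (map (QE.abstrX n) sq).
have [e' se' He'] := IH (qatoms psi).
have := same_signs_eval He'.
rewrite map_CcountGt0 !QE.eval_CcountGt0 -!map_comp.
case: qe_rcf_th.ccount_gt0P => [_|].
  move=> /esym/qe_rcf_th.ccount_gt0P[x']; rewrite !big_map !big_all.
  move=> /andP[sp0 sq0].
  exists (rcons e' x'); first by rewrite !size_rcons se'.
  have {}sp0 : all (fun t => QE.eval (rcons e' x') t == 0) sp.
    by apply: sub_all sp0 => t; rewrite QE.abstrXP /n -se' set_nth_size.
  have {}sq0 : all (fun t => 0 < QE.eval (rcons e' x') t) sq.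
    by apply: sub_all sq0 => t; rewrite QE.abstrXP /n -se' set_nth_size.
  move: sp0 sq0; rewrite /same_signs all_cat all_map !all_filter.
  move=> s0 s12; have := introT andP (conj s0 s12).
  rewrite -!all_predI; apply: sub_all => t /= /andP[+ /andP[]].
  rewrite -/(sg t); rewrite /sg; case: sgzP => //= _.
  - by move=> /eqP ->; rewrite sgz0.
  - by move=> _ + _ => /gtr0_sgz ->.
  - by move=> _ _; rewrite oppr_gt0 => /ltr0_sgz ->.
(* Over [F] the coordinate [x] solves the system, so the case without solution is void. *)
case; exists x; rewrite !big_map !big_all; apply/andP; split.
  rewrite all_filter; have := all_predT T; apply: sub_all => t _ /=; apply/implyP.
  by rewrite map_abstrX QE.abstrXP set_nth_size /sg sgz_eq0.
rewrite all_cat all_map !all_filter; apply/andP; split;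
  have := all_predT T; apply: sub_all => t _ /=; apply/implyP;
  rewrite ?map_OppPoly map_abstrX ?QE.eval_OppPoly ?hornerN QE.abstrXP set_nth_size /sg.
  by rewrite sgz_cp0.
by rewrite sgz_cp0 oppr_gt0.
Qed.

End Transfer.

Lemma mpoly_qterm (K : rcfType) m (p : mpoly m K) :
  exists t : QE.term K, forall (L : rcfType) (i : {rmorphism K -> L}) v,
    QE.eval [seq v k | k <- enum 'I_m] (map_qterm i t) = mmap i v p.
Proof.
have nthv (L : rcfType) (v : 'I_m -> L) (k : 'I_m) :
    [seq v k | k <- enum 'I_m]`_k = v k.
  have lt : (k < size (enum 'I_m))%N by rewrite size_enum_ord.
  by apply: etrans (nth_map k 0 v lt) _; rewrite nth_ord_enum.
elim/mpolyind: p => [|c a p _ _ [t Ht]].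
  by exists (QE.Const 0) => L i v; rewrite /= mmap0 rmorph0.
have [u Hu] : exists u : QE.term K, forall (L : rcfType)
    (i : {rmorphism K -> L}) v,
    QE.eval [seq v k | k <- enum 'I_m] (map_qterm i u) = mmap1 v a.
  rewrite /mmap1; elim: (index_enum _) => [|k s [u Hu]].
    by exists (QE.Const 1) => L i v; rewrite big_nil /= rmorph1.
  exists (QE.Mul (QE.Exp (QE.Var _ k) (a k)) u) => L i v.
  by rewrite big_cons /= Hu nthv.
exists (QE.Add (QE.Mul (QE.Const c) u) t) => L i v.
by rewrite /= Ht Hu mmapD mmapZ mmapX.
Qed.

(** The only result of quantifier elimination used below; [transfer] is its reformulation for
    families of matrices. *)
Theorem sign_transfer (K F : rcfType) (i : {rmorphism K -> F}) m
    (s : seq (mpoly m K)) (v : 'I_m -> F) :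
  exists v' : 'I_m -> K, forall p, p \in s ->
    sgz (mmap i v p) = sgz (mmap idfun v' p).
Proof.
have [T HT] : exists T : seq (QE.term K), forall e', size e' = m ->
    same_signs i [seq v k | k <- enum 'I_m] e' T ->
    forall p, p \in s -> sgz (mmap i v p) = sgz (mmap idfun (fun k => e'`_k) p).
  elim: s => [|p s [T HT]]; first by exists [::].
  have [t Ht] := mpoly_qterm p; exists (t :: T) => e' se' /= /andP[/eqP Ep eT] q.
  rewrite inE => /orP[/eqP ->|]; last exact: HT.
  rewrite -Ht Ep -(Ht _ idfun).
  have -> : [seq e'`_(val k) | k <- enum 'I_m] = e'.
    apply: (@eq_from_nth _ 0) => [|j]; rewrite size_map size_enum_ord // => lt.
    have lt' : (j < size (enum 'I_m))%N by rewrite size_enum_ord.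
    apply: etrans (nth_map (Ordinal lt) 0 (fun k : 'I_m => e'`_(val k)) lt') _.
    by congr e'`_ _; apply: (nth_enum_ord _ lt).
  congr (sgz (QE.eval _ _)); elim: {Ht Ep eT} t => //=.
  - by move=> ? <- ? <-.
  - by move=> ? <-.
  - by move=> ? <-.
  - by move=> ? <- ? <-.
  - by move=> ? <-.
have [e' se' He'] := same_signs_ex i [seq v k | k <- enum 'I_m] T.
by exists (fun k => e'`_k); apply: HT => //; rewrite se' size_map size_enum_ord.
Qed.

Lemma mmap_rmorph (K L L' : fieldType) m (i : {rmorphism K -> L}) (f : {rmorphism L -> L'})
    (j : K -> L') (v : 'I_m -> L) (p : mpoly m K) : f \o i =1 j ->
  mmap j (fun k => f (v k)) p = f (mmap i v p).
Proof.
move=> ij; rewrite /mmap rmorph_sum; apply: eq_bigr => a _; rewrite rmorphM /= -ij.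
by congr (_ * _); rewrite /mmap1 rmorph_prod; apply: eq_bigr => k _; rewrite rmorphXn.
Qed.

Lemma eval_mx_map (K L L' : fieldType) n (i : {rmorphism K -> L})
    (f : {rmorphism L -> L'}) (j : K -> L') (M : 'M[L]_n) p :
  f \o i =1 j -> eval_mx j (map_mx f M) p = f (eval_mx i M p).
Proof.
move=> fi; rewrite /eval_mx -(mmap_rmorph _ _ fi); congr mmap.
by apply/funext => l; rewrite -map_mxvec mxE.
Qed.

Section Definable.
Variables (K : rcfType) (I : finType) (n : nat).

Definition nvar := #|{: I * ('I_n * 'I_n)}|.

Definition point (L : Type) (V : I -> 'M[L]_n) (j : 'I_nvar) : L :=
  let t := enum_val j in V t.1 t.2.1 t.2.2.

Local Notation evp i V := (mmap i (point V)).

(* Functions of a family of matrices that are given by polynomials over [K],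
   uniformly in the real closed extension [L] of [K]. *)
Definition polyfun :=
  forall (L : rcfType) (i : {rmorphism K -> L}), (I -> 'M[L]_n) -> L.
Definition mxpolyfun :=
  forall (L : rcfType) (i : {rmorphism K -> L}), (I -> 'M[L]_n) -> 'M[L]_n.
Definition is_pol (f : polyfun) := exists b, forall L i V, f L i V = evp i V b.
Definition is_mxpol (f : mxpolyfun) :=
  exists B : 'M[mpoly nvar K]_n, forall L i V, f L i V = map_mx (evp i V) B.

Lemma mxpol_var c : is_mxpol (fun L i V => V c).
Proof.
exists (\matrix_(a, b) mpolyX K (mnm1 (enum_rank (c, (a, b))))) => L i V.
apply/matrixP => a b; rewrite !mxE mmapX mmap1U /point enum_rankK //.
Qed.

Lemma mxpol_const (M : 'M[K]_n) : is_mxpol (fun L i V => map_mx i M).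
Proof.
exists (map_mx (@mpolyC _ _) M) => L i V; apply/matrixP => a b.
by rewrite !mxE mmapC.
Qed.

Lemma mxpolM f g : is_mxpol f -> is_mxpol g ->
  is_mxpol (fun L i V => f L i V *m g L i V).
Proof.
by move=> [B HB] [C HC]; exists (B *m C) => L i V; rewrite HB HC map_mxM.
Qed.

Lemma mxpolB f g : is_mxpol f -> is_mxpol g ->
  is_mxpol (fun L i V => f L i V - g L i V).
Proof.
by move=> [B HB] [C HC]; exists (B - C) => L i V; rewrite HB HC map_mxB.
Qed.

Lemma mxpolT f : is_mxpol f -> is_mxpol (fun L i V => (f L i V)^T).
Proof. by move=> [B HB]; exists B^T => L i V; rewrite HB map_trmx. Qed.

Lemma mxpolZ c f : is_mxpol f -> is_mxpol (fun L i V => i c *: f L i V).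
Proof.
move=> [B HB]; exists (mpolyC _ c *: B) => L i V; rewrite HB map_mxZ.
by congr (_ *: _); rewrite /= mmapC.
Qed.

Lemma mxpol_sum J (r : seq J) (f : J -> mxpolyfun) :
  (forall j, is_mxpol (f j)) -> is_mxpol (fun L i V => \sum_(j <- r) f j L i V).
Proof.
move=> Hf; elim: r => [|j r [B HB]].
  by exists 0 => L i V; rewrite big_nil map_mx0.
have [C HC] := Hf j.
by exists (C + B) => L i V; rewrite big_cons map_mxD -HB -HC.
Qed.

Lemma mxpol_mask (P : rel 'I_n) f : is_mxpol f ->
  is_mxpol (fun L i V => \matrix_(a, b) (if P a b then f L i V a b else 0)).
Proof.
move=> [B HB]; exists (\matrix_(a, b) (if P a b then B a b else 0)) => L i V.
by apply/matrixP => a b; rewrite !mxE HB; case: ifP; rewrite ?mxE ?rmorph0.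
Qed.

Lemma pol_entry f a b : is_mxpol f -> is_pol (fun L i V => f L i V a b).
Proof. by move=> [B HB]; exists (B a b) => L i V; rewrite HB mxE. Qed.

Lemma pol_det f : is_mxpol f -> is_pol (fun L i V => \det (f L i V)).
Proof. by move=> [B HB]; exists (\det B) => L i V; rewrite HB det_map_mx. Qed.

Lemma pol_const c : is_pol (fun L i V => i c).
Proof. by exists (mpolyC _ c) => L i V; rewrite mmapC. Qed.

Lemma polB f g : is_pol f -> is_pol g -> is_pol (fun L i V => f L i V - g L i V).
Proof.
by move=> [b Hb] [c Hc]; exists (b - c) => L i V; rewrite Hb Hc rmorphB.
Qed.

Lemma polM f g : is_pol f -> is_pol g -> is_pol (fun L i V => f L i V * g L i V).
Proof.
by move=> [b Hb] [c Hc]; exists (b * c) => L i V; rewrite Hb Hc rmorphM.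
Qed.

Lemma pol_eval p f : is_mxpol f -> is_pol (fun L i V => eval_mx i (f L i V) p).
Proof.
move=> [B HB]; exists (mmap (@mpolyC _ _) (fun l => mxvec B 0 l) p) => L i V.
rewrite HB /eval_mx [X in _ = mmap _ _ X]/mmap rmorph_sum.
rewrite {1}/mmap; apply: eq_bigr => m _; rewrite rmorphM /= mmapC; congr (_ * _).
by rewrite /mmap1 rmorph_prod; apply: eq_bigr => l _; rewrite rmorphXn -map_mxvec mxE.
Qed.

Definition relfun :=
  forall (L : rcfType) (i : {rmorphism K -> L}), (I -> 'M[L]_n) -> Prop.

(** Definability without formulas: the truth of [P] depends only on the signs of finitely many
    polynomials over [K], uniformly in the field. Connectives then need no syntax. *)
Definition definable (P : relfun) := exists s : seq (mpoly nvar K),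
  forall (L : rcfType) (i : {rmorphism K -> L}) V V', (forall p, p \in s -> sgz (evp i V p) = sgz (evp idfun V' p)) ->
    (P L i V <-> P K idfun V').

Lemma def_eq0 f : is_pol f -> definable (fun L i V => f L i V = 0).
Proof.
move=> [b Hb]; exists [:: b] => L i V V' /(_ b (mem_head _ _)) /eqP.
by rewrite sgz_eq !Hb => /andP[/eqP E _]; split=> /eqP; [rewrite E|rewrite -E] => /eqP.
Qed.

Lemma def_gt0 f : is_pol f -> definable (fun L i V => 0 < f L i V).
Proof.
move=> [b Hb]; exists [:: b] => L i V V' /(_ b (mem_head _ _)) /eqP.
by rewrite sgz_eq !Hb => /andP[_ /eqP ->].
Qed.

Lemma def_impl P Q : definable P -> definable Q ->
  definable (fun L i V => P L i V -> Q L i V).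
Proof.
move=> [s Hs] [t Ht]; exists (s ++ t) => L i V V' H.
have [P1 P2] : P L i V <-> P K idfun V'.
  by apply: Hs => p ps; apply: H; rewrite mem_cat ps.
have [Q1 Q2] : Q L i V <-> Q K idfun V'.
  by apply: Ht => p ps; apply: H; rewrite mem_cat ps orbT.
by split; auto.
Qed.

Lemma def_and P Q : definable P -> definable Q ->
  definable (fun L i V => P L i V /\ Q L i V).
Proof.
move=> [s Hs] [t Ht]; exists (s ++ t) => L i V V' H.
have [P1 P2] : P L i V <-> P K idfun V'.
  by apply: Hs => p ps; apply: H; rewrite mem_cat ps.
have [Q1 Q2] : Q L i V <-> Q K idfun V'.
  by apply: Ht => p ps; apply: H; rewrite mem_cat ps orbT.
by split=> -[]; auto.
Qed.

Lemma def_allseq (J : eqType) (r : seq J) (P : J -> relfun) :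
  (forall j, j \in r -> definable (P j)) ->
  definable (fun L i V => forall j, j \in r -> P j L i V).
Proof.
elim: r => [|j r IH] HP; first by exists [::].
have [|s Hs] := HP j; first exact: mem_head.
have [|t Ht] := IH; first by move=> k kr; apply: HP; rewrite inE kr orbT.
exists (s ++ t) => L i V V' H.
have [P1 P2] : P j L i V <-> P j K idfun V'.
  by apply: Hs => p ps; apply: H; rewrite mem_cat ps.
have [Q1 Q2] := Ht L i V V' (fun p ps => H p (etrans (mem_cat _ _ _)
  (introT orP (or_intror ps)))).
split=> HH k; rewrite inE => /orP[/eqP ->|kr].
- by apply/P1/HH/mem_head.
- by apply: Q1 => // l lr; apply: HH; rewrite inE lr orbT.
- by apply/P2/HH/mem_head.
- by apply: Q2 => // l lr; apply: HH; rewrite inE lr orbT.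
Qed.

Lemma def_all (J : finType) (P : J -> relfun) :
  (forall j, definable (P j)) -> definable (fun L i V => forall j, P j L i V).
Proof.
move=> HP; have [s Hs] := @def_allseq J (enum J) P (fun j _ => HP j).
exists s => L i V V' /Hs[H1 H2]; split=> H j.
  by apply: H1 => //; rewrite mem_enum.
by apply: H2 => //; rewrite mem_enum.
Qed.

Lemma def_exseq (J : eqType) (r : seq J) (P : J -> relfun) :
  (forall j, definable (P j)) ->
  definable (fun L i V => exists2 j, j \in r & P j L i V).
Proof.
(* [1 = 0] serves as falsity, so that the existential is obtained as the negation of a universal
   statement. *)
move=> HP; have [j _|s Hs] := @def_allseq J r (fun j L i V => P j L i V -> 1 = 0 :> L).
  apply: def_impl (HP j) _.
  have [b Hb] := pol_const 1.
  by apply: def_eq0; exists b => L i V; rewrite -Hb rmorph1.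
exists s => L i V V' /Hs [H1 H2]; split=> -[j jr Pj]; apply: contrapT => nP.
  have /H2 /(_ j jr Pj) /eqP : forall k, k \in r -> P k K idfun V' -> 1 = 0 :> K.
    by move=> k kr Pk; case: nP; exists k.
  by rewrite oner_eq0.
have /H1 /(_ j jr Pj) /eqP : forall k, k \in r -> P k L i V -> 1 = 0 :> L.
  by move=> k kr Pk; case: nP; exists k.
by rewrite oner_eq0.
Qed.

Lemma def_mxeq f g : is_mxpol f -> is_mxpol g ->
  definable (fun L i V => f L i V = g L i V).
Proof.
move=> Hf Hg.
have [|s Hs] := @def_all 'I_n (fun a L i V => forall b, f L i V a b - g L i V a b = 0).
  by move=> a; apply: def_all => b; apply/def_eq0/polB; apply: pol_entry.
exists s => L i V V' /Hs[H1 H2]; split=> E.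
  apply/matrixP => a b; apply/eqP; rewrite -subr_eq0; apply/eqP; apply: H1.
  by move=> c d; rewrite E subrr.
apply/matrixP => a b; apply/eqP; rewrite -subr_eq0; apply/eqP; apply: H2.
by move=> c d; rewrite E subrr.
Qed.

Lemma def_zeros (G : seq (mxpoly K n)) f : is_mxpol f ->
  definable (fun L i V => zeros i [set` G] (f L i V)).
Proof.
by move=> Hf; apply: def_allseq => p _; apply/def_eq0/pol_eval.
Qed.

Lemma def_sa (d : sa_formula K n) f : is_mxpol f ->
  definable (fun L i V => sa_points i d (f L i V)).
Proof.
move=> Hf; apply: def_exseq => c; apply: def_and; apply: def_allseq => p _.
  exact/def_eq0/pol_eval.
exact/def_gt0/pol_eval.
Qed.

(** A point over [L] is replaced by a point over [K] with the same signs. Hypotheses on the point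
    have to be part of [P]. *)
Theorem transfer (P : relfun) : definable P -> (forall V, P K idfun V) ->
  forall L i V, P L i V.
Proof.
move=> [s Hs] PK L i V; have [v' Hv'] := sign_transfer i s (point V).
pose V' c := \matrix_(a, b) v' (enum_rank (c, (a, b))).
apply/(Hs L i V V') => // p ps; rewrite Hv' //; congr (sgz (mmap _ _ _)).
by apply/funext => j; rewrite /point mxE -!surjective_pairing enum_valK.
Qed.

End Definable.

(** * Simultaneous diagonalization *)

Section RealSpectral.
Variable K : rcfType.
Implicit Types n : nat.

Lemma dot_ge0 n (u : 'rV[K]_n) : 0 <= (u *m u^T) 0 0.
Proof. by rewrite mxE sumr_ge0 // => i _; rewrite mxE -expr2 sqr_ge0. Qed.

Lemma dot_eq0 n (u : 'rV[K]_n) : (u *m u^T) 0 0 = 0 -> u = 0.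
Proof.
rewrite mxE => /eqP; rewrite psumr_eq0; last by move=> i _; rewrite mxE -expr2 sqr_ge0.
move=> /allP H; apply/rowP => i; apply/eqP.
by have := H i (mem_index_enum _); rewrite !mxE mulf_eq0 orbb.
Qed.

(** [v] is the conjugate transpose of [u], so [u *m v] is a nonzero sum of squared moduli; symmetry
    makes its multiples by [z] and by the conjugate of [z] equal. *)
Lemma sym_eigenvalue_real n (A : 'M[K]_n) (u : 'rV[K[i]]_n) (z : K[i]) :
  A^T = A -> u != 0 -> u *m map_mx (real_complex K) A = z *: u ->
  exists x, z = real_complex K x.
Proof.
move=> sA u0 uA; pose v := map_mx Num.conj u^T.
have cA : map_mx Num.conj (map_mx (real_complex K) A) = map_mx (real_complex K) A.
  apply/matrixP => a b; rewrite !mxE /=; apply/CrealP.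
  by apply/complex_realP; exists (A a b).
have vA : map_mx (real_complex K) A *m v = Num.conj z *: v.
  have := congr1 (fun M => map_mx Num.conj M^T) uA.
  by rewrite /= trmx_mul map_mxM linearZ /= map_mxZ map_trmx sA cA.
have E : z *: (u *m v) = Num.conj z *: (u *m v).
  by rewrite scalemxAl -uA -mulmxA vA -scalemxAr.
have nz : (u *m v) 0 0 != 0.
  rewrite mxE; apply: contra u0; rewrite psumr_eq0; last first.
    by move=> i _; rewrite !mxE mul_conjC_ge0.
  move=> /allP H; apply/eqP/rowP => i; apply/eqP.
  by have := H i (mem_index_enum _); rewrite !mxE mul_conjC_eq0.
suff /complex_realP[x ->] : z \is Num.real by exists x.
apply/CrealP; apply: (mulIf nz).
by have /matrixP/(_ 0 0) := E; rewrite [LHS]mxE [RHS]mxE => ->.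
Qed.

(** The matrix [B] of the restriction to [W] need not be symmetric. Its complex eigenvalues are real
    because they are eigenvalues of [A] itself. *)
Lemma sym_stable_eigen n (A W : 'M[K]_n) : A^T = A -> W != 0 -> stablemx W A ->
  exists a, (W :&: eigenspace A a)%MS != 0.
Proof.
move=> sA W0 WA; pose r := \rank W; have r0 : (0 < r)%N by rewrite lt0n mxrank_eq0.
pose V := row_base W; have VA : stablemx V A by rewrite stablemx_row_base.
pose B := V *m A *m pinvmx V.
have BV : B *m V = V *m A by rewrite mulmxKpV.
have [z /eigenvalueP[w wB w0]] := eigenvalue_closed (map_mx (real_complex K) B) r0.
pose u := w *m map_mx (real_complex K) V.
have u0 : u != 0.
  by rewrite mulmx_free_eq0 // /row_free mxrank_map; apply: row_base_free.
have [|x zx] := @sym_eigenvalue_real n A u z sA u0.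
  by rewrite /u -mulmxA -map_mxM -BV map_mxM mulmxA wB scalemxAl.
have /eigenvalueP[y yB y0] : eigenvalue B x.
  rewrite -(eigenvalue_map (real_complex K)); apply/eigenvalueP.
  by exists w => //; rewrite wB zx.
exists x; apply/negP => /eqP H0.
have : (y *m V <= W :&: eigenspace A x)%MS.
  rewrite sub_capmx; apply/andP; split.
    by rewrite (submx_trans (submxMl _ _)) // eq_row_base.
  by apply/eigenspaceP; rewrite -mulmxA -BV mulmxA yB scalemxAl.
by rewrite H0 submx0 mulmx_free_eq0 ?row_base_free // (negbTE y0).
Qed.

Definition comm_sym_family n (As : set 'M[K]_n) :=
  (forall A, As A -> A^T = A) /\ (forall A B, As A -> As B -> A *m B = B *m A).

(* In a nonzero invariant subspace of minimal dimension every vector is a common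
   eigenvector, as the eigenspaces are invariant. *)
Lemma comm_sym_eigenvector n (As : set 'M[K]_n) : (0 < n)%N ->
  comm_sym_family As ->
  exists2 v : 'rV[K]_n, v != 0 & forall A, As A -> exists a, v *m A = a *: v.
Proof.
move=> n0 [sAs cAs].
pose P r := `[< exists W : 'M[K]_n, [/\ \rank W = r, W != 0 &
  forall A, As A -> stablemx W A] >].
have exP : exists r, P r.
  exists n; apply/asboolP; exists 1%:M; split; first exact: mxrank1.
    by rewrite -mxrank_eq0 mxrank1 -lt0n.
  by move=> A _; apply: stableCmx.
case: (ex_minnP exP) => r /asboolP[W [rW W0 WAs]] rmin.
have [v vW v0] : exists2 v : 'rV_n, (v <= W)%MS & v != 0.
  by have /rowV0Pn[v] := W0; exists v.
exists v => // A AA.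
have [a Ha] := sym_stable_eigen (sAs A AA) W0 (WAs A AA); exists a.
apply/eigenspaceP; apply: submx_trans vW _.
have : P (\rank (W :&: eigenspace A a)%MS).
  apply/asboolP; exists (W :&: eigenspace A a)%MS; split=> // B BB.
  rewrite sub_capmx (submx_trans (submxMr _ (capmxSl _ _)) (WAs B BB)) /=.
  apply: submx_trans (submxMr _ (capmxSr _ _)) _.
  by apply: comm_mx_stable_eigenspace; apply: cAs.
move=> /rmin; rewrite -rW => le; rewrite (geq_leqif (mxrank_leqif_sup (capmxSl W (eigenspace A a)))) in le.
exact: submx_trans le (capmxSr _ _).
Qed.

(** [Q] is the reflection exchanging the first basis vector [e] with [v]; the line it negates is
    spanned by [w = e - v], so the case [w = 0] is separate. *)
Lemma householder n (v : 'rV[K]_(1 + n)) : v *m v^T = 1%:M ->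
  exists2 Q : 'M[K]_(1 + n), Q *m Q^T = 1%:M & row 0 Q = v.
Proof.
move=> v1; pose e : 'rV[K]_(1 + n) := delta_mx 0 0.
have e1 : e *m e^T = 1%:M.
  by rewrite /e trmx_delta mul_delta_mx; apply/matrixP => i j; rewrite !ord1 !mxE.
pose w := e - v; have [w0|w0] := eqVneq w 0.
  exists 1%:M; first by rewrite trmx1 mulmx1.
  by rewrite row1; apply/esym/eqP; rewrite -subr_eq0 -opprB oppr_eq0; apply/eqP.
pose c := (w *m w^T) 0 0.
have c0 : c != 0 by apply: contra w0 => /eqP/dot_eq0 ->.
have wwT : w *m w^T = c%:M by apply/matrixP => i j; rewrite !ord1 [RHS]mxE eqxx.
pose Q := 1%:M - (2 / c) *: (w^T *m w).
have QT : Q^T = Q by rewrite linearB linearZ /= trmx1 trmx_mul trmxK.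
(* Both products are half of [c] up to sign, as [e] and [v] have the same length. *)
have wv : w *m v^T = (- (c / 2))%:M /\ e *m w^T = (c / 2)%:M.
  have [x Ex] : exists x, e *m v^T = x%:M.
    exists ((e *m v^T) 0 0); apply/matrixP => i j; rewrite !ord1 [RHS]mxE eqxx //.
  have Ex' : v *m e^T = x%:M by rewrite -[v]trmxK -trmx_mul Ex tr_scalar_mx.
  have /matrixP/(_ 0 0) : w *m w^T = (2 - 2 * x)%:M.
    rewrite /w linearB /= mulmxBr !mulmxBl e1 v1 Ex Ex' opprB -!raddfB -raddfD /=.
    by congr _%:M; ring.
  rewrite -/c [RHS]mxE eqxx mulr1n => Ec.
  rewrite mulmxBl Ex v1 linearB /= mulmxBr e1 Ex -!raddfB /=.
  by split; congr _%:M; rewrite Ec; field.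
exists Q.
  rewrite QT; pose k := 2 / c; pose M := w^T *m w.
  have MM : M *m M = c *: M.
    by rewrite /M mulmxA -[_ *m w *m w^T]mulmxA wwT mul_mx_scalar -scalemxAl.
  rewrite /Q -/M -/k mulmxBr mulmx1 -scalemxAr mulmxBl mul1mx -scalemxAl MM.
  rewrite scalerBr !scalerA -addrA -[RHS]addr0; congr (_ + _).
  rewrite -scalerBl -opprD -scalerDl (_ : _ + _ = 0) ?scale0r ?oppr0 //.
  by rewrite /k; field.
rewrite rowE mulmxBr mulmx1 -/e -scalemxAr mulmxA wv.2 mul_scalar_mx scalerA.
rewrite (_ : 2 / c * (c / 2) = 1); last by field.
by rewrite scale1r /w opprB addrCA subrr addr0.
Qed.

Lemma unit_vector n (v : 'rV[K]_n) : v != 0 ->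
  exists2 c, c != 0 & (c *: v) *m (c *: v)^T = 1%:M.
Proof.
move=> v0; pose s := (v *m v^T) 0 0.
have s0 : 0 < s.
  by rewrite lt0r dot_ge0 andbT; apply: contra v0 => /eqP/dot_eq0 ->.
have r0 : Num.sqrt s != 0 by rewrite gt_eqF // sqrtr_gt0.
exists (Num.sqrt s)^-1; first by rewrite invr_eq0.
rewrite linearZ /= -scalemxAl -scalemxAr scalerA -invfM -expr2 sqr_sqrtr ?ltW //.
apply/matrixP => i j; rewrite !ord1 mxE [RHS]mxE eqxx -/s mulVf //.
by rewrite gt_eqF.
Qed.

(** A common unit eigenvector, completed to an orthogonal matrix, splits a block of size one off
    every member by symmetry; the complementary blocks form a commuting symmetric family again. *)
Theorem comm_sym_codiag n (As : set 'M[K]_n) : comm_sym_family As ->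
  exists2 Q : 'M[K]_n, Q *m Q^T = 1%:M &
    forall A, As A -> exists d, Q *m A *m Q^T = diag_mx d.
Proof.
elim: n As => [|n IH] As cAs.
  exists 1%:M; first by apply/matrixP => -[].
  by move=> A _; exists 0; apply/matrixP => -[].
have [v v0 Hv] := comm_sym_eigenvector (ltn0Sn n) cAs.
have [c c0 v1] := unit_vector v0.
have [H HH Hr] := @householder n _ v1.
have HtH : H^T *m H = 1%:M by apply: mulmx1C.
have H0 A : As A -> exists2 a, H *m A *m H^T =
    block_mx a%:M 0 0 (drsubmx (H *m A *m H^T : 'M[K]_(1 + n))) &
    (drsubmx (H *m A *m H^T : 'M[K]_(1 + n)))^T = drsubmx (H *m A *m H^T : 'M[K]_(1 + n)).
  move=> AA; have [a Ha] := Hv A AA.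
  have [B EB] : exists B : 'M[K]_(1 + n), B = H *m A *m H^T by eexists.
  have sB : B^T = B by rewrite EB !trmx_mul trmxK cAs.1 // mulmxA.
  have rB : row 0 B = a *: delta_mx 0 0.
    rewrite EB !row_mul Hr -scalemxAl Ha scalerA [c * a]mulrC -scalerA -Hr.
    by rewrite -scalemxAl -row_mul HH row1.
  exists a; last by rewrite trmx_drsub -EB sB.
  rewrite -EB -[LHS]submxK; congr (block_mx _ _ _ _).
  - apply/matrixP => i j; rewrite !ord1 !mxE.
    have /matrixP/(_ 0 0) := rB; rewrite !mxE eqxx mulr1 => <-.
    by congr (B _ _); apply/val_inj.
  - apply/matrixP => i j; rewrite !ord1 !mxE.
    have /matrixP/(_ 0 (rshift 1 j)) := rB; rewrite !mxE /= mulr0 => <-.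
    by congr (B _ _); apply/val_inj.
  - rewrite -sB -trmx_ursub -[RHS]trmx0; congr (_^T).
    apply/matrixP => i j; rewrite !ord1 !mxE.
    have /matrixP/(_ 0 (rshift 1 j)) := rB; rewrite !mxE /= mulr0 => <-.
    by congr (B _ _); apply/val_inj.
pose As' := [set drsubmx (H *m A *m H^T : 'M[K]_(1 + n)) | A in As].
have [|Q QQ HQ] := IH As'.
  split; first by move=> _ [A AA <-]; have [a] := H0 A AA.
  move=> _ _ [A AA <-] [B BB <-].
  have [a Ea _] := H0 A AA; have [b Eb _] := H0 B BB.
  have E : (H *m A *m H^T) *m (H *m B *m H^T) = (H *m B *m H^T) *m (H *m A *m H^T).
    rewrite !mulmxA -[_ *m H^T *m H]mulmxA HtH mulmx1 -[H *m A *m B]mulmxA.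
    by rewrite (cAs.2 A B) // -[_ *m H^T *m H]mulmxA HtH mulmx1 !mulmxA.
  rewrite Ea Eb !mulmx_block !mul0mx !mulmx0 !add0r in E.
  by have [] := eq_block_mx E.
pose D : 'M[K]_(1 + n) := block_mx 1%:M 0 0 Q.
have ED : D^T = block_mx 1%:M 0 0 Q^T by rewrite /D tr_block_mx trmx1 !trmx0.
have DD : D *m D^T = 1%:M.
  rewrite ED mulmx_block !(mul0mx, mulmx0, add0r, addr0) mulmx1 QQ.
  by rewrite -scalar_mx_block.
exists (D *m H).
  by rewrite trmx_mul mulmxA -[_ *m H *m H^T]mulmxA HH mulmx1.
move=> A AA; have [a Ea _] := H0 A AA.
have [|d Hd] := HQ (drsubmx (H *m A *m H^T : 'M[K]_(1 + n))); first by exists A.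
exists (row_mx a%:M d).
have -> : D *m H *m A *m (D *m H)^T = D *m (H *m A *m H^T) *m D^T.
  by rewrite trmx_mul !mulmxA.
rewrite Ea ED /D !mulmx_block !(mul0mx, mulmx0, add0r, addr0).
rewrite mulmx1 mul1mx Hd; have Ed := diag_mx_row (a%:M : 'rV_1) d.
apply: (etrans _ (esym Ed)); congr block_mx.
by apply/matrixP => i j; rewrite !ord1 !mxE.
Qed.

End RealSpectral.

(** * Tensor representations *)

Section TensorPower.
Variables (T0 : finType) (d : nat).
Notation T := {ffun 'I_d -> T0}.
(** A basis of the tensor power is indexed by the maps from ['I_d] to [T0]; numbering them gives
    ordinary matrices. *)
Definition tdim := #|{: T}|.
Definition tix (s : 'I_tdim) : T := enum_val s.

Lemma big_tix (R : nmodType) (F : T -> R) : \sum_s F (tix s) = \sum_f F f.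
Proof. by rewrite [RHS](reindex tix) //; apply/onW_bij/enum_val_bij. Qed.

Lemma tix_inj : injective tix. Proof. exact: enum_val_inj. Qed.

Lemma tix_surj f : exists s, tix s = f.
Proof. by exists (enum_rank f); rewrite /tix enum_rankK. Qed.

Section Ring.
Variable R : comNzRingType.
Implicit Types (A B : 'I_d -> T0 -> T0 -> R).

Definition kmul (a b : T0 -> T0 -> R) p q := \sum_o a p o * b o q.
Definition kone (p q : T0) : R := (p == q)%:R.

(** The Kronecker product of the matrices [A k]. *)
Definition tens A : 'M[R]_tdim := \matrix_(s, t) \prod_k A k (tix s k) (tix t k).

Lemma eq_tens A B : (forall k p q, A k p q = B k p q) -> tens A = tens B.
Proof. by move=> AB; apply/matrixP => s t; rewrite !mxE; apply: eq_bigr. Qed.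

Lemma tensM A B : tens A *m tens B = tens (fun k => kmul (A k) (B k)).
Proof.
apply/matrixP => s t; rewrite !mxE.
rewrite bigA_distr_bigA -(big_tix (fun f : T => \prod_k (A k (tix s k) (f k) *
  B k (f k) (tix t k)))).
by apply: eq_bigr => w _; rewrite !mxE big_split.
Qed.

Lemma tens1 : tens (fun=> kone) = 1%:M.
Proof.
apply/matrixP => s t; rewrite !mxE /kone.
have [->|st] := eqVneq s t; first by rewrite big1 // => k _; rewrite eqxx.
have [k kst] : exists k, tix s k != tix t k.
  apply/existsP; apply: contraNT st => /existsPn H.
  by apply/eqP/tix_inj/ffunP => k; apply/eqP; have := H k; rewrite negbK.
by rewrite (bigD1 k) //= (negbTE kst) mul0r.
Qed.

(* The derivative of the diagonal tensor power at [a] in the direction [b]. *)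
Definition dtens (a b : T0 -> T0 -> R) : 'M[R]_tdim :=
  \sum_k tens (fun j => if j == k then b else a).

Lemma dtensl a b c : tens (fun=> c) *m dtens a b = dtens (kmul c a) (kmul c b).
Proof.
rewrite mulmx_sumr; apply: eq_bigr => k _; rewrite tensM.
by apply: eq_tens => j p q; case: eqP.
Qed.

Lemma dtensr a b c : dtens a b *m tens (fun=> c) = dtens (kmul a c) (kmul b c).
Proof.
rewrite mulmx_suml; apply: eq_bigr => k _; rewrite tensM.
by apply: eq_tens => j p q; case: eqP.
Qed.

Lemma eq_dtens a a' b b' : (forall p q, a p q = a' p q) ->
  (forall p q, b p q = b' p q) -> dtens a b = dtens a' b'.
Proof.
by move=> aa bb; apply: eq_bigr => k _; apply: eq_tens => j p q; case: eqP.
Qed.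

Lemma tens_if a b k s t : tens (fun j => if j == k then b else a) s t =
  b (tix s k) (tix t k) * \prod_(j | j != k) a (tix s j) (tix t j).
Proof.
rewrite mxE (bigD1 k) //= eqxx.
by congr (_ * _); apply: eq_bigr => j /negbTE ->.
Qed.

Lemma dtensP a x b c :
  dtens a (fun p q => x * b p q + c p q) = x *: dtens a b + dtens a c.
Proof.
rewrite /dtens scaler_sumr -big_split; apply: eq_bigr => k _ /=.
apply/matrixP => s t; rewrite tens_if [RHS]mxE [in RHS]mxE !tens_if.
by rewrite mulrDl mulrA.
Qed.

Lemma dtens_entry a b s t : dtens a b s t =
  \sum_k b (tix s k) (tix t k) * \prod_(j | j != k) a (tix s j) (tix t j).
Proof. by rewrite /dtens summxE; apply: eq_bigr => k _; rewrite tens_if. Qed.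

End Ring.

Lemma map_tens (R R' : comNzRingType) (f : {rmorphism R -> R'}) A :
  map_mx f (tens A) = tens (fun k p q => f (A k p q)).
Proof. by apply/matrixP => s t; rewrite !mxE rmorph_prod. Qed.

Lemma deriv_prod (R : comNzRingType) (I : finType) (F : I -> {poly R}) :
  (\prod_i F i)^`() = \sum_k (F k)^`() * \prod_(j | j != k) F j.
Proof.
have H (r : seq I) : uniq r -> (\prod_(i <- r) F i)^`() =
    \sum_(k <- r) (F k)^`() * \prod_(j <- r | j != k) F j.
  elim: r => [|i r IH] /=; first by rewrite !big_nil derivC.
  move=> /andP[ir ur]; rewrite !big_cons derivM eqxx /= IH // mulr_sumr.
  congr (_ * _ + _).
    by rewrite [in RHS]big_seq_cond [in LHS]big_seq; apply: eq_bigl => j /=;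
      case: eqP => [->|]; rewrite ?(negbTE ir) ?andbT.
  rewrite !big_seq; apply: eq_bigr => k kr; rewrite big_cons.
  by case: eqP => [ik|_]; [rewrite ik kr in ir|rewrite mulrCA].
by rewrite H ?index_enum_uniq.
Qed.

Lemma deriv_tens (R : comNzRingType) (a : T0 -> T0 -> {poly R}) :
  map_mx (@deriv R) (tens (fun=> a)) = dtens a (fun p q => (a p q)^`()).
Proof. by apply/matrixP => s t; rewrite dtens_entry !mxE deriv_prod. Qed.

End TensorPower.

Section PolyRep.
Variables (n d : nat).
Notation T0 := (unit + 'I_n * 'I_n)%type.
Notation N := (tdim T0 d).

Section Ring.
Variable R : comNzRingType.
Implicit Types g h x y : 'M[R]_n.

(* Right multiplication by [g] on the space spanned by the constant function
   and the matrix entries; [kext0] is its derivative at the identity. *)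
Definition kext g (p q : T0) : R :=
  match p, q with
  | inl _, inl _ => 1
  | inr (i, j), inr (k, l) => if i == k then g j l else 0
  | _, _ => 0
  end.

Definition kext0 g (p q : T0) : R :=
  match p, q with
  | inr (i, j), inr (k, l) => if i == k then g j l else 0
  | _, _ => 0
  end.

(** The constant function in the space lets all monomials of degree at most [d], and not only those
    of degree [d], occur in its tensor power; [drho] is the differential of [rho] at the
    identity. *)
Definition rho g : 'M[R]_N := tens (fun _ : 'I_d => kext g).
Definition drho y : 'M[R]_N := dtens d (kext 1%:M) (kext0 y).

Lemma kmul_ext_sum (a b : T0 -> T0 -> R) p q :
  kmul a b p q = a p (inl tt) * b (inl tt) q +
    \sum_i \sum_j a p (inr (i, j)) * b (inr (i, j)) q.
Proof.
rewrite /kmul big_sumType /=; congr (_ + _).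
  by rewrite (bigD1 tt) //= big1 ?addr0 // => -[].
by rewrite pair_bigA; apply: eq_bigr => -[].
Qed.

Lemma sum_if_row (i : 'I_n) (F : 'I_n -> 'I_n -> R) :
  \sum_k \sum_l (if i == k then F k l else 0) = \sum_l F i l.
Proof.
rewrite (bigD1 i) //= [X in _ + X]big1 ?addr0; last first.
  by move=> k ki; rewrite big1 // => l _; rewrite eq_sym (negbTE ki).
by apply: eq_bigr => l _; rewrite eqxx.
Qed.

Lemma sum_kext_rows g h (i j k l : 'I_n) :
  \sum_a \sum_b (if i == a then g j b else 0) * (if a == k then h b l else 0) =
  if i == k then (g *m h) j l else 0.
Proof.
rewrite (eq_bigr (fun a => \sum_b
    if i == a then g j b * (if a == k then h b l else 0) else 0)); last first.
  by move=> a _; apply: eq_bigr => b _; case: eqP; rewrite ?mul0r.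
rewrite sum_if_row; case: eqP => _; first by rewrite mxE.
by rewrite big1 // => b _; rewrite mulr0.
Qed.

Lemma kextM g h p q : kmul (kext g) (kext h) p q = kext (g *m h) p q.
Proof.
rewrite kmul_ext_sum; case: p q => [[]|[i j]] [[]|[k l]] /=; rewrite ?sum_kext_rows;
  rewrite ?(mulr0, mul0r, mulr1, add0r) //;
  by rewrite big1 ?addr0 // => a _; rewrite big1 // => b _; rewrite ?mul0r ?mulr0.
Qed.

Lemma kextMl g h p q : kmul (kext g) (kext0 h) p q = kext0 (g *m h) p q.
Proof.
rewrite kmul_ext_sum; case: p q => [[]|[i j]] [[]|[k l]] /=; rewrite ?sum_kext_rows;
  rewrite ?(mulr0, mul0r, mulr1, add0r) //;
  by rewrite big1 ?addr0 // => a _; rewrite big1 // => b _; rewrite ?mul0r ?mulr0.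
Qed.

Lemma kextMr g h p q : kmul (kext0 g) (kext h) p q = kext0 (g *m h) p q.
Proof.
rewrite kmul_ext_sum; case: p q => [[]|[i j]] [[]|[k l]] /=; rewrite ?sum_kext_rows;
  rewrite ?(mulr0, mul0r, mulr1, add0r) //;
  by rewrite big1 ?addr0 // => a _; rewrite big1 // => b _; rewrite ?mul0r ?mulr0.
Qed.

Lemma kext1 p q : kext 1%:M p q = kone R p q.
Proof.
rewrite /kone; case: p q => [[]|[i j]] [[]|[k l]] //=.
rewrite (_ : (inr (i, j) == inr (k, l) :> T0) = (i == k) && (j == l)) //; case: eqP => //= _.
by rewrite mxE.
Qed.

Lemma rhoM g h : rho (g *m h) = rho g *m rho h.
Proof. by rewrite /rho tensM; apply: eq_tens => k p q; rewrite kextM. Qed.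

Lemma rho1 : rho 1%:M = 1%:M.
Proof. by rewrite -tens1; apply: eq_tens => k p q; rewrite kext1. Qed.

Lemma rho_drho g y : rho g *m drho y = dtens d (kext g) (kext0 (g *m y)).
Proof.
rewrite dtensl; apply: eq_dtens => p q; first by rewrite kextM mulmx1.
by rewrite kextMl.
Qed.

Lemma drho_rho g y : drho y *m rho g = dtens d (kext g) (kext0 (y *m g)).
Proof.
rewrite dtensr; apply: eq_dtens => p q; first by rewrite kextM mul1mx.
by rewrite kextMr.
Qed.

Lemma drho_conj g y z : g *m y = z *m g -> rho g *m drho y = drho z *m rho g.
Proof. by move=> E; rewrite rho_drho drho_rho E. Qed.

Lemma drhoP c y z : drho (c *: y + z) = c *: drho y + drho z.
Proof.
rewrite /drho -dtensP; apply: eq_dtens => // p q.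
case: p q => [[]|[i j]] [[]|[k l]] /=; rewrite ?mulr0 ?addr0 //.
by case: eqP; rewrite ?mulr0 ?addr0 // !mxE.
Qed.

Lemma drho0 : drho 0 = 0.
Proof.
have := drhoP (-1) 0 0; rewrite scaler0 addr0 scaleN1r => ->.
by rewrite addrC subrr.
Qed.

Lemma drho_sum I (r : seq I) (P : pred I) (F : I -> 'M[R]_n) :
  drho (\sum_(i <- r | P i) F i) = \sum_(i <- r | P i) drho (F i).
Proof.
apply: (big_morph drho _ drho0) => y z.
by have := drhoP 1 y z; rewrite !scale1r.
Qed.

Lemma drhoZ c y : drho (c *: y) = c *: drho y.
Proof. by have := drhoP c y 0; rewrite !addr0 drho0 addr0. Qed.

(** The diagonals of [kext] and [kext0] at [diag_mx z]. *)
Definition kval (z : 'rV[R]_n) (p : T0) : R :=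
  if p is inr (_, j) then z 0 j else 1.
Definition kval0 (z : 'rV[R]_n) (p : T0) : R :=
  if p is inr (_, j) then z 0 j else 0.

Lemma rho_diag z :
  rho (diag_mx z) = diag_mx (\row_s \prod_k kval z (tix s k)).
Proof.
apply/matrixP => s t; rewrite !mxE.
have E p q : kext (diag_mx z) p q = kval z p *+ (p == q).
  case: p q => [[]|[i j]] [[]|[k l]] //=.
  rewrite mxE (_ : (inr (i, j) == inr (k, l) :> T0) = (i == k) && (j == l)) //.
  by case: eqP => //= _; case: eqP => [->|].
have [<-|st] := eqVneq s t.
  by rewrite mulr1n; apply: eq_bigr => k _; rewrite E eqxx.
have [k kst] : exists k, tix s k != tix t k.
  apply/existsP; apply: contraNT st => /existsPn H.
  by apply/eqP/tix_inj/ffunP => k; apply/eqP; have := H k; rewrite negbK.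
by rewrite (bigD1 k) //= E (negbTE kst) mul0r.
Qed.

Lemma drho_diag z :
  drho (diag_mx z) = diag_mx (\row_s \sum_k kval0 z (tix s k)).
Proof.
apply/matrixP => s t; rewrite dtens_entry !mxE.
have E p q : kext0 (diag_mx z) p q = kval0 z p *+ (p == q).
  case: p q => [[]|[i j]] [[]|[k l]] //=.
  rewrite mxE (_ : (inr (i, j) == inr (k, l) :> T0) = (i == k) && (j == l)) //.
  by case: eqP => //= _; case: eqP => [->|].
have [<-|st] := eqVneq s t.
  rewrite mulr1n; apply: eq_bigr => k _; rewrite E eqxx big1 ?mulr1 // => j _.
  by rewrite kext1 /kone eqxx.
rewrite big1 // => k _; rewrite E.
have [kst|kst] := eqVneq (tix s k) (tix t k); last by rewrite mul0r.
have [j jst] : exists j, tix s j != tix t j.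
  apply/existsP; apply: contraNT st => /existsPn H.
  by apply/eqP/tix_inj/ffunP => j; apply/eqP; have := H j; rewrite negbK.
rewrite (bigD1 j) /=; last by apply: contraNneq jst => ->; apply/eqP.
by rewrite kext1 /kone (negbTE jst) mul0r mulr0.
Qed.

End Ring.

Lemma map_rho (R R' : comNzRingType) (f : {rmorphism R -> R'}) g :
  map_mx f (rho g) = rho (map_mx f g).
Proof.
rewrite /rho map_tens; apply: eq_tens => k p q.
case: p q => [[]|[i j]] [[]|[l m]] /=; rewrite ?rmorph1 ?rmorph0 //.
by case: eqP; rewrite ?rmorph0 // mxE.
Qed.

(** The chain rule in formal terms: [rho] carries a solution of the linear equation of [y] to a
    solution of that of [drho y]. *)
Lemma deriv_rho (R : comNzRingType) (e y : 'M[{poly R}]_n) :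
  map_mx (@deriv R) e = e *m y -> map_mx (@deriv R) (rho e) = rho e *m drho y.
Proof.
move=> ey; rewrite deriv_tens rho_drho; apply: eq_dtens => // p q.
case: p q => [[]|[i j]] [[]|[l m]] /=; rewrite ?deriv0 //; first by rewrite -polyC1 derivC.
by case: eqP; rewrite ?deriv0 // -ey mxE.
Qed.

Lemma map_drho (R R' : comNzRingType) (f : {rmorphism R -> R'}) y :
  map_mx f (drho y) = drho (map_mx f y).
Proof.
apply/matrixP => s t; rewrite mxE !dtens_entry rmorph_sum; apply: eq_bigr => k _.
rewrite rmorphM rmorph_prod; congr (_ * _).
  case: (tix s k) (tix t k) => [[]|[i j]] [[]|[l m]] /=; rewrite ?rmorph0 //.
  by case: eqP; rewrite ?rmorph0 // mxE.
by apply: eq_bigr => j _; rewrite !kext1 /kone rmorph_nat.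
Qed.

End PolyRep.

(** * Zero sets as stabilizers *)

Section Chevalley.
Variables (L : fieldType) (n : nat).
Notation T0 := (unit + 'I_n * 'I_n)%type.
Implicit Types g x : 'M[L]_n.

Definition kvec x (p : T0) : L := if p is inr (i, j) then x i j else 1.
(** All monomials of degree at most [d] in the entries of [x], with repetitions. *)
Definition monoms d x : 'rV[L]_(tdim T0 d) := \row_s \prod_k kvec x (tix s k).

Lemma kvecM x g q : \sum_o kvec x o * kext g o q = kvec (x *m g) q.
Proof.
rewrite big_sumType /= (bigD1 tt) //= big1 ?addr0; last by case.
rewrite (eq_bigr (fun p : 'I_n * 'I_n => x p.1 p.2 * kext g (inr (p.1, p.2)) q));
  last by case.
rewrite -(pair_bigA _ (fun i j => x i j * kext g (inr (i, j)) q)) /=.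
case: q => [[]|[k l]]; first by rewrite /= mulr1 big1 ?addr0 // => i _; rewrite big1 // => j _; rewrite mulr0.
rewrite /= mulr0 add0r mxE -(sum_if_row k (fun i j => x i j * g j l)); apply: eq_bigr => i _; apply: eq_bigr => j _ /=.
by rewrite eq_sym; case: eqP; rewrite ?mulr0.
Qed.

Lemma monomsM d x g : monoms d (x *m g) = monoms d x *m rho d g.
Proof.
apply/rowP => t; rewrite !mxE.
under eq_bigr do rewrite -kvecM.
rewrite bigA_distr_bigA -(big_tix (fun f : {ffun 'I_d -> T0} =>
  \prod_k (kvec x (f k) * kext g (f k) (tix t k)))).
by apply: eq_bigr => w _; rewrite ?mxE big_split.
Qed.

(** A monomial of degree at most [m] is completed to exactly [m] factors by the constant
    coordinate. *)
Lemma prod_nth_pad (I : Type) (z : I) (G : I -> L) (l : seq I) m : G z = 1 ->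
  (size l <= m)%N -> \prod_(j < m) G (nth z l j) = \prod_(p <- l) G p.
Proof.
move=> Gz; elim: l m => [|p l IH] [|m] // lm.
- by rewrite big_ord0 big_nil.
- by rewrite big_nil big1 // => j _; rewrite nth_nil.
- by rewrite big_ord_recl big_cons IH.
Qed.

Lemma monoms_eval (K : fieldType) (i : K -> L) d (p : mxpoly K n) :
  (forall m, m \in msupp p -> (mdeg m <= d)%N) ->
  exists c : 'cV[L]_(tdim T0 d), forall x, eval_mx i x p = (monoms d x *m c) 0 0.
Proof.
move=> Hp.
have H (m : multinom (n * n)) : (mdeg m <= d)%N -> exists s : 'I_(tdim T0 d),
    forall x, mmap1 (fun k => mxvec x 0 k) m = monoms d x 0 s.
  move=> md; pose r := flatten [seq nseq (m k) k | k <- enum 'I_(n * n)].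
  have rP (F : 'I_(n * n) -> L) : \prod_(k <- r) F k = \prod_k F k ^+ m k.
    rewrite /r big_flatten big_map big_enum; apply: eq_bigr => k _.
    by rewrite big_nseq -Monoid.iteropE.
  have sr : (size r <= d)%N.
    apply: leq_trans md; rewrite /r size_flatten /shape -map_comp sumnE big_map.
    rewrite big_enum mdegE; apply: leq_sum => k _ /=; by rewrite size_nseq.
  pose o (k : 'I_(n * n)) : T0 := inr (enum_val (cast_ord (esym (mxvec_cast n n)) k)).
  have vo x k : kvec x (o k) = mxvec x 0 k.
    by case/mxvec_indexP: k => a b; rewrite mxvecE /o cast_ordK enum_rankK.
  have [s Hs] := @tix_surj T0 d [ffun k : 'I_d => nth (inl tt) (map o r) k].
  exists s => x; rewrite mxE /mmap1 -rP.
  under [RHS]eq_bigr do rewrite Hs ffunE.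
  rewrite (prod_nth_pad (G := kvec x)) ?size_map // big_map.
  by apply: eq_bigr => k _; rewrite vo.
have [f Hf] : exists f : multinom (n * n) -> 'I_(tdim T0 d), forall m, m \in msupp p ->
    forall x, mmap1 (fun k => mxvec x 0 k) m = monoms d x 0 (f m).
  have [s0 _] := @tix_surj T0 d [ffun => inl tt].
  have [|f Hf] := @choice _ _ (fun m s => m \in msupp p ->
      forall x, mmap1 (fun k => mxvec x 0 k) m = monoms d x 0 s); last by exists f.
  move=> m; case: (boolP (m \in msupp p)) => [mp|_]; last by exists s0.
  by have [s Hs] := H m (Hp m mp); exists s.
exists (\sum_(m <- msupp p) i (mcoeff m p) *: delta_mx (f m) 0) => x.
rewrite mulmx_sumr summxE /eval_mx /mmap big_seq [RHS]big_seq; apply: eq_bigr => m mp.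
by rewrite -scalemxAr [RHS]mxE Hf // -colE; congr (_ * _); rewrite [RHS]mxE.
Qed.

(** The span of [X] is described by the linear equations it satisfies. A matrix of maximal rank
    obeying all equations of [X] absorbs every vector of [X], since adjoining one preserves the
    property. *)
Lemma span_exists N (X : set 'rV[L]_N) : exists E : 'M[L]_N,
  (forall v, X v -> (v <= E)%MS) /\
  (forall m (c : 'M[L]_(N, m)), (forall v, X v -> v *m c = 0) -> E *m c = 0).
Proof.
pose Q (E : 'M[L]_N) := forall m (c : 'M[L]_(N, m)), (forall v, X v -> v *m c = 0) -> E *m c = 0.
pose P r := `[< exists2 E, \rank E = r & Q E >].
have exP : exists r, P r.
  by exists 0%N; apply/asboolP; exists 0; [rewrite mxrank0|move=> m c _; rewrite mul0mx].
have bP r : P r -> (r <= N)%N by move/asboolP => [E <- _]; apply: rank_leq_row.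
case: (ex_maxnP exP bP) => r /asboolP[E rE QE] rmax; exists E; split=> // v Xv.
have : P (\rank (E + v)%MS).
  apply/asboolP; exists (E + v)%MS => // m c Hc.
  apply/eqP; rewrite -submx0 (eqmxMr _ (addsmxE _ _)) mul_col_mx QE // Hc //.
  by rewrite submx0; apply/eqP/matrixP => a b; rewrite !mxE; case: splitP => j _; rewrite mxE.
move=> /rmax; rewrite -rE => le.
rewrite (geq_leqif (mxrank_leqif_sup (addsmxSl E v))) addsmx_sub in le.
by case/andP: le.
Qed.

(* [E] is the span of the tensors of the elements of the zero set; annihilation
   of [E] by the coefficient vectors of [G] recovers the equations. *)
Lemma zeros_stabilizer (K : fieldType) (i : K -> L) (G : seq (mxpoly K n)) :
  let Z := zeros i [set` G] in
  Z 1%:M -> (forall x y, Z x -> Z y -> Z (x *m y)) ->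
  exists d (E : 'M[L]_(tdim T0 d)), forall g, Z g <-> (E *m rho d g <= E)%MS.
Proof.
move=> Z Z1 ZM.
pose d := (\sum_(p <- G) \sum_(m <- msupp p) mdeg m)%N.
have Hd p : p \in G -> forall m, m \in msupp p -> (mdeg m <= d)%N.
  move=> pG m mp; rewrite /d (big_rem p) //= (big_rem m) //=.
  by rewrite -addnA leq_addr.
have [E [E1 E2]] := @span_exists _ [set monoms d x | x in Z].
exists d, E => g; split=> [Zg|Eg].
  rewrite submxE -mulmxA; apply/eqP/E2 => _ [x Zx <-].
  apply/eqP; rewrite mulmxA -monomsM -submxE; apply: E1.
  by exists (x *m g) => //; apply: ZM.
have Egd : (monoms d g <= E)%MS.
  rewrite -[g]mul1mx monomsM; apply: submx_trans (submxMr _ _) Eg.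
  by apply: E1; exists 1%:M.
move=> p pG; have [c Hc] := monoms_eval i (Hd p pG); rewrite Hc.
have /submxP[w ->] := Egd.
rewrite -mulmxA E2 ?mulmx0 ?mxE // => _ [x Zx <-].
by apply/matrixP => a b; rewrite !ord1 -Hc [RHS]mxE; apply: Zx.
Qed.

(** An invertible matrix preserves ranks, so a stable subspace is mapped onto itself. *)
Lemma stablemx_inv m N (E : 'M[L]_(m, N)) (A : 'M[L]_N) : A \in unitmx ->
  stablemx E A -> stablemx E (invmx A).
Proof.
move=> uA EA; have rEA : \rank (E *m A) = \rank E by rewrite mxrankMfree ?row_free_unit.
have /submxP[w Ew] : (E <= E *m A)%MS.
  by rewrite -(geq_leqif (mxrank_leqif_sup EA)) rEA.
by rewrite {1}Ew -!mulmxA mulmxV // mulmx1 submxMl.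
Qed.

Lemma lagrange_fun N (w : 'I_N -> L) (f : L -> L) :
  exists p : {poly L}, forall s, p.[w s] = f (w s).
Proof.
have [r ur Hr] : exists2 r : seq L, uniq r & forall s, w s \in r.
  by exists (undup (codom w)); [exact: undup_uniq|move=> s; rewrite mem_undup codom_f].
suff [p Hp] : exists p : {poly L}, forall x : L, x \in r -> p.[x] = f x.
  by exists p => s; apply: Hp.
elim: r {Hr} ur => [|y r IH] /=; first by exists 0.
move=> /andP[yr /IH[p Hp]]; pose q := \prod_(z <- r) ('X - z%:P).
have q0 : q.[y] != 0.
  by rewrite -rootE root_prod_XsubC.
exists (p + ((f y - p.[y]) / q.[y]) *: q) => x; rewrite inE !hornerE.
case/orP => [/eqP ->|xr]; first by rewrite mulfVK // addrC subrK.
have /eqP -> : q.[x] == 0 by rewrite -rootE root_prod_XsubC.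
by rewrite mulr0 addr0 Hp.
Qed.

(** [B] is [p] evaluated at [A], described through the diagonalizations of [A]. *)
Lemma stablemx_poly m N (E : 'M[L]_(m, N)) (A : 'M[L]_N) (p : {poly L}) :
  stablemx E A -> exists2 B : 'M[L]_N, stablemx E B &
    forall P (w : 'rV[L]_N), P \in unitmx -> A = P *m diag_mx w *m invmx P ->
      B = P *m diag_mx (map_mx (horner p) w) *m invmx P.
Proof.
move=> EA; elim/poly_ind: p => [|p c [B EB HB]].
  exists 0; first exact: stablemx0.
  move=> P w uP _; rewrite (_ : map_mx _ w = 0) ?linear0 ?mulmx0 ?mul0mx //.
  by apply/rowP => j; rewrite !mxE horner0.
exists (B *m A + c%:M).
  by apply: stablemxD; [apply: stablemxM|apply: stablemxC].
move=> P w uP EAP; rewrite (HB P w uP EAP) EAP.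
have -> : c%:M = P *m diag_mx (const_mx c) *m invmx P.
  by rewrite diag_const_mx scalar_mxC mulmxK.
rewrite !mulmxA mulmxKV // -mulmxDl; congr (_ *m _).
rewrite -mulmxA -mulmxDr; congr (_ *m _); rewrite mulmx_diag -raddfD; congr diag_mx.
by apply/rowP => j; rewrite !mxE !hornerE.
Qed.

(* By interpolation a function of a diagonalizable operator is a polynomial in
   that operator. *)
Lemma stablemx_fun m N (E : 'M[L]_(m, N)) P (w : 'rV[L]_N) (f : L -> L) :
  P \in unitmx -> stablemx E (P *m diag_mx w *m invmx P) ->
  stablemx E (P *m diag_mx (map_mx f w) *m invmx P).
Proof.
move=> uP EA; have [p Hp] := lagrange_fun (fun s => w 0 s) f.
have [B EB HB] := stablemx_poly p EA.
suff -> : map_mx f w = map_mx (horner p) w by rewrite -(HB P w).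
by apply/rowP => j; rewrite !mxE Hp.
Qed.

End Chevalley.

(** * Big cells for a graded space *)

Section BigCell.
Variable L : realFieldType.

(** A limit under the grading is replaced by linear algebra. Once [E *m A] is known to be graded, it
    contains the leading part of [x *m A] for each homogeneous [x] of [E]; this leading part is [x],
    and equality follows by rank. *)
Lemma graded_bigcell N (w : 'I_N -> L) (E A B : 'M[L]_N) :
  stablemx E (diag_mx (\row_s w s)) -> A \in unitmx -> B \in unitmx ->
  (forall s t, A s t != 0 -> s = t \/ w t < w s) -> (forall s, A s s = 1) ->
  (forall s t, B s t != 0 -> w s <= w t) ->
  stablemx E (A *m B) -> stablemx E A.
Proof.
move=> Ew uA uB HA A1 HB EAB.
pose pr (D : L -> bool) : 'M[L]_N := diag_mx (\row_s (D (w s))%:R).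
have prE D : pr D = diag_mx (map_mx (fun x => (D x)%:R) (\row_s w s)).
  by congr diag_mx; apply/rowP => s; rewrite !mxE.
have Epr D : stablemx E (pr D).
  have := @stablemx_fun L N N E 1%:M (\row_s w s) (fun x => (D x)%:R) (unitmx1 _ _).
  by rewrite !mul1mx invmx1 !mulmx1 -prE; apply.
have entl D M s t : (pr D *m M : 'M[L]_N) s t = (D (w s))%:R * M s t.
  by rewrite mul_diag_mx !mxE.
have entr D M s t : (M *m pr D : 'M[L]_N) s t = M s t * (D (w t))%:R.
  by rewrite mul_mx_diag !mxE.
have prN D : pr (predC D) = 1%:M - pr D.
  apply/matrixP => s t; rewrite !mxE /=; case: eqP => [->|_]; last by rewrite !mulr0n subr0.
  by case: (D _); rewrite ?subrr ?subr0.
pose E' := E *m A.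
have rE' : \rank E' = \rank E by rewrite mxrankMfree ?row_free_unit.
have uAB : A *m B \in unitmx by rewrite unitmx_mul uA uB.
have EB : (E *m invmx B <= E')%MS.
  have := stablemx_inv uAB EAB => /(submxMr A); apply: submx_trans.
  have -> : invmx (A *m B) = invmx B *m invmx A.
    apply: (@row_free_inj _ _ _ _ (A *m B)); first by rewrite row_free_unit.
    by rewrite mulVmx // -!mulmxA (mulmxA (invmx A)) mulVmx // mul1mx mulVmx.
  by rewrite mulmxA mulmxKV.
(* [A] never raises weights, so [F1] lies in the part selected by the down-set [D]; [B] and its
   inverse never lead from outside [D] into it, so [F2] lies in the complementary part. Their ranks
   add up to at least that of [E'], which contains both. *)
have E'pr (D : L -> bool) : (forall x y, x <= y -> D y -> D x) -> stablemx E' (pr D).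
  move=> Dd; pose F1 := E *m pr D *m A; pose F2 := E *m pr (predC D) *m invmx B.
  have F1pr : F1 *m pr D = F1.
    rewrite /F1 -!mulmxA; congr (_ *m _); apply/matrixP => s t.
    rewrite !entl entr; case Ds: (D (w s)); rewrite ?mul0r // !mul1r.
    have [->|/HA] := eqVneq (A s t) 0; first by rewrite mul0r.
    move=> H; rewrite (_ : D (w t)) ?mulr1 //.
    by case: H => [<- //|/ltW H]; apply: Dd Ds.
  have BV : stablemx (pr (predC D)) (invmx B).
    apply: stablemx_inv => //; rewrite (_ : _ *m B = pr (predC D) *m B *m pr (predC D)).
      exact: submxMl.
    apply/matrixP => s t; rewrite entr !entl; case Ds: (predC D (w s)); rewrite ?mul0r // !mul1r.
    have [->|/HB H] := eqVneq (B s t) 0; first by rewrite mul0r.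
    rewrite (_ : predC D (w t)) ?mulr1 //=.
    by move: Ds => /=; apply: contraTN => /(Dd _ _ H) ->.
  have F2pr : F2 *m pr D = 0.
    have /submxP[c Ec] := BV.
    rewrite /F2 -mulmxA -[E *m _ *m _]mulmxA [pr _ *m (_ *m _)]mulmxA Ec -!mulmxA.
    rewrite (_ : pr (predC D) *m pr D = 0) ?mulmx0 //.
    apply/matrixP => s t; rewrite entl !mxE /=; case: eqP => [->|_]; last by rewrite mulr0n mulr0.
    by case: (D _); rewrite ?mul0r ?mulr1n ?mulr0.
  have F1E : (F1 <= E')%MS by apply: submxMr; apply: Epr.
  have F2E : (F2 <= E')%MS.
    by apply: submx_trans EB; apply: submxMr; apply: Epr.
  have F12 : (F1 :&: F2 = 0)%MS.
    apply/eqP/rowV0P => v; rewrite sub_capmx => /andP[/submxP[a ->] /submxP[b Eb]].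
    by rewrite -F1pr mulmxA Eb -mulmxA F2pr mulmx0.
  have le : (\rank E' <= \rank (F1 + F2)%MS)%N.
    have := mxrank_sum_cap F1 F2; rewrite rE' F12 mxrank0 addn0 => ->.
    have -> : \rank F1 = \rank (E *m pr D) by rewrite mxrankMfree ?row_free_unit.
    have -> : \rank F2 = \rank (E *m pr (predC D)).
      by rewrite mxrankMfree ?row_free_unit ?unitmx_inv.
    apply: leq_trans (mxrank_adds_leqif _ _).1; apply: mxrankS.
    rewrite {1}(_ : E = E *m pr D + E *m pr (predC D)) ?addmx_sub_adds //.
    by rewrite -mulmxDr prN addrC subrK mulmx1.
  have E'F : (E' <= F1 + F2)%MS.
    have FE : (F1 + F2 <= E')%MS by rewrite addsmx_sub F1E F2E.
    by rewrite -(geq_leqif (mxrank_leqif_sup FE)).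
  apply: submx_trans (submxMr _ E'F) _.
  by rewrite (eqmxMr _ (addsmxE _ _)) mul_col_mx F1pr F2pr col_mx_sub F1E sub0mx.
pose peq (c x : L) := x == c; pose ple (c x : L) := x <= c.
pose plt (c x : L) := x < c.
have E'c (c : L) : stablemx E' (pr (peq c)).
  (* A single weight is the difference of two down-sets. *)
  have -> : pr (peq c) = pr (ple c) - pr (plt c).
    apply/matrixP => s t; rewrite !mxE; case: eqP => [->|_]; last by rewrite !mulr0n subr0.
    by rewrite /peq /ple /plt; case: (ltgtP (w t) c); rewrite !mulr1n ?subrr ?subr0.
  rewrite mulmxBr; apply: addmx_sub; last rewrite eqmx_opp.
    by apply: E'pr => x y; apply: le_trans.
  by apply: E'pr => x y; apply: le_lt_trans.
have EE' : (E <= E')%MS.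
  have -> : E = \sum_(c <- undup (codom w)) E *m pr (peq c).
    rewrite -mulmx_sumr [X in _ *m X](_ : _ = 1%:M) ?mulmx1 //.
    apply/matrixP => s t; rewrite summxE !mxE.
    rewrite (bigD1_seq (w s)) ?undup_uniq ?mem_undup ?codom_f //= big1.
      rewrite !mxE addr0 /peq; by rewrite eqxx.
    move=> c cs; rewrite !mxE /peq; by rewrite eq_sym (negbTE cs) mul0rn.
  apply: (big_ind (fun X => (X <= E')%MS)) => [|X Y|c _]; [exact: sub0mx|exact: addmx_sub|].
  pose P := pr (peq c).
  (* The diagonal of [A] is one and its other entries change the weight, so compression to weight
     [c] turns [A] into the identity. *)
  have -> : E *m P = E *m P *m A *m P.
    rewrite -!mulmxA; congr (_ *m _); apply/matrixP => s t.
    rewrite !entl entr !mxE /peq; case: (eqVneq (w s) c) => [ws|_]; last by rewrite !mul0r mul0rn.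
    rewrite !mul1r; have [E0|st] := eqVneq s t; first by rewrite -E0 A1 ws eqxx mul1r.
    have [->|/HA[|H]] := eqVneq (A s t) 0; first by rewrite mul0r mulr0n.
      by move=> E0; rewrite E0 eqxx in st.
    by rewrite -ws lt_eqF // mulr0.
  apply: submx_trans (E'c c); apply: submxMr; apply: submxMr; exact: Epr.
by rewrite -(geq_leqif (mxrank_leqif_sup EE')) rE'.
Qed.

Section Rho.
Variables (n d : nat) (z : 'rV[L]_n).
Hypothesis z_gt0 : forall j, 0 < z 0 j.
Notation T0 := (unit + 'I_n * 'I_n)%type.

Let w (s : 'I_(tdim T0 d)) := \prod_k kval z (tix s k).

Let kval_gt0 p : 0 < kval z p.
Proof. by case: p => [[]|[]] /=. Qed.

(** Weights multiply over the tensor factors, and as they are positive a strict decrease in one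
    factor persists in the product. *)
Lemma rho_weight_lt (u : 'M[L]_n) :
  (forall i j, u i j != 0 -> i = j \/ z 0 j < z 0 i) ->
  forall s t, rho d u s t != 0 -> s = t \/ w t < w s.
Proof.
move=> Hu s t; rewrite mxE => /prodf_neq0 H.
have Hk k : tix s k = tix t k \/ kval z (tix t k) < kval z (tix s k).
  have := H k isT; case: (tix s k) (tix t k) => [[]|[i j]] [[]|[a b]] /=;
    rewrite ?eqxx //; first by left.
  by have [->|_] := eqVneq i a; rewrite ?eqxx // => /Hu[->|]; [left|right].
have [->|st] := eqVneq s t; [by left|right].
have [k kst] : exists k, tix s k != tix t k.
  apply/existsP; apply: contraNT st => /existsPn Hn.
  by apply/eqP/tix_inj/ffunP => k; apply/eqP; have := Hn k; rewrite negbK.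
rewrite /w (bigD1 k) //= [ltRHS](bigD1 k) //=.
have [E|lt] := Hk k; first by rewrite E eqxx in kst.
apply: (@lt_le_trans _ _ (kval z (tix s k) * \prod_(i | i != k) kval z (tix t i))).
  by rewrite ltr_pM2r // prodr_gt0.
rewrite ler_pM2l //; apply: ler_prod => j _; rewrite ltW //=.
by have [->|/ltW] := Hk j.
Qed.

Lemma rho_weight_le (u : 'M[L]_n) :
  (forall i j, u i j != 0 -> z 0 i <= z 0 j) ->
  forall s t, rho d u s t != 0 -> w s <= w t.
Proof.
move=> Hu s t; rewrite mxE => /prodf_neq0 H; apply: ler_prod => k _; rewrite ltW //=.
have := H k isT; case: (tix s k) (tix t k) => [[]|[i j]] [[]|[a b]] /=; rewrite ?eqxx //.
by have [_|_] := eqVneq i a; rewrite ?eqxx // => /Hu.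
Qed.

Lemma rho_unit (u : 'M[L]_n) : u \in unitmx -> rho d u \in unitmx.
Proof.
move=> uu; suff /mulmx1_unit[] : rho d u *m rho d (invmx u) = 1%:M by [].
by rewrite -rhoM mulmxV // rho1.
Qed.

Lemma rho_bigcell (E : 'M[L]_(tdim T0 d)) (u v : 'M[L]_n) :
  stablemx E (rho d (diag_mx z)) -> u \in unitmx -> v \in unitmx ->
  (forall i j, u i j != 0 -> i = j \/ z 0 j < z 0 i) -> (forall i, u i i = 1) ->
  (forall i j, v i j != 0 -> z 0 i <= z 0 j) ->
  stablemx E (rho d (u *m v)) -> stablemx E (rho d u).
Proof.
rewrite rho_diag rhoM => Ez uu uv Hu u1 Hv; apply: (graded_bigcell Ez).
- exact: rho_unit.
- exact: rho_unit.
- exact: rho_weight_lt.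
- move=> s; rewrite mxE big1 // => k _.
  by case: (tix s k) => [[]|[i j]] //=; rewrite eqxx u1.
- exact: rho_weight_le.
Qed.

End Rho.
End BigCell.

(** * Exponentials of nilpotent matrices *)

Section NilpotentExp.
Variables (L : numFieldType) (n : nat).
Implicit Types (X Y : 'M[L]_n).

Local Notation pC := (map_mx (@polyC L)).

Lemma poly_eq0_derivs (p : {poly L}) : (forall k, (p^`(k)).[0] = 0) -> p = 0.
Proof.
move=> H; apply/polyP => k; rewrite coef0; apply/eqP.
have := H k; rewrite horner_coef0 coef_derivn addn0 => /eqP.
by rewrite mulrn_eq0 ffactnn -leqn0 leqNgt fact_gt0.
Qed.

Lemma map_deriv_mulC a b c (A : 'M[{poly L}]_(a, b)) (B : 'M[L]_(b, c)) :
  map_mx (@deriv L) (A *m pC B) = map_mx (@deriv L) A *m pC B.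
Proof.
apply/matrixP => i j; rewrite !mxE raddf_sum; apply: eq_bigr => k _.
by rewrite /= !mxE derivM derivC mulr0 addr0.
Qed.

Lemma horner_polyC_mx t a b (M : 'M[L]_(a, b)) : map_mx (horner_eval t) (pC M) = M.
Proof. by apply/matrixP => i j; rewrite !mxE /horner_eval hornerC. Qed.

(** All derivatives of [phi *m pC c] at [0] vanish by the equation, and in characteristic zero they
    determine a polynomial. *)
Lemma linear_ode_eq0 a N b (phi : 'M[{poly L}]_(a, N)) (C : 'M[L]_N) (c : 'M[L]_(N, b)) :
  map_mx (@deriv L) phi = phi *m pC C ->
  (forall k, map_mx (horner_eval 0) phi *m C ^+ k *m c = 0) -> phi *m pC c = 0.
Proof.
move=> Hphi H0.
have D k : map_mx (derivn k) (phi *m pC c) = phi *m pC (C ^+ k *m c).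
  elim: k => [|k IH]; first by rewrite mul1mx; apply/matrixP => i j; rewrite !mxE.
  have -> : map_mx (derivn k.+1) (phi *m pC c) =
      map_mx (@deriv L) (map_mx (derivn k) (phi *m pC c)).
    by apply/matrixP => i j; rewrite !mxE derivnS.
  by rewrite IH map_deriv_mulC Hphi -mulmxA -map_mxM exprS -mulmxE mulmxA.
apply/matrixP => i j; rewrite [RHS]mxE; apply: poly_eq0_derivs => k.
have /matrixP/(_ i j) := H0 k; rewrite [RHS]mxE => H00; rewrite -[RHS]H00.
have /matrixP/(_ i j) := D k; rewrite [LHS]mxE => ->.
by rewrite -mulmxA -[in RHS](horner_polyC_mx 0 (C ^+ k *m c)) -map_mxM [RHS]mxE.
Qed.

(** For nilpotent [X], its one-parameter group with the time as polynomial variable. *)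
Definition exp_poly X : 'M[{poly L}]_n :=
  \sum_(k < n) ((k`!%:R)^-1 *: 'X^k) *: pC (X ^+ k).

Lemma expmxZ (t : L) X k : (t *: X) ^+ k = t ^+ k *: X ^+ k.
Proof.
elim: k => [|k IH]; first by rewrite !expr0 scale1r.
by rewrite !exprS IH -!mulmxE -scalemxAl -scalemxAr scalerA.
Qed.

Lemma exp_polyE t X : map_mx (horner_eval t) (exp_poly X) = exp_nilp (t *: X).
Proof.
rewrite /exp_poly /exp_nilp /exp_trunc raddf_sum; apply: eq_bigr => k _ /=.
rewrite expmxZ; apply/matrixP => i j; rewrite !mxE /horner_eval !hornerE.
by rewrite ?hornerXn ?mulrA.
Qed.

Lemma deriv_exp_poly X : X ^+ n = 0 ->
  map_mx (@deriv L) (exp_poly X) = exp_poly X *m pC X.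
Proof.
move=> Xn; rewrite /exp_poly mulmx_suml.
have -> : map_mx (@deriv L) (\sum_(k < n) ((k`!%:R)^-1 *: 'X^k) *: pC (X ^+ k)) =
    \sum_(k < n) ((k`!%:R)^-1 *: 'X^k)^`() *: pC (X ^+ k).
  rewrite raddf_sum; apply: eq_bigr => k _; apply/matrixP => i j.
  by rewrite /= !mxE derivM derivC mulr0 addr0.
case: (n) X Xn => [|m] X Xn; first by rewrite !big_ord0.
rewrite big_ord_recl big_ord_recr /= expr0 derivZ derivC scaler0 scale0r add0r.
rewrite -[X in _ = _ + X]scalemxAl (_ : pC (X ^+ m) *m pC X = 0); last first.
  by rewrite -map_mxM mulmxE -exprSr Xn map_mx0.
rewrite scaler0 addr0; apply: eq_bigr => k _.
rewrite -scalemxAl -map_mxM mulmxE -exprSr /bump /= add1n; congr (_ *: _).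
rewrite derivZ derivXn /= -['X^k *+ _]scaler_nat scalerA; congr (_ *: _).
by rewrite factS natrM invfM mulrAC mulVf ?mul1r // pnatr_eq0.
Qed.

Lemma exp_nilp0 : exp_nilp (0 : 'M[L]_n) = 1%:M.
Proof.
rewrite /exp_nilp /exp_trunc; case: n => [|m]; first by apply/matrixP => -[].
rewrite big_ord_recl big1 ?addr0 => [|k _]; last by rewrite expr0n scaler0.
by rewrite expr0 invr1 scale1r.
Qed.

Lemma exp_poly_horner0 X : map_mx (horner_eval 0) (exp_poly X) = 1%:M.
Proof. by rewrite exp_polyE scale0r exp_nilp0. Qed.

(** The translate of the one-parameter group by time one and its product with [exp_nilp X] solve the
    same linear equation and agree at [0]. *)
Lemma exp_nilpS X m : X ^+ n = 0 ->
  exp_nilp (m.+1%:R *: X) = exp_nilp X *m exp_nilp (m%:R *: X).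
Proof.
move=> Xn; pose phi := map_mx (comp_poly ('X + 1%:P)) (exp_poly X) -
  pC (exp_nilp X) *m exp_poly X.
have /matrixP E : phi *m pC 1%:M = 0.
  apply: (@linear_ode_eq0 _ _ _ _ X); last first.
    move=> k; rewrite (_ : map_mx (horner_eval 0) phi = 0) ?mul0mx // map_mxB map_mxM.
    rewrite exp_poly_horner0 mulmx1 -map_mx_comp.
    rewrite horner_polyC_mx.
    have -> : map_mx (horner_eval 0 \o comp_poly ('X + 1%:P)) (exp_poly X) =
        map_mx (horner_eval 1) (exp_poly X).
      apply/matrixP => i j; rewrite !mxE /= /horner_eval horner_comp !hornerE.
      by rewrite ?add0r.
    by rewrite exp_polyE scale1r subrr.
  have dC : map_mx (@deriv L) (pC (exp_nilp X) *m exp_poly X) =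
      pC (exp_nilp X) *m (exp_poly X *m pC X).
    rewrite -deriv_exp_poly //; apply/matrixP => i j; rewrite !mxE raddf_sum.
    by apply: eq_bigr => k _; rewrite /= !mxE derivM derivC mul0r add0r.
  have dS : map_mx (@deriv L) (map_mx (comp_poly ('X + 1%:P)) (exp_poly X)) =
      map_mx (comp_poly ('X + 1%:P)) (exp_poly X *m pC X).
    rewrite -deriv_exp_poly //; apply/matrixP => i j; rewrite !mxE.
    by rewrite deriv_comp derivD derivX derivC addr0 mulr1.
  rewrite /phi map_mxB dC dS map_mxM mulmxBl mulmxA; congr (_ *m _ - _).
  by apply/matrixP => i j; rewrite !mxE /= comp_polyC.
have {E} : map_mx (horner_eval m%:R) (phi *m pC 1%:M) = 0.
  by apply/matrixP => i j; rewrite mxE E !mxE /horner_eval horner0.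
rewrite map_mx1 mulmx1 map_mxB map_mxM exp_polyE -map_mx_comp.
rewrite horner_polyC_mx.
have -> : map_mx (horner_eval m%:R \o comp_poly ('X + 1%:P)) (exp_poly X) =
    map_mx (horner_eval m.+1%:R) (exp_poly X).
  apply/matrixP => i j; rewrite !mxE /= /horner_eval horner_comp !hornerE.
  by rewrite -natr1.
by rewrite exp_polyE => /eqP; rewrite subr_eq0 => /eqP.
Qed.

Lemma poly_eq0_nat (p : {poly L}) : (forall m : nat, p.[m%:R] = 0) -> p = 0.
Proof.
move=> H; apply/eqP; apply: contraT => p0.
have := @max_poly_roots L p [seq m%:R | m <- iota 0 (size p)] p0.
rewrite size_map size_iota ltnn => H1; apply: H1.
  by apply/allP => _ /mapP[m _ ->]; rewrite rootE H.
by rewrite map_inj_uniq ?iota_uniq // => a b /eqP; rewrite eqr_nat => /eqP.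
Qed.

Section Stable.
Variables (d : nat) (E : 'M[L]_(tdim (unit + 'I_n * 'I_n)%type d)).

(** The image of [E] modulo [E], a polynomial in the time, has vanishing derivatives at [0], because
    [E] is stable under all powers of [drho d X]. *)
Lemma drho_exp X : X ^+ n = 0 -> stablemx E (drho d X) ->
  forall t, stablemx E (rho d (exp_nilp (t *: X))).
Proof.
move=> Xn EX t; rewrite submxE -mulmxA; apply/eqP.
have : pC E *m rho d (exp_poly X) *m pC (cokermx E) = 0.
  apply: (@linear_ode_eq0 _ _ _ _ (drho d X)).
    have -> : map_mx (@deriv L) (pC E *m rho d (exp_poly X)) =
        pC E *m map_mx (@deriv L) (rho d (exp_poly X)).
      apply/matrixP => i j; rewrite !mxE raddf_sum; apply: eq_bigr => k _ /=.
      by rewrite !mxE derivM derivC mul0r add0r.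
    by rewrite (deriv_rho _ (deriv_exp_poly Xn)) -map_drho mulmxA.
  move=> k; rewrite map_mxM map_rho exp_poly_horner0 rho1 mulmx1.
  rewrite horner_polyC_mx; apply/eqP; rewrite -submxE; elim: k => [|k IH]; first by rewrite expr0 mulmx1.
  by rewrite exprSr -mulmxE mulmxA; apply: submx_trans (submxMr _ IH) EX.
move/(congr1 (map_mx (horner_eval t))); rewrite !map_mxM map_rho exp_polyE map_mx0.
by rewrite !horner_polyC_mx /cokermx !mulmxA.
Qed.

(** Stability at time one spreads to all natural times, then to all times since the entries are
    polynomials; the derivative at [0] is the claim. *)
Lemma exp_drho X : X ^+ n = 0 -> stablemx E (rho d (exp_nilp X)) ->
  stablemx E (drho d X).
Proof.
move=> Xn EX.
have Em m : stablemx E (rho d (exp_nilp (m%:R *: X))).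
  elim: m => [|m IH]; first by rewrite scale0r exp_nilp0 rho1 mulmx1.
  by rewrite exp_nilpS // rhoM; apply: stablemxM.
have H : pC E *m rho d (exp_poly X) *m pC (cokermx E) = 0.
  apply/matrixP => i j; rewrite [RHS]mxE; apply: poly_eq0_nat => m.
  have := Em m; rewrite submxE => /eqP/matrixP/(_ i j); rewrite [RHS]mxE => <-.
  rewrite -exp_polyE -map_rho.
  have -> : E *m map_mx (horner_eval m%:R) (rho d (exp_poly X)) *m cokermx E =
      map_mx (horner_eval m%:R) (pC E *m rho d (exp_poly X) *m pC (cokermx E)).
    by rewrite !map_mxM !horner_polyC_mx /cokermx !mulmxA.
  by rewrite [RHS]mxE.
have {H} := congr1 (fun A => map_mx (horner_eval 0) (map_mx (@deriv L) A)) H.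
rewrite map_deriv_mulC.
have -> : map_mx (@deriv L) (pC E *m rho d (exp_poly X)) =
    pC E *m map_mx (@deriv L) (rho d (exp_poly X)).
  apply/matrixP => i j; rewrite !mxE raddf_sum; apply: eq_bigr => k _ /=.
  by rewrite !mxE derivM derivC mul0r add0r.
rewrite (deriv_rho _ (deriv_exp_poly Xn)) !map_mxM map_rho exp_poly_horner0 rho1 mul1mx.
rewrite -map_drho !horner_polyC_mx => H; rewrite submxE H; apply/eqP/matrixP => i j.
by rewrite !mxE deriv0 /horner_eval horner0.
Qed.

(* Eliminates, one at a time, the entries on which some [diag_mx z] acts with a
   ratio different from that at [(i0, j0)]. *)
Lemma drho_weight (Z : set 'rV[L]_n) X i0 j0 :
  (forall z j, Z z -> z 0 j != 0) ->
  (forall z, Z z -> stablemx E (rho d (diag_mx z))) ->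
  stablemx E (drho d X) ->
  stablemx E (drho d (\matrix_(i, j) if `[< forall z, Z z ->
    z 0 j / z 0 i = z 0 j0 / z 0 i0 >] then X i j else 0)).
Proof.
move=> Z0 EZ EX.
pose same i j := `[< forall z, Z z -> z 0 j / z 0 i = z 0 j0 / z 0 i0 >].
suff [M [EM M1 M2]] : exists M : 'M[L]_n, [/\ stablemx E (drho d M),
    forall i j, same i j -> M i j = X i j &
    forall p, p \in enum {: 'I_n * 'I_n} -> ~~ same p.1 p.2 -> M p.1 p.2 = 0].
  rewrite (_ : \matrix_(_, _) _ = M) //; apply/matrixP => i j; rewrite mxE -/(same i j).
  case: ifPn => [/M1 //|/(M2 (i, j)) -> //]; by rewrite mem_enum.
elim: (enum _) => [|[a b] l [M [EM M1 M2]]]; first by exists X.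
case ab: (same a b).
  exists M; split=> // p; rewrite inE => /orP[/eqP ->|]; last exact: M2.
  by rewrite ab.
have [z Zz nz] : exists2 z, Z z & z 0 b / z 0 a != z 0 j0 / z 0 i0.
  move/negbT: ab => /asboolPn; apply: contra_notP => H z Zz.
  by apply/eqP; apply: contraT => ne; case: H; exists z.
pose x := z 0 j0 / z 0 i0; pose y := z 0 b / z 0 a.
have xy : x - y != 0 by rewrite subr_eq0 eq_sym.
have uz : diag_mx z \in unitmx.
  rewrite unitmxE det_diag unitfE; apply/prodf_neq0 => j _; exact: Z0.
pose M' := invmx (diag_mx z) *m M *m diag_mx z.
have iz : invmx (diag_mx z) = diag_mx (map_mx (@GRing.inv L) z).
  apply: (@row_free_inj _ _ _ _ (diag_mx z)); first by rewrite row_free_unit.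
  rewrite mulVmx // mulmx_diag; apply/matrixP => i j; rewrite !mxE mulVf //.
  exact: Z0.
have M'E i j : M' i j = z 0 j / z 0 i * M i j.
  rewrite /M' iz mul_mx_diag mxE mul_diag_mx mxE mxE; ring.
have uD : rho d (diag_mx z) \in unitmx.
  suff /mulmx1_unit[] : rho d (diag_mx z) *m rho d (invmx (diag_mx z)) = 1%:M by [].
  by rewrite -rhoM mulmxV // rho1.
have EM' : stablemx E (drho d M').
  have HM' : rho d (diag_mx z) *m drho d M' = drho d M *m rho d (diag_mx z).
    by apply: drho_conj; rewrite /M' !mulmxA mulmxV // mul1mx.
  rewrite -[drho d M'](mulKmx uD) HM' mulmxA.
  apply: submx_trans (submxMr _ (stablemx_inv uD (EZ z Zz))) _.
  by rewrite mulmxA; apply: submx_trans (submxMr _ EM) (EZ z Zz).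
have entE i j : (M' - y *: M) i j = (z 0 j / z 0 i - y) * M i j.
  by rewrite mxE M'E !mxE -mulrBl.
(* Conjugation multiplies each entry by its ratio; this combination kills the entries of ratio [y]
   and fixes those of ratio [x]. *)
exists ((x - y)^-1 *: (M' - y *: M)); split.
- have -> : M' - y *: M = (- y) *: M + M' by rewrite scaleNr addrC.
  rewrite drhoZ drhoP -scalemxAr scalemx_sub //.
  by rewrite mulmxDr -scalemxAr addmx_sub ?scalemx_sub.
- move=> i j ij; rewrite mxE entE.
  by have /asboolP/(_ z Zz) -> := ij; rewrite -/x M1 // mulKf.
- move=> p pl np; rewrite mxE entE.
  move: pl; rewrite inE => /orP[/eqP -> /=|pl]; last by rewrite M2 // !mulr0.
  by rewrite subrr mul0r mulr0.
Qed.

End Stable.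
End NilpotentExp.

(** * Triangular decompositions *)

Section Triangular.
Variables (R : realDomainType) (n : nat) (h : 'I_n -> R).

(** Entry patterns of the parabolic subgroup attached to [h]: the nilradical, the unipotent radical
    and the Levi part, in blocks on which [h] is constant. *)
Definition sup (L : fieldType) (M : 'M[L]_n) := forall i j, M i j != 0 -> h j < h i.
Definition unip (L : fieldType) (u : 'M[L]_n) := sup (u - 1%:M).
Definition blockd (L : fieldType) (M : 'M[L]_n) := forall i j, M i j != 0 -> h i = h j.

Section Field.
Variable L : fieldType.
Implicit Types M N u v : 'M[L]_n.

Lemma mulmx_entry_neq0 M N i j : (M *m N) i j != 0 ->
  exists2 k, M i k != 0 & N k j != 0.
Proof.
rewrite mxE => H; apply: contrapT => H'; case/eqP: H; rewrite big1 // => k _.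
have [->|m0] := eqVneq (M i k) 0; first by rewrite mul0r.
have [->|n0] := eqVneq (N k j) 0; first by rewrite mulr0.
by case: H'; exists k.
Qed.

Lemma addmx_entry_neq0 M N i j : (M + N) i j != 0 -> M i j != 0 \/ N i j != 0.
Proof.
rewrite mxE => H; have [m0|] := eqVneq (M i j) 0; last by left.
by right; apply: contraNneq H => ->; rewrite m0 addr0.
Qed.

Lemma sup0 : sup (0 : 'M[L]_n). Proof. by move=> i j; rewrite mxE eqxx. Qed.

Lemma supM M N : sup M -> sup N -> sup (M *m N).
Proof. by move=> sM sN i j /mulmx_entry_neq0[k /sM ik /sN kj]; apply: lt_trans ik. Qed.

Lemma supD M N : sup M -> sup N -> sup (M + N).
Proof. by move=> sM sN i j /addmx_entry_neq0[/sM|/sN]. Qed.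

Lemma supZ c M : sup M -> sup (c *: M).
Proof. by move=> sM i j; rewrite mxE mulf_eq0 => /norP[_ /sM]. Qed.

Lemma supN M : sup M -> sup (- M).
Proof. by move=> sM i j; rewrite mxE oppr_eq0 => /sM. Qed.

Lemma supX M k : sup M -> sup (M ^+ k.+1).
Proof.
move=> sM; elim: k => [|k IH]; first by rewrite expr1.
by rewrite exprS -mulmxE; apply: supM.
Qed.

Lemma sup_sum I (r : seq I) (F : I -> 'M[L]_n) :
  (forall k, sup (F k)) -> sup (\sum_(k <- r) F k).
Proof. by move=> sF; elim/big_ind: _ => // [|M N]; [apply: sup0|apply: supD]. Qed.

(** [r] turns [h] into an integer rank below [n], which every factor [M] strictly lowers. *)
Lemma sup_nilpotent M : sup M -> M ^+ n = 0.
Proof.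
move=> sM; pose r i := #|[pred j | h j < h i]|.
have rn i : (r i < n)%N.
  rewrite -[X in (_ < X)%N]card_ord; apply: proper_card; apply/properP; split.
    by apply/fintype.subsetP.
  by exists i; rewrite // inE ltxx.
have rM i j : M i j != 0 -> (r j < r i)%N.
  move=> /sM ji; apply: proper_card; apply/properP; split.
    by apply/fintype.subsetP => k; rewrite !inE => /lt_trans; apply.
  by exists j; rewrite !inE ?ltxx.
have rX k : forall i j, (M ^+ k) i j != 0 -> (r j + k <= r i)%N.
  elim: k => [|k IH] i j.
    rewrite expr0 mxE addn0; case: (i =P j) => [->|_] //; by rewrite eqxx.
  rewrite exprS -mulmxE => /mulmx_entry_neq0[l /rM il /IH lj].
  by rewrite addnS; apply: leq_ltn_trans lj il.
apply/matrixP => i j; rewrite [RHS]mxE; apply/eqP; apply: contraT => /rX le.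
by have := leq_ltn_trans (leq_trans (leq_addl _ _) le) (rn i); rewrite ltnn.
Qed.

Lemma unipP u : unip u -> (forall i j, u i j != 0 -> i = j \/ h j < h i) /\
  (forall i, u i i = 1).
Proof.
move=> uu; split=> [i j|i].
  have [->|ij] := eqVneq i j; first by left.
  by move=> uij; right; apply: uu; rewrite !mxE (negbTE ij) subr0.
apply/eqP; rewrite -subr_eq0; apply: contraT => H.
by have /uu : (u - 1%:M) i i != 0; rewrite ?ltxx // !mxE eqxx.
Qed.

Lemma unipM u v : unip u -> unip v -> unip (u *m v).
Proof.
move=> uu uv; rewrite /unip.
have -> : u *m v - 1%:M = (u - 1%:M) *m (v - 1%:M) + (u - 1%:M) + (v - 1%:M).
  rewrite mulmxBl !mulmxBr !mulmx1 mul1mx; move: (u *m v) => w.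
  by apply/matrixP => i j; rewrite !mxE; ring.
by apply: supD => //; apply: supD => //; apply: supM.
Qed.

(** The inverse is the geometric series of the nilpotent part, whose higher terms keep the strict
    pattern. *)
Lemma unip_inv u : unip u -> u \in unitmx /\ unip (invmx u).
Proof.
move=> uu; pose Y : 'M[L]_n := - (u - 1%:M); have sY : sup Y by apply: supN.
pose v : 'M[L]_n := \sum_(k < n) Y ^+ k.
have geo m (Z : 'M[L]_m) : Z ^+ m = 0 ->
    Z *m (\sum_(k < m) Z ^+ k) = \sum_(k < m) Z ^+ k - 1%:M.
  move=> Zm; rewrite mulmx_sumr; case: m Z Zm => [|m] Z Zm.
    by apply/matrixP => -[].
  rewrite big_ord_recr [in RHS]big_ord_recl /= expr0 mulmxE -exprS Zm addr0.
  by rewrite addrAC subrr add0r; apply: eq_bigr => k _; rewrite exprS.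
have Yv : Y *m v = v - 1%:M by apply/geo/sup_nilpotent.
have uv : u *m v = 1%:M.
  have -> : u = 1%:M - Y by rewrite /Y opprK addrC subrK.
  by rewrite mulmxBl mul1mx Yv opprB addrC subrK.
have [unu _] := mulmx1_unit uv; split=> //.
have -> : invmx u = v by rewrite -[v](mulKmx unu) uv mulmx1.
rewrite /unip /v -Yv /v mulmx_sumr; apply: sup_sum => k.
by rewrite mulmxE -exprS; apply: supX.
Qed.

(* [w] is simultaneously in both triangular halves. *)
Lemma unip_block_eq1 w (D D' : 'rV[L]_n) : (forall i, D 0 i != 0) -> unip w ->
  w *m diag_mx D = diag_mx D' *m (invmx w)^T -> w = 1%:M /\ D = D'.
Proof.
move=> D0 uw E; have [w1 w2] := unipP uw.
have [v1 v2] := unipP (unip_inv uw).2.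
have Eij i j : w i j * D 0 j = D' 0 i * invmx w j i.
  by have /matrixP/(_ i j) := E; rewrite mul_mx_diag mul_diag_mx !mxE.
split; last by apply/rowP => i; have := Eij i i; rewrite w2 v2 mul1r mulr1.
apply/matrixP => i j; rewrite !mxE; have [->|ij] := eqVneq i j; first exact: w2.
apply/eqP; apply: contraT => wij; have [e|lt] := w1 i j wij; first by rewrite e eqxx in ij.
have : w i j * D 0 j != 0 by rewrite mulf_neq0.
rewrite Eij mulf_eq0 => /norP[_ /v1[e|lt']]; first by rewrite e eqxx in ij.
by have := lt_trans lt lt'; rewrite ltxx.
Qed.

End Field.

Section NumField.
Variable L : numFieldType.
Implicit Types M N u v : 'M[L]_n.

Lemma exp_nilp_unip N : sup N -> unip (exp_nilp N).
Proof.
move=> sN; rewrite /unip /exp_nilp /exp_trunc.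
have [n0|n0] := posnP n; first by move=> i; have := ltn_ord i; rewrite [X in (_ < X)%N]n0.
suff H m : (0 < m)%N -> sup (\sum_(k < m) (k`!%:R)^-1 *: N ^+ k - 1%:M) by exact: H.
case: m => // m _; rewrite big_ord_recl /= expr0 invr1 scale1r.
rewrite addrAC subrr add0r; apply: sup_sum => k; exact/supZ/supX.
Qed.

Lemma dvdpX (p : {poly L}) : ('X %| p) = (p.[0] == 0).
Proof. by rewrite -['X]subr0 -polyC0 dvdp_XsubCl rootE. Qed.

(** [q] is the logarithm of [1 + 'X] modulo ['X^m], built one coefficient at a time. *)
Lemma exp_poly_solution m : (0 < m)%N -> exists q : {poly L},
  'X %| q /\ 'X^m %| \sum_(k < m) (k`!%:R)^-1 *: q ^+ k - 1 - 'X.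
Proof.
move=> m0; suff H j : (0 < j)%N -> (j <= m)%N -> exists q : {poly L},
    'X %| q /\ 'X^j %| \sum_(k < m) (k`!%:R)^-1 *: q ^+ k - 1 - 'X.
  exact: H m0 (leqnn m).
elim: j => // j IH _ jm; have [j0|j0] := posnP j.
  exists 0; split; first exact: dvdp0.
  rewrite j0; case: (m) m0 => // m' _; rewrite big_ord_recl big1 ?addr0; last first.
    by move=> k _; rewrite expr0n scaler0.
  by rewrite expr0 invr1 scale1r subrr sub0r expr1 dvdpNr dvdpp.
have [q [Xq /dvdpP[r Er]]] := IH j0 (ltnW jm).
(* [c] is the coefficient of ['X^j] in the error. The exponential has the identity as linear part
   and [q] has no constant term, so the correction changes the series by [- c%:P * 'X^j] modulo the
   next power. *)
pose c := r.[0]; pose x := q - c%:P * 'X^j.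
have Xx : 'X %| x.
  by rewrite /x dvdp_sub // dvdp_mull // -(prednK j0) exprSr dvdp_mull.
exists x; split=> //.
have -> : \sum_(k < m) (k`!%:R)^-1 *: x ^+ k - 1 - 'X = (r - c%:P) * 'X^j +
    (c%:P * 'X^j + \sum_(k < m) (k`!%:R)^-1 *: (x ^+ k - q ^+ k)).
  have -> : \sum_(k < m) (k`!%:R)^-1 *: (x ^+ k - q ^+ k) =
      \sum_(k < m) (k`!%:R)^-1 *: x ^+ k - \sum_(k < m) (k`!%:R)^-1 *: q ^+ k.
    by rewrite -sumrB; apply: eq_bigr => k _; rewrite scalerBr.
  by rewrite mulrBl -Er; ring.
apply: dvdp_add.
  by rewrite exprS dvdp_mul // dvdpX !hornerE /c subrr.
have m1 : (1 < m)%N by apply: leq_trans jm.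
pose T k : {poly L} := (k`!%:R)^-1 *: (x ^+ k - q ^+ k).
have E0 : (0`!%:R : L)^-1 *: (x ^+ 0 - q ^+ 0) = 0 by rewrite !expr0 subrr scaler0.
have E1 : (1`!%:R : L)^-1 *: (x ^+ 1 - q ^+ 1) = x - q by rewrite invr1 scale1r !expr1.
have -> : \sum_(k < m) T k = x - q + \sum_(k < m.-2) T k.+2.
  case: (m) m1 => [|[|m']] //= _; rewrite 2!big_ord_recl.
  by apply: etrans (congr2 +%R E0 (congr2 +%R E1 (erefl _))) _; rewrite add0r.
rewrite addrA [X in X + _](_ : _ = 0) ?add0r; last by rewrite /x; ring.
elim/big_ind: _ => [|p p'|k _]; [exact: dvdp0|exact: dvdp_add|].
rewrite /T dvdpZr ?invr_eq0 ?pnatr_eq0 -?lt0n ?fact_gt0 // subrXX.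
rewrite [x - q](_ : _ = - c%:P * 'X^j); last by rewrite /x; ring.
rewrite exprSr dvdp_mul // ?dvdp_mull //.
elim/big_ind: _ => [|p p'|i _]; [exact: dvdp0|exact: dvdp_add|].
have [i0|i0] := posnP i.
  by rewrite i0 subn0 exprS -mulrA dvdp_mulr.
by rewrite dvdp_mull // -(prednK i0) exprS dvdp_mulr.
Qed.

(** The truncated logarithm is evaluated at the nilpotent [u - 1%:M]; as it has no constant term,
    the result keeps the strict triangular pattern. *)
Lemma exp_nilp_surj u : unip u -> exists2 N, sup N & exp_nilp N = u.
Proof.
move=> uu; have [n0|n0] := posnP n.
  exists 0; first exact: sup0.
  by apply/matrixP => i; have := ltn_ord i; rewrite [X in (_ < X)%N]n0.
have [q [/dvdpP[r Eq] Es]] := exp_poly_solution n0.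
pose Y := u - 1%:M; have sY : sup Y by [].
have H m (Z : 'M[L]_m) : (0 < m)%N -> Z ^+ m = 0 ->
    'X^m %| \sum_(k < m) (k`!%:R)^-1 *: q ^+ k - 1 - 'X ->
    exists W, W = \sum_(k < size r) r`_k *: Z ^+ k.+1 /\
      \sum_(k < m) (k`!%:R)^-1 *: W ^+ k = 1%:M + Z.
  case: m Z => // m Z _ Zm /dvdpP[t Et]; exists (horner_mx Z q); split.
    rewrite Eq rmorphM /= horner_mx_X -{1}[r]coefK poly_def rmorph_sum mulr_suml.
    apply: eq_bigr => k _; rewrite -mul_polyC rmorphM /= horner_mx_C rmorphXn /=.
    by rewrite horner_mx_X -mulrA -exprSr -mulmxE mul_scalar_mx.
  have := congr1 (horner_mx Z) Et.
  rewrite rmorphM rmorphXn /= horner_mx_X Zm mulr0 !rmorphB rmorph1 /= horner_mx_X.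
  rewrite rmorph_sum => /eqP; rewrite subr_eq add0r subr_eq => /eqP E.
  rewrite addrC -[RHS]E; apply: eq_bigr => k _.
  by rewrite -mul_polyC rmorphM /= horner_mx_C rmorphXn /= -mulmxE mul_scalar_mx.
have [W [EW1 EW2]] := H n Y n0 (sup_nilpotent sY) Es; exists W.
  by rewrite EW1; apply: sup_sum => k; apply/supZ/supX.
by rewrite /exp_nilp /exp_trunc EW2 /Y addrC subrK.
Qed.
End NumField.

Section RCF.
Variable F : rcfType.
Implicit Types (y w : 'M[F]_n).

Lemma mul_trmx_eq0 m1 m2 (v : 'M[F]_(m1, m2)) : v *m v^T = 0 -> v = 0.
Proof.
move=> E; apply/row_matrixP => i; rewrite row0; apply: dot_eq0.
have /matrixP/(_ i i) := E; rewrite [X in X = _ -> _]mxE [X in _ = X -> _]mxE => H.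
by rewrite mxE -[RHS]H; apply: eq_bigr => j _; rewrite !mxE.
Qed.

(* The [i]-th row of [w] is orthogonal, for the form [y *m y^T], to the basis
   vectors below [i]. *)
Lemma block_cholesky y : y \in unitmx ->
  exists2 w : 'M[F]_n, unip w & blockd (w *m (y *m y^T) *m w^T).
Proof.
move=> uy; pose p := y *m y^T.
have pT : p^T = p by rewrite /p trmx_mul trmxK.
pose D (i : 'I_n) : 'M[F]_n := diag_mx (\row_j (h j < h i)%R%:R).
have DT i : (D i)^T = D i by rewrite tr_diag_mx.
(* As [p] is positive definite, its compression to the indices below [i] has the same kernel as
   [D i], which makes the system for the row [X i] solvable. *)
have Dp i m (c : 'M[F]_(n, m)) : D i *m p *m D i *m c = 0 -> D i *m c = 0.
  move=> E; have : (c^T *m D i *m y) *m (c^T *m D i *m y)^T = 0.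
    have -> : (c^T *m D i *m y) *m (c^T *m D i *m y)^T = c^T *m (D i *m p *m D i *m c).
      by rewrite !trmx_mul trmxK DT /p !mulmxA.
    by rewrite E mulmx0.
  move/mul_trmx_eq0/(congr1 (fun M => M *m invmx y)).
  by rewrite mulmxK // mul0mx => /(congr1 trmx); rewrite trmx_mul trmxK DT trmx0.
have HX i : exists x : 'rV[F]_n,
    delta_mx 0 i *m p *m D i = x *m (D i *m p *m D i).
  apply/submxP; rewrite submxE -[_ *m D i *m _]mulmxA.
  by rewrite (Dp i _ _ (mulmx_coker _)) mulmx0.
have [X HX'] := choice HX.
pose w := \matrix_(i, j) ((i == j)%:R - X i 0 j * (h j < h i)%R%:R).
have rw i : row i w = delta_mx 0 i - X i *m D i.
  by apply/rowP => j; rewrite mul_mx_diag !mxE eqxx /= eq_sym.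
have w1 : unip w.
  move=> i j; rewrite !mxE addrAC subrr add0r oppr_eq0.
  by case: ltP => // _; rewrite mulr0 eqxx.
exists w => //; rewrite -/p.
pose q := w *m p *m w^T; have qT : q^T = q by rewrite /q trmx_mul trmxK trmx_mul pT mulmxA.
have q0 i k : h k < h i -> q i k = 0.
  (* The column [k] of [w^T] is supported on indices where [h] is below [h i], to which the row [i]
     has been made orthogonal. *)
  move=> ki; have wk : w^T *m delta_mx k (0 : 'I_1) = D i *m (w^T *m delta_mx k (0 : 'I_1)).
    apply/matrixP => j l; rewrite mul_diag_mx -!colE !mxE.
    have [lt|ge] := ltP (h j) (h i); first by rewrite mul1r.
    rewrite mul0r; apply/eqP; apply: contraT => H.
    have /((unipP w1).1 k j)[E|lt] : w k j != 0 by rewrite mxE.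
      by rewrite -E leNgt ki in ge.
    by rewrite leNgt (lt_trans lt ki) in ge.
  have -> : q i k = (row i w *m p *m (w^T *m delta_mx k (0 : 'I_1))) 0 0.
    by rewrite mulmxA -colE -!row_mul [RHS]mxE [RHS]mxE.
  by rewrite wk mulmxA rw !mulmxBl HX' !mulmxA subrr mxE.
move=> i k qik; case: (ltgtP (h i) (h k)) => // lt.
  by move: qik; rewrite -/q -qT mxE q0 // eqxx.
by move: qik; rewrite -/q q0 // eqxx.
Qed.

Lemma sym_fun_calculus m (l : 'M[F]_m) : l^T = l ->
  exists2 Q : 'M[F]_m, Q *m Q^T = 1%:M & exists d, l = Q^T *m diag_mx d *m Q.
Proof.
move=> sl; have [|Q QQ HQ] := @comm_sym_codiag F m [set l].
  by split=> [A ->|A B -> ->].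
have [d Hd] := HQ l erefl; exists Q => //; exists d.
have QQ' := mulmx1C QQ.
by rewrite -Hd !mulmxA QQ' mul1mx -mulmxA QQ' mulmx1.
Qed.

(** In an orthonormal eigenbasis [e] takes fourth roots of the eigenvalues; equal eigenvalues have
    equal roots, whence the statement on the commutant. *)
Lemma posdef_root4 m (v : 'M[F]_m) : v \in unitmx ->
  exists e : 'M[F]_m, [/\ e^T = e, e \in unitmx,
    v *m v^T = (e *m e) *m (e *m e) &
    forall B, B *m (v *m v^T) = v *m v^T *m B -> B *m e = e *m B].
Proof.
move=> uv; have [|Q QQ [d Ed]] := @sym_fun_calculus m (v *m v^T).
  by rewrite trmx_mul trmxK.
have QQ' := mulmx1C QQ.
have d0 i : 0 < d 0 i.
  have E : diag_mx d = (Q *m v) *m (Q *m v)^T.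
    by rewrite trmx_mul !mulmxA -[_ *m v *m v^T]mulmxA Ed !mulmxA QQ mul1mx -mulmxA QQ mulmx1.
  have Ei : d 0 i = (row i (Q *m v) *m (row i (Q *m v))^T) 0 0.
    have /matrixP/(_ i i) := E; rewrite mxE eqxx mulr1n => ->.
    by rewrite [LHS]mxE [RHS]mxE; apply: eq_bigr => j _; rewrite !mxE.
  rewrite Ei lt0r dot_ge0 andbT; apply/eqP => /dot_eq0 H.
  have /matrixP/(_ 0 0) : row i (Q *m v) *m (invmx v *m Q^T) *m delta_mx i (0 : 'I_1) = 0.
    by rewrite H !mul0mx.
  rewrite -row_mul mulmxA mulmxK // QQ row1 mul_delta_mx !mxE /= => /eqP.
  by rewrite oner_eq0.
pose s : 'rV[F]_m := \row_i Num.sqrt (Num.sqrt (d 0 i)).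
have s4 i : s 0 i * s 0 i * (s 0 i * s 0 i) = d 0 i.
  by rewrite mxE -!expr2 !sqr_sqrtr ?sqrtr_ge0 // ltW.
pose e := Q^T *m diag_mx s *m Q.
have ee : e *m e = Q^T *m diag_mx (\row_i (s 0 i * s 0 i)) *m Q.
  rewrite /e !mulmxA -[_ *m Q *m Q^T]mulmxA QQ mulmx1 -[Q^T *m diag_mx _ *m diag_mx _]mulmxA.
  by rewrite mulmx_diag.
have eeee : (e *m e) *m (e *m e) = v *m v^T.
  rewrite ee Ed !mulmxA -[_ *m Q *m Q^T]mulmxA QQ mulmx1 -[Q^T *m diag_mx _ *m diag_mx _]mulmxA.
  rewrite mulmx_diag; congr (_ *m diag_mx _ *m _).
  by apply/rowP => i; rewrite !mxE -[RHS]s4 !mxE.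
exists e; split=> //; first by rewrite /e !trmx_mul trmxK tr_diag_mx mulmxA.
  have : (e *m e) *m (e *m e) \in unitmx by rewrite eeee unitmx_mul unitmx_tr uv.
  by rewrite !unitmx_mul => /andP[/andP[]].
move=> B BE; have [C EC] : exists C, C = Q *m B *m Q^T by eexists.
have CE : C *m diag_mx d = diag_mx d *m C.
  have [P EP] : exists P, P = v *m v^T by eexists.
  rewrite -EP in Ed BE.
  have -> : diag_mx d = Q *m P *m Q^T.
    by rewrite Ed !mulmxA QQ mul1mx -mulmxA QQ mulmx1.
  rewrite EC !mulmxA -[Q *m B *m Q^T *m Q]mulmxA QQ' mulmx1 -[Q *m B *m P]mulmxA BE.
  by rewrite -[Q *m P *m Q^T *m Q]mulmxA QQ' mulmx1 !mulmxA.
have Cs : C *m diag_mx s = diag_mx s *m C.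
  apply/matrixP => i j; rewrite mul_mx_diag mul_diag_mx [LHS]mxE [RHS]mxE.
  have /matrixP/(_ i j) := CE; rewrite mul_mx_diag mul_diag_mx [LHS]mxE [RHS]mxE => H.
  have [->|C0] := eqVneq (C i j) 0; first by rewrite mul0r mulr0.
  rewrite mulrC; congr (_ * _); rewrite !mxE; congr (Num.sqrt (Num.sqrt _)).
  by apply: (mulfI C0); rewrite H mulrC.
have EB : B = Q^T *m C *m Q by rewrite EC !mulmxA QQ' mul1mx -mulmxA QQ' mulmx1.
rewrite EB /e !mulmxA -[Q^T *m C *m Q *m Q^T]mulmxA.
rewrite -[Q^T *m diag_mx s *m Q *m Q^T]mulmxA QQ !mulmx1.
by rewrite -[Q^T *m C *m _]mulmxA Cs !mulmxA.
Qed.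

(** The projections to the levels of [h] commute with [l], hence with [e]. *)
Lemma blockd_comm (l e : 'M[F]_n) : blockd l ->
  (forall B, B *m l = l *m B -> B *m e = e *m B) -> blockd e.
Proof.
move=> bl H i j eij; apply/eqP; apply: contraT => hij.
pose B : 'M[F]_n := diag_mx (\row_k (h k == h i)%:R).
have /H /matrixP/(_ i j) : B *m l = l *m B.
  apply/matrixP => a b; rewrite mul_mx_diag mul_diag_mx !mxE.
  have [->|/bl ->] := eqVneq (l a b) 0; first by rewrite mul0r mulr0.
  by rewrite mulrC.
rewrite mul_mx_diag mul_diag_mx !mxE eqxx mul1r eq_sym (negbTE hij) mulr0 => /eqP.
by rewrite (negbTE eij).
Qed.

Theorem block_cholesky_root y : y \in unitmx ->
  exists u e : 'M[F]_n, [/\ unip u, e^T = e, e \in unitmx, blockd e &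
    y *m y^T = u *m ((e *m e) *m (e *m e)) *m u^T].
Proof.
move=> uy; have [w uw bw] := block_cholesky uy.
have [unw uwi] := unip_inv uw.
have uwy : w *m y \in unitmx by rewrite unitmx_mul unw.
have Ewy : w *m (y *m y^T) *m w^T = (w *m y) *m (w *m y)^T.
  by rewrite trmx_mul !mulmxA.
have [e [sE uE E4 He]] := posdef_root4 uwy.
exists (invmx w), e; split=> //.
  by apply: blockd_comm He; rewrite -Ewy.
rewrite -E4 -Ewy !mulmxA mulVmx // mul1mx trmx_inv.
by rewrite mulmxK // unitmx_tr.
Qed.

End RCF.
End Triangular.

(** * Diagonalizable groups *)

Section Independence.
Variables (L : fieldType) (T : Type) (Y : set T) (mul : T -> T -> T) (one : T).
Hypotheses (Y1 : Y one) (Ymul : forall x y, Y x -> Y y -> Y (mul x y)).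
Variables (I : choiceType) (chi : I -> T -> L).
Hypotheses (chi1 : forall i, chi i one = 1)
  (chiM : forall i x y, chi i (mul x y) = chi i x * chi i y).

Let eqv i j := `[< forall y, Y y -> chi i y = chi j y >].

(* Artin's independence theorem; as the characters need not be distinct on [Y],
   the conclusion is tested on functions [c] constant on equal ones. *)
Lemma indep_chars (s : seq (L * I)) :
  (forall y, Y y -> \sum_(p <- s) p.1 * chi p.2 y = 0) ->
  forall c : I -> L, (forall i j, (forall y, Y y -> chi i y = chi j y) -> c i = c j) ->
  \sum_(p <- s) p.1 * c p.2 = 0.
Proof.
have [k] := ubnP (size s); elim: k s => // k IH [|[a0 i0] s] sk Hs c Hc.
  by rewrite big_nil.
have eqvE i j : eqv i j -> forall y, Y y -> chi i y = chi j y by move/asboolP.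
have [all0|] := boolP (all (fun p => eqv p.2 i0) ((a0, i0) :: s)).
  have ex y (d : I -> L) : (forall i, eqv i i0 -> d i = y) ->
      \sum_(p <- (a0, i0) :: s) p.1 * d p.2 = (\sum_(p <- (a0, i0) :: s) p.1) * y.
    move=> Hd; rewrite big_distrl big_seq [RHS]big_seq; apply: eq_bigr => p ps.
    by rewrite Hd //; apply: (allP all0).
  rewrite (ex (c i0)); last by move=> i /eqvE; apply: Hc.
  have := Hs one Y1; rewrite (ex 1 (fun i => chi i one)) ?mulr1 => [->|i _]; last exact: chi1.
  by rewrite mul0r.
case/allPn => -[a1 i1] ps1 n10.
have [y0 Yy0 d10] : exists2 y0, Y y0 & chi i1 y0 != chi i0 y0.
  move: n10 => /asboolPn; apply: contra_notP => H y Yy.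
  by apply/eqP; apply: contraT => ne; case: H; exists y.
(* The relation translated by [y0], minus [chi i0 y0] times the relation, has lost the term of [i0].
   In the class of [i1] every coefficient gains the same nonzero factor, which [d'] divides out. *)
have stepA (d : I -> L) : (forall i j, (forall y, Y y -> chi i y = chi j y) -> d i = d j) ->
    \sum_(p <- (a0, i0) :: s | eqv p.2 i1) p.1 * d p.2 = 0.
  move=> Hd; pose s' := [seq (p.1 * (chi p.2 y0 - chi i0 y0), p.2) | p <- s].
  pose d' i := if eqv i i1 then d i / (chi i y0 - chi i0 y0) else 0.
  have n01 : eqv i0 i1 = false.
    apply/negbTE/asboolPn => H; case/eqP: d10; exact/esym/H.
  rewrite big_cons /= n01 big_mkcond /=.
  have := IH s' _ _ d' _; rewrite size_map => /(_ sk).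
  have -> : \sum_(p <- s') p.1 * d' p.2 =
      \sum_(p <- s) (if eqv p.2 i1 then p.1 * d p.2 else 0).
    rewrite big_map; apply: eq_bigr => p _ /=; rewrite /d'.
    case: ifPn => [e1|_]; last by rewrite mulr0.
    rewrite -mulrA [_ * (d _ / _)]mulrC divfK //.
    by rewrite subr_eq0 (eqvE _ _ e1).
  apply.
    move=> y Yy; rewrite big_map.
    have E1 := Hs _ (Ymul Yy0 Yy); have E2 := Hs y Yy.
    move: E1 E2; rewrite !big_cons /= chiM => E1 E2.
    have : \sum_(p <- s) p.1 * chi p.2 (mul y0 y) - chi i0 y0 * \sum_(p <- s) p.1 * chi p.2 y = 0.
      move/eqP: E1; rewrite addrC addr_eq0 => /eqP ->.
      by move/eqP: E2; rewrite addrC addr_eq0 => /eqP ->; ring.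
    rewrite mulr_sumr -sumrB => H; rewrite -[RHS]H; apply: eq_bigr => p _ /=.
    by rewrite chiM; ring.
  move=> i j ij; rewrite /d'.
  have -> : eqv i i1 = eqv j i1.
    apply/asboolP/asboolP => H y Yy; first by rewrite -ij ?H.
    by rewrite ij ?H.
  by case: ifP => // _; rewrite (Hd i j ij) (ij y0 Yy0).
(* Without the class of [i1], which is not empty, the sum is shorter. *)
rewrite (bigID (fun p => eqv p.2 i1)) /= stepA // add0r -big_filter.
apply: IH => //; last first.
  move=> y Yy; rewrite big_filter; have := Hs y Yy.
  rewrite (bigID (fun p => eqv p.2 i1)) /= (stepA (fun i => chi i y)) ?add0r //.
  by move=> i j ij; apply: ij.
apply: leq_trans (_ : size ((a0, i0) :: s) <= k)%N; last by [].
rewrite size_filter; have := count_predC (fun p => eqv p.2 i1) ((a0, i0) :: s).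
move=> <-; rewrite -[X in (X < _)%N]add0n ltn_add2r -has_count.
by apply/hasP; exists (a1, i1) => //; apply/asboolP.
Qed.

End Independence.

(** * Saturated lattices *)

Section Lattice.
Variable n : nat.
Local Notation toQ M := (map_mx (intr : int -> rat) M).

(* A matrix of maximal rank with rows in [X], in Smith normal form, gives [B]. *)
Lemma saturated_basis (X : set 'rV[int]_n) :
  X 0 -> (forall x y, X x -> X y -> X (x + y)) -> (forall x, X x -> X (- x)) ->
  (forall (k : int) x, k != 0 -> X (k *: x) -> X x) ->
  exists (B : 'M[int]_n) (J : pred 'I_n), B \in unitmx /\
    forall c, X c <-> (forall j, ~~ J j -> (c *m invmx B) 0 j = 0).
Proof.
move=> X0 XD XN Xsat.
have XZ (k : int) x : X x -> X (k *: x).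
  move=> Xx; have Xn m : X ((m%:Z) *: x).
    by elim: m => [|m IH]; rewrite ?scale0r // -natz mulrS scalerDl scale1r natz; apply: XD.
  by case: k => m; [apply: Xn|rewrite NegzE scaleNr; apply: XN].
pose P r := `[< exists m (M : 'M[int]_(m, n)), \rank (toQ M) = r /\ forall i, X (row i M) >].
have exP : exists r, P r.
  by exists (\rank (toQ (0 : 'M[int]_(0, n)))); apply/asboolP; exists 0%N, 0; split=> // -[].
have bP r : P r -> (r <= n)%N by move/asboolP => [m [M [<- _]]]; apply: rank_leq_col.
case: (ex_maxnP exP bP) => r /asboolP[m [M [rM XM]]] rmax.
have [A uA [B uB [d _ EM]]] := int_Smith_normal_form M.
(* [J] marks the rows of [B] with a nonzero invariant factor; saturation of [X] divides these
   factors out. *)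
pose J (j : 'I_n) := (j < m)%N && (d`_j != 0).
exists B, J; split=> // c; split.
  move=> Xc j nJ.
  (* By maximality of the rank, [c] is a rational combination of the rows of [M]. *)
  have : P (\rank (toQ (col_mx M c))).
    apply/asboolP; exists (m + 1)%N, (col_mx M c); split=> // i.
    by case: (split_ordP i) => k ->; rewrite ?rowKu // rowKd ord1 row_id.
  move=> /rmax; rewrite -rM map_col_mx -addsmxE => le.
  rewrite (geq_leqif (mxrank_leqif_sup (addsmxSl _ _))) addsmx_sub in le.
  have /andP[_ /submxP[x Ex]] := le.
  apply/eqP; rewrite -(intr_eq0 rat); apply/eqP.
  have -> : ((c *m invmx B) 0 j)%:~R = (toQ (c *m invmx B)) 0 j :> rat by rewrite [RHS]mxE.
  have -> : toQ (c *m invmx B) = x *m toQ A *m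
      toQ (\matrix_(i, j) (d`_i *+ (i == j :> nat)) : 'M[int]_(m, n)).
    rewrite map_mxM Ex EM !map_mxM -!mulmxA -map_mxM.
    by rewrite mulmxV // map_mx1 mulmx1.
  rewrite mxE big1 // => i _; rewrite !mxE; have [ij|ij] := eqVneq (i : nat) j.
    move: nJ; rewrite /J -ij ltn_ord /= negbK => /eqP ->.
    by rewrite mul0rn mulr0.
  by rewrite mulr0n mulr0.
move=> Hc; have XS I (q : seq I) (F : I -> 'rV[int]_n) : (forall i, X (F i)) ->
    X (\sum_(i <- q) F i).
  by move=> HF; elim: q => [|i q IH]; rewrite ?big_nil // big_cons; apply: XD.
have XB j : J j -> X (row j B).
  move=> /andP[jm dj]; apply: (Xsat d`_j) => //; pose j' := Ordinal jm.
  have -> : d`_j *: row j B = row j' (invmx A *m M).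
    rewrite EM !mulmxA mulVmx // mul1mx row_mul.
    have -> : row j' (\matrix_(i, j) (d`_i *+ (i == j :> nat)) : 'M[int]_(m, n)) =
        d`_j *: delta_mx 0 j.
      apply/rowP => k; rewrite !mxE eqxx /= -[_ == _ :> nat]/(j == k) [k == j]eq_sym.
      by case: eqP; rewrite ?mulr1 ?mulr0.
    by rewrite -scalemxAl rowE.
  rewrite row_mul mulmx_sum_row; apply: XS => i; exact/XZ/XM.
have -> : c = \sum_j (c *m invmx B) 0 j *: row j B.
  by rewrite -mulmx_sum_row mulmxKV.
apply: XS => j; have [Jj|nJ] := boolP (J j); first exact/XZ/XB.
by rewrite Hc // scale0r.
Qed.

End Lattice.

Section IntPowers.
Variable L : fieldType.

Definition zexp n (z : 'rV[L]_n) (c : 'rV[int]_n) : L := \prod_i z 0 i ^ c 0 i.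
Definition nonzero n (z : 'rV[L]_n) := forall i, z 0 i != 0.

Lemma zexp0 n (z : 'rV[L]_n) : zexp z 0 = 1.
Proof. by rewrite /zexp big1 // => i _; rewrite mxE expr0z. Qed.

Lemma zexp_neq0 n (z : 'rV[L]_n) c : nonzero z -> zexp z c != 0.
Proof. by move=> z0; apply/prodf_neq0 => i _; apply: expfz_neq0. Qed.

Lemma zexpD n (z : 'rV[L]_n) c c' : nonzero z -> zexp z (c + c') = zexp z c * zexp z c'.
Proof.
by move=> z0; rewrite -big_split; apply: eq_bigr => i _; rewrite mxE expfzDr.
Qed.

Lemma zexpN n (z : 'rV[L]_n) c : nonzero z -> zexp z (- c) = (zexp z c)^-1.
Proof.
move=> z0; apply: (mulIf (zexp_neq0 c z0)).
by rewrite -zexpD // addNr zexp0 mulVf // zexp_neq0.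
Qed.

Lemma zexpZ n (z : 'rV[L]_n) k c : zexp z (k *: c) = zexp z c ^ k.
Proof.
rewrite /zexp (big_morph (fun x : L => x ^ k) (fun x y => expfzMl x y k) (exp1rz _ k)).
by apply: eq_bigr => i _; rewrite mxE mulrC -exprz_exp.
Qed.

Lemma zexp_sum n (z : 'rV[L]_n) I (r : seq I) (F : I -> 'rV[int]_n) : nonzero z ->
  zexp z (\sum_(i <- r) F i) = \prod_(i <- r) zexp z (F i).
Proof.
move=> z0; apply: (big_morph (zexp z) _ (zexp0 z)) => c c'; exact: zexpD.
Qed.

Lemma zexp_delta n (z : 'rV[L]_n) i : zexp z (delta_mx 0 i) = z 0 i.
Proof.
rewrite /zexp (bigD1 i) //= mxE !eqxx expr1z big1 ?mulr1 // => j ji.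
by rewrite mxE (negbTE ji) expr0z.
Qed.

Lemma zexp_mul n r (t : 'rV[L]_r) (N : 'M[int]_(n, r)) c : nonzero t ->
  zexp (\row_i zexp t (row i N)) c = zexp t (c *m N).
Proof.
move=> t0; rewrite mulmx_sum_row zexp_sum //; apply: eq_bigr => i _.
by rewrite mxE zexpZ.
Qed.

Definition zpos (c : int) : nat := if (0 <= c)%R then `|c|%N else 0%N.
Definition zneg (c : int) : nat := if (0 <= c)%R then 0%N else `|c|%N.

Lemma expz_pos_neg (x y : L) (c : int) : x * y = 1 -> x ^ c = x ^+ zpos c * y ^+ zneg c.
Proof.
move=> xy; have y0 : y = x^-1.
  have x0 : x != 0 by apply: contra_eq_neq xy => ->; rewrite mul0r eq_sym oner_eq0.
  by apply: (mulfI x0); rewrite xy mulfV.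
rewrite /zpos /zneg y0; case: c => m; first by rewrite /= mulr1.
by rewrite NegzE /= mul1r exprVn exprnN.
Qed.

(** On the locus of product one the inverse of a coordinate is the product of the others, so
    monomials with negative exponents are polynomials there. *)
Lemma zexp_prod1 n (z : 'rV[L]_n) c : \prod_i z 0 i = 1 ->
  zexp z c = \prod_i (z 0 i ^+ zpos (c 0 i) * (\prod_(l | l != i) z 0 l) ^+ zneg (c 0 i)).
Proof.
move=> z1; apply: eq_bigr => i _; apply: expz_pos_neg.
by rewrite -[RHS]z1 [RHS](bigD1 i).
Qed.

(** Denominators are cleared in order to obtain a polynomial equation. *)
Lemma zexp_eq1 n (z : 'rV[L]_n) c : nonzero z ->
  (zexp z c == 1) = (\prod_i z 0 i ^+ zpos (c 0 i) == \prod_i z 0 i ^+ zneg (c 0 i)).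
Proof.
move=> z0; have -> : zexp z c = \prod_i z 0 i ^+ zpos (c 0 i) / \prod_i z 0 i ^+ zneg (c 0 i).
  rewrite -prodfV -big_split; apply: eq_bigr => i _ /=.
  by rewrite -exprVn; apply: expz_pos_neg; rewrite mulfV.
rewrite -subr_eq0 -[X in _ - X](@divff _ (\prod_i z 0 i ^+ zneg (c 0 i))); last first.
  by apply/prodf_neq0 => i _; rewrite expf_neq0.
rewrite -mulrBl mulf_eq0 invr_eq0 [X in _ || X]negbTE ?orbF ?subr_eq0 //.
by apply/prodf_neq0 => i _; rewrite expf_neq0.
Qed.

Lemma nonzero_prod1 n (z : 'rV[L]_n) : \prod_i z 0 i = 1 -> nonzero z.
Proof.
move=> z1 i; apply: contra_eq_neq z1 => zi.
by rewrite (bigD1 i) //= zi mul0r eq_sym oner_eq0.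
Qed.

End IntPowers.

Lemma mmap_comp_mx (K L : fieldType) n m (i : {rmorphism K -> L}) (v : 'I_m -> L)
    (B : 'M[mpoly m K]_n) p :
  mmap i v (mmap (@mpolyC _ _) (fun l => mxvec B 0 l) p) =
  eval_mx i (map_mx (mmap i v) B) p.
Proof.
rewrite /eval_mx [X in mmap _ _ X]/mmap rmorph_sum.
rewrite [RHS]/mmap; apply: eq_bigr => a _; rewrite rmorphM /= mmapC; congr (_ * _).
by rewrite /mmap1 rmorph_prod; apply: eq_bigr => l _; rewrite rmorphXn -map_mxvec mxE.
Qed.

Definition mxgen (K : fieldType) n : 'M[mxpoly K n]_n :=
  \matrix_(a, b) mpolyX K (mnm1 (mxvec_index a b)).

Lemma eval_mxgen (K L : fieldType) n (i : {rmorphism K -> L}) (M : 'M[L]_n) :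
  map_mx (mmap i (fun k => mxvec M 0 k)) (mxgen K n) = M.
Proof. by apply/matrixP => a b; rewrite !mxE mmapX mmap1U mxvecE. Qed.

Section QDiagonal.
Variables (K : fieldType) (n : nat) (Q : 'M[K]_n).
Hypothesis QQ : Q *m Q^T = 1%:M.

(** [qconj] passes to coordinates in which the torus will be diagonal, [qconjV] returns. [Q] is kept
    over [K] so that the formulas make sense over every extension. *)
Definition qdg (L : fieldType) (i : {rmorphism K -> L}) (y : 'rV[L]_n) : 'M[L]_n :=
  (map_mx i Q)^T *m diag_mx y *m map_mx i Q.
Definition qconj (L : fieldType) (i : {rmorphism K -> L}) (s : 'M[L]_n) : 'M[L]_n :=
  map_mx i Q *m s *m (map_mx i Q)^T.
Definition qconjV (L : fieldType) (i : {rmorphism K -> L}) (s : 'M[L]_n) : 'M[L]_n :=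
  (map_mx i Q)^T *m s *m map_mx i Q.

Section Ext.
Variables (L : fieldType) (i : {rmorphism K -> L}).

Lemma map_orth : map_mx i Q *m (map_mx i Q)^T = 1%:M.
Proof. by rewrite map_trmx -map_mxM QQ map_mx1. Qed.

Lemma map_orthC : (map_mx i Q)^T *m map_mx i Q = 1%:M.
Proof. exact: mulmx1C map_orth. Qed.

Lemma qconjK : cancel (qconj i) (qconjV i).
Proof.
move=> s; rewrite /qconjV /qconj !mulmxA map_orthC mul1mx.
by rewrite -mulmxA map_orthC mulmx1.
Qed.

Lemma qconjVK : cancel (qconjV i) (qconj i).
Proof.
move=> s; rewrite /qconjV /qconj !mulmxA map_orth mul1mx.
by rewrite -mulmxA map_orth mulmx1.
Qed.

Lemma qconjM s t : qconj i (s *m t) = qconj i s *m qconj i t.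
Proof. by rewrite /qconj !mulmxA -[_ *m (map_mx i Q)^T *m map_mx i Q]mulmxA map_orthC mulmx1. Qed.

Lemma qconjVM s t : qconjV i (s *m t) = qconjV i s *m qconjV i t.
Proof. by rewrite /qconjV !mulmxA -[_ *m map_mx i Q *m (map_mx i Q)^T]mulmxA map_orth mulmx1. Qed.

Lemma qconj1 : qconj i 1%:M = 1%:M.
Proof. by rewrite /qconj mulmx1 map_orth. Qed.

Lemma qconjV1 : qconjV i 1%:M = 1%:M.
Proof. by rewrite /qconjV mulmx1 map_orthC. Qed.

Lemma qconjT s : qconj i s^T = (qconj i s)^T.
Proof. by rewrite /qconj !trmx_mul trmxK mulmxA. Qed.

Lemma qconjVT s : qconjV i s^T = (qconjV i s)^T.
Proof. by rewrite /qconjV !trmx_mul trmxK mulmxA. Qed.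

Lemma qconj_det s : \det (qconj i s) = \det s.
Proof. by rewrite /qconj !det_mulmx mulrAC -det_mulmx map_orth det1 mul1r. Qed.

Lemma qconjZ c s : qconj i (c *: s) = c *: qconj i s.
Proof. by rewrite /qconj -scalemxAr -scalemxAl. Qed.

Lemma qconjB s t : qconj i (s - t) = qconj i s - qconj i t.
Proof. by rewrite /qconj mulmxBr mulmxBl. Qed.

Lemma qconjVD s t : qconjV i (s + t) = qconjV i s + qconjV i t.
Proof. by rewrite /qconjV mulmxDr mulmxDl. Qed.

Lemma qconjV0 : qconjV i 0 = 0.
Proof. by rewrite /qconjV mulmx0 mul0mx. Qed.

Lemma qconjVX s k : qconjV i s ^+ k = qconjV i (s ^+ k).
Proof.
elim: k => [|k IH]; first by rewrite !expr0 qconjV1.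
by rewrite !exprS IH -!mulmxE qconjVM.
Qed.

Lemma qconjV_exp s : exp_nilp (qconjV i s) = qconjV i (exp_nilp s).
Proof.
rewrite /exp_nilp /exp_trunc; elim: (index_enum _) => [|k r IH].
  by rewrite !big_nil qconjV0.
by rewrite !big_cons IH qconjVD qconjVX /qconjV -scalemxAr -scalemxAl.
Qed.

Lemma qdgE y : qdg i y = qconjV i (diag_mx y). Proof. by []. Qed.

Lemma qconj_qdg y : qconj i (qdg i y) = diag_mx y.
Proof. exact: qconjVK. Qed.

Lemma qdgM y z : qdg i y *m qdg i z = qdg i (\row_j (y 0 j * z 0 j)).
Proof. by rewrite !qdgE -qconjVM mulmx_diag. Qed.

Lemma qdg1 : qdg i (const_mx 1) = 1%:M.
Proof. by rewrite qdgE diag_const_mx qconjV1. Qed.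

Lemma qdg_diag s : (forall a b, a != b -> qconj i s a b = 0) ->
  s = qdg i (\row_j qconj i s j j).
Proof.
move=> H; rewrite -[LHS]qconjK qdgE; congr qconjV.
apply/matrixP => a b; rewrite [RHS]mxE [X in X *+ _]mxE; have [<-|ab] := eqVneq a b.
  by rewrite mulr1n.
by rewrite mulr0n H.
Qed.

End Ext.

Lemma eval_qdg (p : mxpoly K n) : exists q : mpoly n K,
  forall (L : fieldType) (i : {rmorphism K -> L}) (y : 'rV[L]_n),
  eval_mx i (qdg i y) p = mmap i (fun j => y 0 j) q.
Proof.
pose B : 'M[mpoly n K]_n := map_mx (@mpolyC _ _) Q^T *m
  diag_mx (\row_j mpolyX K (mnm1 j)) *m map_mx (@mpolyC _ _) Q.
exists (mmap (@mpolyC n K) (fun l => mxvec B 0 l) p) => L i y.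
have EC (M : 'M[K]_n) :
    map_mx (mmap i (fun j => y 0 j)) (map_mx (@mpolyC _ _) M) = map_mx i M.
  by apply/matrixP => a c; rewrite mxE [X in mmap _ _ X]mxE mmapC [RHS]mxE.
suff EB : map_mx (mmap i (fun j => y 0 j)) B = qdg i y by rewrite mmap_comp_mx EB.
rewrite /B !map_mxM !EC map_diag_mx /qdg map_trmx; congr (_ *m diag_mx _ *m _).
by apply/rowP => j; rewrite !mxE /= mmapX mmap1U.
Qed.

End QDiagonal.

(** * Split tori given by lattices of characters *)

Section DiagonalTorus.
Variables (K : rcfType) (n : nat) (Q : 'M[K]_n).
Hypothesis QQ : Q *m Q^T = 1%:M.
Local Notation C := K[i].
Local Notation rc := (real_complex K).
Local Notation QC := (map_mx rc Q).
Variables (X : set 'rV[int]_n) (B : 'M[int]_n) (J : pred 'I_n).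
Hypotheses (uB : B \in unitmx)
  (XB : forall c, X c <-> (forall j, ~~ J j -> (c *m invmx B) 0 j = 0))
  (X1 : X (const_mx 1)).

Let QQC : QC *m QC^T = 1%:M.
Proof. by rewrite map_trmx -map_mxM QQ map_mx1. Qed.

Let QQC' : QC^T *m QC = 1%:M. Proof. exact: mulmx1C. Qed.

Definition qdiag (z : 'rV[C]_n) : 'M[C]_n := qdg Q rc z.
Definition qentry (s : 'M[C]_n) : 'rV[C]_n := \row_i (QC *m s *m QC^T) i i.

Lemma qdiagK z : qentry (qdiag z) = z.
Proof.
apply/rowP => i; rewrite mxE /qdiag /qdg !mulmxA QQC mul1mx -mulmxA QQC mulmx1.
by rewrite mxE eqxx.
Qed.

Lemma qdiagM z z' : qdiag z *m qdiag z' = qdiag (\row_i (z 0 i * z' 0 i)).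
Proof. exact: qdgM. Qed.

Lemma qdiag1 : qdiag (const_mx 1) = 1%:M.
Proof. exact: qdg1. Qed.

Definition torus_set : set 'rV[C]_n :=
  [set z | nonzero z /\ forall c, X c -> zexp z c = 1].

Lemma torus_prod1 z : torus_set z -> \prod_i z 0 i = 1.
Proof.
move=> [_ /(_ _ X1) H]; rewrite -[RHS]H; apply: eq_bigr => i _.
by rewrite mxE expr1z.
Qed.

Definition torus_eqs : set (mxpoly K n) :=
  [set p | forall z, torus_set z -> eval_mx rc (qdiag z) p = 0].

Let P : 'M[mxpoly K n]_n :=
  map_mx (@mpolyC _ _) Q *m mxgen K n *m map_mx (@mpolyC _ _) Q^T.

Let evP (s : 'M[C]_n) a b : eval_mx rc s (P a b) = (QC *m s *m QC^T) a b.
Proof.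
have E : map_mx (mmap rc (fun k => mxvec s 0 k)) P = QC *m s *m QC^T.
  have EC (M : 'M[K]_n) :
      map_mx (mmap rc (fun k => mxvec s 0 k)) (map_mx (@mpolyC _ _) M) = map_mx rc M.
    by apply/matrixP => x y; rewrite mxE [X in mmap _ _ X]mxE mmapC [RHS]mxE.
  by rewrite /P !map_mxM eval_mxgen !EC map_trmx.
by have /matrixP/(_ a b) := E; rewrite [LHS]mxE.
Qed.

Let evPd (s : 'M[C]_n) a : eval_mx rc s (P a a) = qentry s 0 a.
Proof. by rewrite evP [RHS]mxE. Qed.

(** The ideal contains enough equations: the off-diagonal entries vanish, the diagonal has product
    one, and each [c] in [X] gives a binomial. *)
Lemma torus_geom s : geom torus_eqs s <-> exists2 z, torus_set z & s = qdiag z.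
Proof.
split=> [Hs|[z Tz ->] p Hp]; last exact: Hp.
pose z := qentry s.
have sz : s = qdiag z.
  rewrite /qdiag /qdg; have <- : QC *m s *m QC^T = diag_mx z.
    apply/matrixP => a b; rewrite [RHS]mxE; have [<-|ab] := eqVneq a b.
      by rewrite mulr1n [RHS]mxE.
    rewrite -evP; apply: Hs => y _; rewrite evP /qdiag /qdg !mulmxA QQC mul1mx.
    by rewrite -mulmxA QQC mulmx1 mxE (negbTE ab).
  by rewrite !mulmxA QQC' mul1mx -mulmxA QQC' mulmx1.
have z1 : \prod_i z 0 i = 1.
  have : eval_mx rc s (\prod_i P i i - 1) = 0.
    apply: Hs => y Ty; rewrite /eval_mx rmorphB rmorph_prod rmorph1 /=.
    rewrite (eq_bigr (fun i => y 0 i)) ?torus_prod1 ?subrr // => i _.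
    by rewrite [LHS]evPd qdiagK.
  rewrite /eval_mx rmorphB rmorph_prod rmorph1 /= => /eqP; rewrite subr_eq0 => /eqP H; rewrite -[RHS]H.
  by apply: eq_bigr => i _; rewrite [RHS]evPd.
have z0 : nonzero z by apply: nonzero_prod1.
exists z => //; split=> // c Xc.
have ev (y : 'M[C]_n) : eval_mx rc y (\prod_i P i i ^+ zpos (c 0 i) - \prod_i P i i ^+ zneg (c 0 i)) =
    \prod_i qentry y 0 i ^+ zpos (c 0 i) - \prod_i qentry y 0 i ^+ zneg (c 0 i).
  rewrite /eval_mx rmorphB !rmorph_prod /=; congr (_ - _);
    by apply: eq_bigr => i _; rewrite rmorphXn /= -evPd.
apply/eqP; rewrite zexp_eq1 // -subr_eq0 -ev; apply/eqP/Hs => y [y0 Ty].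
rewrite ev qdiagK; apply/eqP; rewrite subr_eq0 -zexp_eq1 //; exact/eqP/Ty.
Qed.

Lemma torus_subgroup : is_subgroup (geom torus_eqs).
Proof.
have TM z z' : torus_set z -> torus_set z' -> torus_set (\row_i (z 0 i * z' 0 i)).
  move=> [z0 Tz] [z0' Tz']; split=> [i|c Xc]; first by rewrite mxE mulf_neq0.
  rewrite -[RHS](Tz c Xc) -[RHS]mulr1 -[X in _ = _ * X](Tz' c Xc) -big_split.
  by apply: eq_bigr => i _; rewrite mxE expfzMl.
have TV z : torus_set z -> torus_set (map_mx GRing.inv z).
  move=> [z0 Tz]; split=> [i|c Xc]; first by rewrite mxE invr_eq0.
  have XN : X (- c) by move: Xc; rewrite !XB => H j nJ; rewrite mulNmx mxE H ?oppr0.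
  rewrite -[RHS](Tz _ XN); apply: eq_bigr => i _; rewrite !mxE.
  by rewrite exprz_inv.
have T1 : torus_set (const_mx 1).
  split=> [i|c _]; first by rewrite mxE oner_eq0.
  by rewrite /zexp big1 // => i _; rewrite mxE exp1rz.
have inv z : torus_set z -> qdiag (map_mx GRing.inv z) *m qdiag z = 1%:M.
  move=> [z0 _]; rewrite qdiagM -qdiag1; congr qdiag; apply/rowP => i.
  by rewrite !mxE mulVf.
split.
- by move=> s /torus_geom[z Tz ->]; have /mulmx1_unit[] := inv z Tz.
- by apply/torus_geom; exists (const_mx 1); rewrite ?qdiag1.
- move=> s s' /torus_geom[z Tz ->] /torus_geom[z' Tz' ->]; apply/torus_geom.
  exists (\row_i (z 0 i * z' 0 i)); [exact: TM|exact: qdiagM].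
- move=> s /torus_geom[z Tz ->]; apply/torus_geom; exists (map_mx GRing.inv z).
    exact: TV.
  have [_ uz] := mulmx1_unit (inv z Tz).
  apply: (can_inj (mulmxK uz)); rewrite (mulVmx uz); exact/esym/inv.
Qed.

(** [X] is spanned by the rows of [B] that [J] selects, so the characters given by the remaining
    rows are coordinates; the exponents [N] of the inverse map are the corresponding columns of
    [invmx B]. *)
Lemma torus_split : split_torus torus_eqs.
Proof.
split; first exact: torus_subgroup.
pose r := #|[pred j | ~~ J j]|.
pose ix (k : 'I_r) : 'I_n := enum_val k.
have ixJ k : ~~ J (ix k) by have := enum_valP k; rewrite inE.
pose Sel : 'M[int]_(n, r) := \matrix_(j, k) (j == ix k)%:R.
pose phi (k : 'I_r) : mxpoly K n := \prod_i (P i i ^+ zpos (B (ix k) i) *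
  (\prod_(l | l != i) P l l) ^+ zneg (B (ix k) i)).
pose N := invmx B *m Sel.
pose psi a b : mpoly (r + r) K := \sum_l mpolyC _ (Q l a * Q l b) *
  \prod_k (mpolyX K (mnm1 (lshift r k)) ^+ zpos (N l k) *
            mpolyX K (mnm1 (rshift r k)) ^+ zneg (N l k)).
exists r, phi, psi => f h.
have SelSel : Sel^T *m Sel = 1%:M.
  apply/matrixP => k k'; rewrite !mxE (bigD1 (ix k)) //= !mxE eqxx mul1r big1 ?addr0.
    by rewrite (inj_eq enum_val_inj).
  by move=> j jk; rewrite !mxE (negbTE jk) mul0r.
have fE z : torus_set z -> f (qdiag z) = \row_k zexp z (row k (Sel^T *m B)).
  move=> Tz; apply/rowP => k; rewrite !mxE zexp_prod1 ?torus_prod1 //.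
  rewrite /eval_mx rmorph_prod; apply: eq_bigr => i _ /=.
  have -> : row k (Sel^T *m B) 0 i = B (ix k) i.
    rewrite !mxE (bigD1 (ix k)) //= !mxE eqxx mul1r big1 ?addr0 // => j jk.
    by rewrite !mxE (negbTE jk) mul0r.
  rewrite rmorphM !rmorphXn rmorph_prod /=; congr (_ ^+ _ * _ ^+ _).
    by rewrite [LHS]evPd qdiagK.
  by apply: eq_bigr => l _; rewrite [LHS]evPd qdiagK.
have hE t : torus_points t -> h t = qdiag (\row_i zexp t (row i N)).
  move=> t0; apply/matrixP => a b; rewrite !mxE /psi rmorph_sum.
  apply: eq_bigr => l _; rewrite rmorphM /= mmapC rmorph_prod mul_mx_diag !mxE.
  rewrite [RHS]mulrAC; congr (_ * _); first exact: (rmorphM rc).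
  rewrite /zexp.
  apply: eq_bigr => k _; rewrite rmorphM !rmorphXn /= !mmapX !mmap1U row_mxEl row_mxEr !mxE.
  by apply/esym/expz_pos_neg; rewrite mulfV.
have Th t : torus_points t -> torus_set (\row_i zexp t (row i N)).
  move=> t0; split=> [i|c Xc]; first by rewrite mxE zexp_neq0.
  rewrite zexp_mul // mulmxA (_ : c *m invmx B *m Sel = 0) ?zexp0 //.
  apply/rowP => k; rewrite !mxE big1 // => j _; rewrite !mxE.
  case: eqP => [->|_]; last by rewrite mulr0.
  by have /XB/(_ _ (ixJ k)) := Xc; rewrite !mxE => ->; rewrite mul0r.
split.
- move=> s /torus_geom[z Tz ->] k; rewrite fE // mxE zexp_neq0 //; exact: Tz.1.
- by move=> t t0; apply/torus_geom; exists (\row_i zexp t (row i N)); [apply: Th|rewrite hE].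
- move=> s /torus_geom[z Tz ->]; have [z0 Tz'] := Tz.
  rewrite fE // hE; last by move=> k; rewrite mxE zexp_neq0.
  congr qdiag; apply/rowP => i; rewrite mxE zexp_mul // -[RHS]zexp_delta.
  (* The two exponents differ by an element of [X], a character trivial on the torus. *)
  have -> : row i N *m (Sel^T *m B) = delta_mx 0 i -
      row i (invmx B) *m diag_mx (\row_j (J j)%:R) *m B.
    have -> : delta_mx 0 i = row i (invmx B) *m B by rewrite -row_mul mulVmx // row1.
    rewrite -mulmxBl.
    rewrite /N row_mul !mulmxA; congr (_ *m B); rewrite -mulmxA -[X in X - _]mulmx1 -mulmxBr.
    congr (_ *m _); apply/matrixP => j l; rewrite !mxE.
    have [Jj|nJ] := boolP (J j).
      rewrite subrr big1 // => k _; rewrite !mxE; case: eqP => [E|_]; rewrite ?mul0r //.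
      by have := ixJ k; rewrite -E Jj.
    rewrite mul0rn subr0; have jr : j \in [pred j | ~~ J j] by rewrite inE.
    rewrite (bigD1 (enum_rank_in jr j)) //= !mxE /ix enum_rankK_in // eqxx mul1r.
    rewrite big1 ?addr0 1?eq_sym // => k kj; rewrite !mxE.
    case: (j =P _) => [E|_]; rewrite ?mul0r //.
    by case/eqP: kj; apply: enum_val_inj; rewrite enum_rankK_in.
  have Xc : X (row i (invmx B) *m diag_mx (\row_j (J j)%:R) *m B).
    apply/XB => j nJ; rewrite mulmxK // mul_mx_diag !mxE.
    by rewrite (negbTE nJ) mulr0.
  by rewrite zexpD // zexpN // (Tz' _ Xc) invr1 mulr1.
- move=> t t0; rewrite hE // fE; last exact: Th.
  apply/rowP => k; rewrite mxE zexp_mul //.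
  have -> : row k (Sel^T *m B) *m N = delta_mx 0 k.
    by rewrite -row_mul /N mulmxA -[_ *m B *m _]mulmxA mulmxV // mulmx1 SelSel row1.
  exact: zexp_delta.
- move=> s s' /torus_geom[z Tz ->] /torus_geom[z' Tz' ->] k.
  have [zz Ezz zzE] : exists2 zz, qdiag z *m qdiag z' = qdiag zz &
      forall i, zz 0 i = z 0 i * z' 0 i.
    by exists (\row_i (z 0 i * z' 0 i)) => [|i]; [exact: qdiagM|rewrite mxE].
  have Tzz : torus_set zz.
    have [_ _ HM _] := torus_subgroup.
    have : geom torus_eqs (qdiag z *m qdiag z').
      by apply: HM; apply/torus_geom; 
        [exact: (ex_intro2 _ _ z Tz erefl)|exact: (ex_intro2 _ _ z' Tz' erefl)].
    rewrite Ezz => /torus_geom[y Ty E].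
    by have := congr1 qentry E; rewrite !qdiagK => ->.
  have fEk y : torus_set y -> f (qdiag y) 0 k = zexp y (row k (Sel^T *m B)).
    by move=> Ty; rewrite (fE y Ty) [LHS]mxE.
  rewrite Ezz; apply: etrans (fEk zz Tzz) _.
  apply: etrans (esym (congr2 *%R (fEk z Tz) (fEk z' Tz'))).
  rewrite /zexp -big_split; apply: eq_bigr => i _ /=.
  by rewrite zzE expfzMl.
Qed.

End DiagonalTorus.

Section TorusMaximality.
Variables (K : rcfType) (n : nat) (Q : 'M[K]_n).
Hypothesis QQ : Q *m Q^T = 1%:M.
Local Notation C := K[i].
Local Notation rc := (real_complex K).

(* The Zariski closure of the group generated by [A] and [b] is a split torus:
   the exponents of the monomials trivial on it form a saturated lattice, as all
   values are positive. *)
Theorem maximal_torus_mem (G S : seq (mxpoly K n)) (A : set 'M[K]_n) (b : 'M[K]_n)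
    (N : nat) : (0 < N)%N ->
  maximal_split_torus [set` G] [set` S] ->
  (forall g, geom [set` G] g -> \det g = 1) ->
  (forall s, A s -> exists2 d : 'rV[K]_n, s = Q^T *m diag_mx d *m Q & forall i, 0 < d 0 i) ->
  A 1%:M -> (forall s t, A s -> A t -> A (s *m t)) ->
  (forall s, A s -> geom [set` S] (map_mx rc s)) ->
  (forall p : mxpoly K n, (forall s, A s -> eval_mx idfun s p = 0) ->
     forall s, geom [set` S] s -> eval_mx rc s p = 0) ->
  (exists2 d : 'rV[K]_n, b = Q^T *m diag_mx d *m Q & forall i, 0 < d 0 i) ->
  is_subgroup (geom [set` G]) -> geom [set` G] (map_mx rc (b ^+ N)) ->
  geom [set` S] (map_mx rc b).
Proof.
move=> N0 [splS SG maxS] GSL HA A1 AM AS dens [bd Eb bd0] Ggrp Gb.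
have QQ' : Q^T *m Q = 1%:M by apply: mulmx1C.
pose qd (d : 'rV[K]_n) : 'M[K]_n := Q^T *m diag_mx d *m Q.
have qdM d d' : qd d *m qd d' = qd (\row_i (d 0 i * d' 0 i)).
  rewrite /qd !mulmxA -[_ *m Q *m Q^T]mulmxA QQ mulmx1.
  by rewrite -[Q^T *m diag_mx d *m _]mulmxA mulmx_diag.
have qd_det d : \det (qd d) = \prod_i d 0 i.
  by rewrite /qd !det_mulmx mulrAC -det_mulmx QQ' det1 mul1r det_diag.
have qdX d k : qd d ^+ k = qd (\row_i d 0 i ^+ k).
  elim: k => [|k IH].
    rewrite expr0 (_ : \row_i _ = const_mx 1) ?/qd ?diag_const_mx ?mulmx1 ?QQ' //.
    by apply/rowP => i; rewrite !mxE.
  by rewrite exprS IH -mulmxE qdM; congr qd; apply/rowP => i; rewrite !mxE exprS.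
have rc_qd d : map_mx rc (qd d) = qdiag Q (map_mx rc d).
  by rewrite /qdiag /qdg /qd !map_mxM map_trmx map_diag_mx.
have Gdet (d : 'rV[K]_n) : (forall i, 0 < d 0 i) -> geom [set` G] (map_mx rc (qd d)) ->
    \prod_i d 0 i = 1.
  move=> _ /GSL; rewrite det_map_mx qd_det => H.
  by apply: (fmorph_inj rc); rewrite H rmorph1.
pose Y : set 'rV[K]_n := [set d : 'rV[K]_n | (forall i, 0 < d 0 i) /\ (A (qd d) \/ d = bd)].
pose X : set 'rV[int]_n := [set c : 'rV[int]_n | forall d, Y d -> zexp d c = 1].
have Yn0 d : Y d -> nonzero d by move=> [d0 _] i; rewrite gt_eqF.
have zexp_gt0 (d : 'rV[K]_n) (c : 'rV[int]_n) : (forall i, 0 < d 0 i) -> 0 < zexp d c :> K.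
  by move=> d0; apply: prodr_gt0 => i _; apply: exprz_gt0.
have pow1 (x : K) k : 0 < x -> (0 < k)%N -> x ^+ k = 1 -> x = 1.
  by move=> x0 k0 xk; apply/eqP; rewrite -(@pexpr_eq1 _ x k) ?ltW // xk.
have [B [J [uB XB]]] : exists (B : 'M[int]_n) (J : pred 'I_n), B \in unitmx /\
    forall c, X c <-> (forall j, ~~ J j -> (c *m invmx B) 0 j = 0).
  apply: saturated_basis.
  - by move=> d _; apply: zexp0.
  - by move=> x y Xx Xy d Yd; rewrite zexpD ?Xx ?Xy ?mulr1 //; apply: Yn0.
  - by move=> x Xx d Yd; rewrite zexpN ?Xx ?invr1 //; apply: Yn0.
  move=> k x k0 Xkx d Yd; have := Xkx d Yd; rewrite zexpZ => E.
  have z0 := zexp_gt0 d x Yd.1.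
  have : zexp d x ^ `|k|%N = 1.
    by case: (intP k) E => [|m|m] //; rewrite -exprnN => /(congr1 GRing.inv); rewrite invrK invr1.
  by apply: pow1; rewrite ?absz_gt0.
have bN1 : \prod_i bd 0 i = 1.
  have := Gb; rewrite Eb -/(qd bd) qdX => /Gdet H.
  have {}H : \prod_i bd 0 i ^+ N = 1.
    by rewrite -[RHS]H => [|i]; rewrite ?mxE ?exprn_gt0 //; apply: eq_bigr => i _; rewrite mxE.
  by apply: (pow1 _ N) => //; [apply: prodr_gt0 => i _; apply: bd0|rewrite -prodrXl].
have X1 : X (const_mx 1).
  move=> d [d0 H]; have -> : zexp d (const_mx 1) = \prod_i d 0 i.
    by apply: eq_bigr => i _; rewrite mxE expr1z.
  by case: H => [/AS/SG/(Gdet d d0) //|->].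
pose S' := torus_eqs Q X.
have splS' := torus_split QQ uB XB X1.
have Trc d : Y d -> torus_set X (map_mx rc d).
  move=> Yd; split=> [i|c Xc]; first by rewrite mxE fmorph_eq0 Yn0.
  rewrite -[RHS](rmorph1 rc) -(Xc d Yd) rmorph_prod; apply: eq_bigr => i _.
  by rewrite mxE fmorphXz.
have SS' : geom [set` S] `<=` geom S'.
  move=> s Ss p Hp; apply: dens Ss => t At; have [d Et d0] := HA t At.
  have Yd : Y d by split=> //; left; rewrite /qd -Et.
  have := Hp _ (Trc d Yd); rewrite -rc_qd (eval_mx_map (i := idfun) (f := rc)) //.
  by rewrite /qd -Et => /eqP; rewrite fmorph_eq0 => /eqP.
(* An equation of [G], restricted to diagonal matrices, is a combination of monomials that vanishes
   at all products of points of [A] with powers of [b ^+ N]. Monomials that agree there differ by an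
   exponent in [X], hence agree on the torus, so [indep_chars] gives vanishing at [z]. *)
have S'G : geom S' `<=` geom [set` G].
  move=> s /(torus_geom QQ X1)[z [z0 Tz] ->] p pG.
  have [q Hq] := eval_qdg Q p.
  have evq (y : 'rV[C]_n) : mmap rc (fun i => y 0 i) q = eval_mx rc (qdiag Q y) p.
    by rewrite -Hq.
  rewrite -evq /mmap.
  pose sq := [seq (rc (mcoeff m q), m) | m <- msupp q].
  have -> : \sum_(m <- msupp q) rc (mcoeff m q) * mmap1 (fun i => z 0 i) m =
      \sum_(w <- sq) w.1 * mmap1 (fun i => z 0 i) w.2 by rewrite [RHS]big_map.
  pose mulT (x y : 'rV[K]_n) : 'rV[K]_n := \row_i (x 0 i * y 0 i).
  (* Only [b ^+ N] is known to lie in the group; by positivity a monomial equal to one at it is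
     equal to one at [b]. *)
  pose pt (d : 'rV[K]_n) k : 'rV[K]_n := \row_i (d 0 i * bd 0 i ^+ (N * k)).
  pose YT : set 'rV[K]_n := [set y | exists (d : 'rV[K]_n) k,
    [/\ A (qd d), forall i, 0 < d 0 i & y = pt d k]].
  pose chi (m : multinom n) (y : 'rV[K]_n) : C := mmap1 (fun i => rc (y 0 i)) m.
  have qd_diag (d : 'rV[K]_n) : A (qd d) -> forall i, 0 < d 0 i.
    move=> /HA[d' E d0'] i; suff -> : d = d' by [].
    have : Q *m qd d *m Q^T = Q *m qd d' *m Q^T by rewrite E.
    rewrite /qd !mulmxA QQ !mul1mx -!mulmxA QQ !mulmx1 => /matrixP H.
    by apply/rowP => l; have := H l l; rewrite !mxE eqxx.
  have qd1 : qd (const_mx 1) = 1%:M by rewrite /qd diag_const_mx mulmx1 QQ'.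
  have A1' : A (qd (const_mx 1)) by rewrite qd1.
  have zexpB (L : fieldType) (y : 'rV[L]_n) (m1 m2 : multinom n) : nonzero y ->
      zexp y (\row_i ((m1 i)%:Z - (m2 i)%:Z)) =
      mmap1 (fun i => y 0 i) m1 / mmap1 (fun i => y 0 i) m2.
    move=> y0; rewrite /mmap1 -prodfV -big_split; apply: eq_bigr => i _ /=.
    by rewrite mxE expfzDr ?y0 // -exprnN.
  have mm0 (L : fieldType) (y : 'rV[L]_n) (m : multinom n) : nonzero y ->
      mmap1 (fun i => y 0 i) m != 0.
    by move=> y0; apply/prodf_neq0 => i _; rewrite expf_neq0.
  apply: (@indep_chars C _ YT mulT (const_mx 1) _ _ _ chi).
  - exists (const_mx 1), 0%N; split=> // [i|]; first by rewrite mxE ltr01.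
    by apply/rowP => i; rewrite !mxE muln0 expr0 mulr1.
  - move=> _ _ [d [k [Ad d0 ->]]] [d' [k' [Ad' d0' ->]]].
    exists (\row_i (d 0 i * d' 0 i)), (k + k')%N; split.
    + by rewrite -qdM; apply: AM.
    + by move=> i; rewrite mxE mulr_gt0.
    + by apply/rowP => i; rewrite !mxE mulnDr exprD mulrACA.
  - by move=> m; rewrite /chi /mmap1 big1 // => i _; rewrite mxE rmorph1 expr1n.
  - move=> m x y; rewrite /chi /mmap1 -big_split; apply: eq_bigr => i _ /=.
    by rewrite mxE rmorphM exprMn.
  - move=> _ [d [k [Ad d0 ->]]].
    have Gp : geom [set` G] (map_mx rc (qd (pt d k))).
      have -> : qd (pt d k) = qd d *m b ^+ (N * k).
        by rewrite Eb -/(qd bd) qdX qdM; congr qd; apply/rowP => i; rewrite !mxE.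
      have [_ G1 GM _] := Ggrp; rewrite map_mxM; apply: (GM); first exact/SG/AS.
      elim: k => [|k IH]; first by rewrite muln0 expr0 map_mx1.
      by rewrite mulnS exprD -mulmxE map_mxM; apply: GM.
    have := Gp p pG; rewrite rc_qd -evq /mmap => H; rewrite -[RHS]H [LHS]big_map.
    apply: eq_bigr => m _; congr (_ * _); apply: eq_bigr => i _ /=.
    by rewrite [RHS]/= [in RHS]mxE.
  - move=> m1 m2 E; pose c : 'rV[int]_n := \row_i ((m1 i)%:Z - (m2 i)%:Z).
    have pt0 (d : 'rV[K]_n) k : (forall i, 0 < d 0 i) -> nonzero (pt d k).
      by move=> d0 i; rewrite mxE gt_eqF // mulr_gt0 ?exprn_gt0.
    have EY y : nonzero y -> YT y -> zexp y c = 1.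
      move=> y0 Yy; rewrite zexpB //; have := E y Yy; rewrite /chi.
      have mc m : mmap1 (fun i => rc (y 0 i)) m = rc (mmap1 (fun i => y 0 i) m).
        by rewrite [in RHS]/mmap1 rmorph_prod; apply: eq_bigr => i _; rewrite rmorphXn.
      by rewrite !mc => /(fmorph_inj rc) ->; rewrite divff // mm0.
    have Xc : X c.
      move=> d [d0 [Ad|Ed]].
        have Ept : d = pt d 0%N by apply/rowP => i; rewrite mxE muln0 expr0 mulr1.
        by rewrite Ept; apply: EY; [apply: pt0|exists d, 0%N].
      have : zexp (pt (const_mx 1) 1%N) c = 1.
        apply: EY; first by apply: pt0 => i; rewrite mxE ltr01.
        by exists (const_mx 1), 1%N; split=> // i; rewrite mxE ltr01.
      have -> : zexp (pt (const_mx 1) 1%N) c = zexp d c ^+ N.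
        rewrite Ed /zexp -prodrXl; apply: eq_bigr => i _.
        by rewrite !mxE mul1r muln1 [in LHS]exprnP [in RHS]exprnP exprzAC.
      by apply: pow1 => //; apply: zexp_gt0.
    have := Tz c Xc; rewrite zexpB // => /(congr1 (fun x => x * mmap1 (fun i => z 0 i) m2)).
    by rewrite divfK ?mm0 // mul1r.
have -> : geom [set` S] = geom S' by apply/esym/maxS.
rewrite Eb -/(qd bd) rc_qd; apply/(torus_geom QQ X1); exists (map_mx rc bd) => //.
by apply: Trc; split=> //; right.
Qed.
End TorusMaximality.

(** * Semialgebraic connectedness *)

Lemma cvg_mmap (T : Type) (Fl : set_system T) {FF : Filter Fl} (K : numFieldType) m
    (v : T -> 'I_m -> K) (l : 'I_m -> K) (p : mpoly m K) :
  (forall k, (v t k) @[t --> Fl] --> l k) ->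
  (mmap idfun (v t) p) @[t --> Fl] --> mmap idfun l p.
Proof.
move=> vl; rewrite /mmap; elim: (msupp p) => [|a s IH].
  by under eq_fun do rewrite big_nil; rewrite big_nil; apply: cvg_cst.
under eq_fun do rewrite big_cons; rewrite big_cons; apply: cvgD IH.
apply: cvgM; first exact: cvg_cst.
rewrite /mmap1; elim: (index_enum _) => [|k r IH].
  by under eq_fun do rewrite big_nil; rewrite big_nil; apply: cvg_cst.
under eq_fun do rewrite big_cons; rewrite big_cons; apply: cvgM IH.
elim: (a k) => [|e IH]; first by under eq_fun do rewrite expr0; rewrite expr0; apply: cvg_cst.
by under eq_fun do rewrite exprS; rewrite exprS; apply: cvgM.
Qed.

Lemma cvg_horner (T : Type) (Fl : set_system T) {FF : Filter Fl} (K : numFieldType)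
    (g : T -> K) l (p : {poly K}) :
  g @ Fl --> l -> p.[g t] @[t --> Fl] --> p.[l].
Proof.
move=> gl; elim/poly_ind: p => [|p c IH].
  by under eq_fun do rewrite horner0; rewrite horner0; apply: cvg_cst.
under eq_fun do rewrite !hornerE; rewrite !hornerE; apply: cvgD; last exact: cvg_cst.
exact: cvgM.
Qed.

Lemma cvg_mx (T : Type) (Fl : set_system T) {FF : Filter Fl} (K : topologicalType) m n
    (g : T -> 'M[K]_(m, n)) (l : 'M[K]_(m, n)) :
  (forall i j, (g t i j) @[t --> Fl] --> l i j) -> g @ Fl --> l.
Proof.
move=> gl A [P lP PA]; apply: (@filterS _ Fl _ (fun t => forall i j, P i j (g t i j))).
  by move=> t Pt; apply: PA.
by apply: filter_forall => i; apply: filter_forall => j; apply: gl.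
Qed.

Lemma closed_eval_ge (K : rcfType) n (p : mxpoly K n) :
  closed [set s : 'M[K]_n | 0 <= eval_mx idfun s p].
Proof.
apply: (@preimage_closed 'M[K]_n K (fun s => eval_mx idfun s p) [set x : K | 0 <= x]); last exact: closed_ge.
move=> s _; apply: (@cvg_mmap _ (nbhs s)) => k; case/mxvec_indexP: k => a b.
by under eq_fun do rewrite mxvecE; rewrite mxvecE; apply: coord_continuous.
Qed.

Section OneDim.
Variable K : rcfType.

Lemma ltn_count (T : eqType) (p q : pred T) (s : seq T) x :
  (forall z, p z -> q z) -> x \in s -> q x -> ~~ p x -> (count p s < count q s)%N.
Proof.
move=> pq xs qx px; have := count_predUI p (pred1 x) s.
rewrite [count (predI _ _) _](@eq_count _ _ pred0) ?count_pred0; last first.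
  by move=> z /=; case: eqP => [->|]; rewrite ?andbF // (negbTE px).
rewrite addn0 => E; apply: leq_trans (_ : count (predU p (pred1 x)) s <= _)%N.
  by rewrite E -[X in (X < _)%N]addn0 ltn_add2l -has_count has_pred1.
by apply: sub_count => z /= /orP[/pq//|/eqP->].
Qed.

(** Induction on the number of roots in the open interval, which is cut at one of them. *)
Lemma interval_path (Q : {poly K}) (P : K -> Prop) : Q != 0 ->
  (forall a b : K, 0 <= a -> a < b -> b <= 1 -> (forall z : K, a < z < b -> ~~ root Q z) ->
    (P a <-> P b)) -> (P 0 <-> P 1).
Proof.
move=> Q0 HP; pose rs := polyrcf.roots Q 0 1.
have rsP (z : K) : 0 < z < 1 -> root Q z -> z \in rs.
  by move=> z01 Qz; rewrite polyrcf.root_in_roots // in_itv.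
suff main k (a b : K) : (count (fun z : K => (a < z < b)%R) rs < k)%N -> 0 <= a -> a < b -> b <= 1 ->
    (P a <-> P b) by apply: main (ltnSn _) (lexx _) ltr01 (lexx _).
elim: k a b => // k IH a b ck a0 ab b1.
have [/hasP[c crs /andP[/andP[ac cb] Qc]]|nh] :=
    boolP (has (fun z : K => (a < z < b) && root Q z) rs).
  apply: iff_trans (_ : P c <-> _).
    apply: IH => //; last by rewrite (le_trans (ltW cb)).
    rewrite -ltnS; apply: leq_trans ck; apply: (ltn_count (x := c)); rewrite ?ac ?cb ?ltxx ?andbF //.
    by move=> z /andP[-> /lt_trans->].
  apply: IH => //; last by rewrite (le_trans a0 (ltW ac)).
  rewrite -ltnS; apply: leq_trans ck; apply: (ltn_count (x := c)); rewrite ?ac ?cb ?ltxx //.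
  by move=> z /andP[cz ->]; rewrite (lt_trans ac cz).
apply: HP => // z zab; apply: contra nh => Qz; apply/hasP; exists z; rewrite ?zab //.
by apply: rsP => //; move: zab => /andP[az zb]; rewrite (le_lt_trans a0) // (lt_le_trans zb).
Qed.

Variable D : {poly K}.
Hypothesis D_gt0 : forall t : K, 0 <= t <= 1 -> 0 < D.[t].

(** Denominators are powers of the fixed [D], positive on the unit interval: a path in the torus has
    coordinates of this kind, inverses included. *)
Definition ratfun (g : K -> K) := exists m (q : {poly K}),
  forall t : K, 0 <= t <= 1 -> g t * D.[t] ^+ m = q.[t].

Lemma ratfun_cst c : ratfun (fun=> c).
Proof. by exists 0%N, c%:P => t _; rewrite expr0 mulr1 hornerC. Qed.

Lemma ratfunD f g : ratfun f -> ratfun g -> ratfun (fun t => f t + g t).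
Proof.
move=> [m [p Hp]] [m' [q Hq]].
exists (m + m')%N, (p * D ^+ m' + q * D ^+ m) => t t01.
by rewrite hornerD !hornerM !horner_exp -Hp // -Hq // exprD; ring.
Qed.

Lemma ratfunM f g : ratfun f -> ratfun g -> ratfun (fun t => f t * g t).
Proof.
move=> [m [p Hp]] [m' [q Hq]].
exists (m + m')%N, (p * q) => t t01.
by rewrite hornerM -Hp // -Hq // exprD; ring.
Qed.

Lemma ratfun_mmap m (v : K -> 'I_m -> K) (p : mpoly m K) :
  (forall k, ratfun (fun t => v t k)) -> ratfun (fun t => mmap idfun (v t) p).
Proof.
move=> Hv; rewrite /mmap; elim: (msupp p) => [|a s IH].
  by under eq_fun do rewrite big_nil; apply: ratfun_cst.
under eq_fun do rewrite big_cons; apply: ratfunD IH.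
apply: ratfunM; first exact: ratfun_cst.
rewrite /mmap1; elim: (index_enum _) => [|k r IH].
  by under eq_fun do rewrite big_nil; apply: ratfun_cst.
under eq_fun do rewrite big_cons; apply: ratfunM IH.
elim: (a k) => [|e IH]; first by under eq_fun do rewrite expr0; apply: ratfun_cst.
by under eq_fun do rewrite exprS; apply: ratfunM.
Qed.

Lemma ratfun_cvg g (a : K) (Fl : set_system K) {FF : Filter Fl} : ratfun g -> 0 <= a <= 1 ->
  Fl --> a -> (\forall t \near Fl, 0 <= t <= 1) -> g t @[t --> Fl] --> g a.
Proof.
move=> [m [q Hq]] a01 Fa near01.
have Dn0 (t : K) : 0 <= t <= 1 -> D.[t] ^+ m != 0 by move=> /D_gt0 Dt; rewrite expf_neq0 ?gt_eqF.
have -> : g a = q.[a] / (D ^+ m).[a] by rewrite -Hq // horner_exp mulfK // Dn0.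
have E : \forall t \near Fl, q.[t] / (D ^+ m).[t] = g t.
  by apply: filterS near01 => t t01; rewrite -Hq // horner_exp mulfK // Dn0.
apply: cvg_trans (near_eq_cvg E) _.
apply: cvgM; first exact: cvg_horner.
by apply: cvgV; [rewrite horner_exp Dn0|apply: cvg_horner].
Qed.

Variables (n : nat) (gam : K -> 'M[K]_n).
Hypothesis gam_rat : forall i j, ratfun (fun t => gam t i j).

(** Over a general real closed field an interval is connected only with respect to semialgebraic
    sets. The signs defining [C1] are constant between the roots of one polynomial, and relative
    closedness of [C1] and [C2] passes membership to the end points. *)
Lemma sa_path (V C1 C2 : set 'M[K]_n) : (forall t : K, 0 <= t <= 1 -> V (gam t)) ->
  semialgebraic C1 ->
  (exists2 E : set 'M[K]_n, closed E & C1 = V `&` E) ->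
  (exists2 E : set 'M[K]_n, closed E & C2 = V `&` E) ->
  C1 `|` C2 = V -> C1 `&` C2 = set0 -> (C1 (gam 0) <-> C1 (gam 1)).
Proof.
move=> Vg [d Ed] [E1 cE1 EC1] [E2 cE2 EC2] CU CI.
have sgn p : exists q : {poly K}, forall t : K, 0 <= t <= 1 ->
    Num.sg (eval_mx idfun (gam t) p) = Num.sg q.[t].
  have [|m [q Hq]] := @ratfun_mmap _ (fun t k => mxvec (gam t) 0 k) p.
    by case/mxvec_indexP => a b; under eq_fun do rewrite mxvecE.
  exists q => t t01; rewrite -Hq // sgrM [Num.sg (_ ^+ m)]gtr0_sg ?mulr1 //.
  by rewrite exprn_gt0 ?D_gt0.
have [qf Hqf] := boolp.choice sgn.
pose ps := flatten [seq c.1 ++ c.2 | c <- d].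
(* Polynomials that vanish identically along the path are left out of the product; their sign is
   constant. *)
pose Q := \prod_(p <- ps) (if qf p == 0 then 1 else qf p).
have Q0 : Q != 0.
  rewrite /Q; elim: (ps) => [|p s IH]; rewrite ?big_nil ?oner_eq0 // big_cons mulf_neq0 //.
  by case: ifP => [_|->//]; rewrite oner_eq0.
apply: (@interval_path Q (fun t => C1 (gam t)) Q0) => a b a0 ab b1 noroot.
have itv (t : K) : a <= t <= b -> 0 <= t <= 1.
  by move=> /andP[at_ tb]; rewrite (le_trans a0 at_) (le_trans tb b1).
have const (x y : K) : a < x < b -> a < y < b -> C1 (gam x) -> C1 (gam y).
  move=> xab yab.
  have sg p : p \in ps ->
      Num.sg (eval_mx idfun (gam x) p) = Num.sg (eval_mx idfun (gam y) p).
    move=> pps; rewrite !Hqf; try by apply: itv; rewrite !ltW //; lra.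
    have [->|qp0] := eqVneq (qf p) 0; first by rewrite !horner0.
    apply: (@polyrcf.polyrN0_itv _ `]a, b[); rewrite ?in_itv //= => z.
    rewrite in_itv /= => /noroot; apply: contra => qz; rewrite /root /Q horner_prod.
    by rewrite (big_rem p) //= (negbTE qp0) (eqP qz) mul0r.
  rewrite Ed => -[c cd [H1 H2]]; exists c => //.
  have inps p : (p \in c.1) || (p \in c.2) -> p \in ps.
    by move=> pc; apply/flattenP; exists (c.1 ++ c.2); [apply/mapP; exists c|rewrite mem_cat].
  split=> p pc; first by apply/eqP; rewrite -sgr_eq0 -sg ?H1 ?sgr0 // inps // pc.
  by rewrite -sgr_gt0 -sg ?sgr_gt0 ?H2 // inps // pc orbT.
have cvga (Fl : set_system K) (x : K) (FF : ProperFilter Fl) : a <= x <= b -> Fl --> x ->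
    (\forall t \near Fl, a < t < b) -> forall E : set 'M[K]_n, closed E ->
    (forall t : K, a < t < b -> E (gam t)) -> E (gam x).
  move=> xab Fx nt E cE HE; apply: (@closed_cvg _ _ Fl FF gam E) => //.
    by apply: (filterS _ nt) => t tab; apply: HE.
  apply: cvg_mx => i j; apply: ratfun_cvg => //; first exact: itv.
  by apply: (filterS _ nt) => t /andP[at_ tb]; apply: itv; rewrite !ltW.
have ends (E : set 'M[K]_n) : closed E -> (forall t : K, a < t < b -> E (gam t)) ->
    E (gam a) /\ E (gam b).
  move=> cE HE; split.
    apply: (cvga a^'+ a) => //; rewrite ?lexx ?ltW //.
      exact: cvg_within.
    by near=> t; apply/andP; split; near: t; [apply: nbhs_right_gt|apply: nbhs_right_lt].
  apply: (cvga b^'- b) => //; rewrite ?lexx ?ltW //.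
    exact: cvg_within.
  by near=> t; apply/andP; split; near: t; [apply: nbhs_left_gt|apply: nbhs_left_lt].
have [Va Vb] : V (gam a) /\ V (gam b) by split; apply/Vg/itv; rewrite ?lexx ltW.
pose m := (a + b) / 2; have mab : a < m < b by rewrite /m; apply/andP; split; lra.
have Vt (t : K) : a < t < b -> V (gam t) by move=> tab; apply/Vg/itv; rewrite !ltW //; lra.
have [Cm|nCm] := pselect (C1 (gam m)).
  have [] := ends E1 cE1; last by rewrite EC1 => Ea Eb; split.
  by move=> t tab; have := const m t mab tab Cm; rewrite EC1 => -[].
have [|Ea Eb] := ends E2 cE2.
  move=> t tab; suff : C2 (gam t) by rewrite EC2 => -[].
  have := Vt t tab; rewrite -CU => -[Ct|//]; by have := nCm (const t m tab mab Ct).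
have dis x : V x -> E2 x -> ~ C1 x.
  move=> Vx Ex Cx; have : (C1 `&` C2) x by split=> //; rewrite EC2; split.
  by rewrite CI.
by split=> Cx; [have := dis _ Va Ea Cx|have := dis _ Vb Eb Cx].
Unshelve. all: by end_near.
Qed.

End OneDim.

(** * The identity component of a split torus *)

Lemma geom_real (K : rcfType) n (P : set (mxpoly K n)) (s : 'M[K]_n) :
  geom P (map_mx (real_complex K) s) <-> zeros idfun P s.
Proof.
split=> H p Pp; have := H p Pp; rewrite (eval_mx_map (i := idfun) (f := real_complex K)) //.
  by move/eqP; rewrite fmorph_eq0 => /eqP.
by move=> E; apply/eqP; rewrite fmorph_eq0; apply/eqP.
Qed.

Section SplitTorus.
Variables (K : rcfType) (n : nat) (S : seq (mxpoly K n)).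
Local Notation C := K[i].
Local Notation rc := (real_complex K).
Local Notation V := (zeros idfun [set` S] : set 'M[K]_n).
Local Notation ev s p := (eval_mx idfun s p).

Definition with_inv (L : fieldType) r (t : 'rV[L]_r) : 'rV[L]_(r + r) :=
  row_mx t (map_mx GRing.inv t).

Lemma mmap1_with_inv (L : fieldType) r (t : 'rV[L]_r) (m : multinom (r + r)) : nonzero t ->
  mmap1 (fun k => with_inv t 0 k) m =
  zexp t (\row_i ((m (lshift r i))%:Z - (m (rshift r i))%:Z)).
Proof.
move=> t0; rewrite /mmap1 big_split_ord /= -big_split; apply: eq_bigr => i _ /=.
by rewrite /with_inv row_mxEl row_mxEr !mxE expfzDr ?t0 // -exprnN exprVn.
Qed.

Lemma zexp_inj (r : nat) (c c' : 'rV[int]_r) :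
  (forall t : 'rV[K]_r, (forall i, 0 < t 0 i) -> zexp t c = zexp t c') -> c = c'.
Proof.
move=> E; apply/rowP => i; pose t : 'rV[K]_r := \row_j if j == i then 2 else 1.
have Et d : zexp t d = 2 ^ d 0 i.
  rewrite /zexp (bigD1 i) //= mxE eqxx big1 ?mulr1 // => j ji.
  by rewrite mxE (negbTE ji) exp1rz.
have t0 j : 0 < t 0 j by rewrite mxE; case: ifP.
have := E t t0; rewrite !Et; apply: ieexprIz => //.
by rewrite (eqr_nat K 2 1).
Qed.

(** What remains of the positive points once coordinates are forgotten; the last clause is Zariski
    density in the torus. *)
Definition torus_component (A : set 'M[K]_n) : Prop :=
  [/\ A 1%:M, (forall s t, A s -> A t -> A (s *m t)),
      (forall s, A s -> exists2 t, A t & s = t *m t),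
      (forall s, V s -> A (s *m s)) &
      (forall p : mxpoly K n, (forall s, A s -> ev s p = 0) ->
         forall s, geom [set` S] s -> eval_mx rc s p = 0)].

(** In the coordinates of the torus the component of the identity is the positive orthant, where
    square roots exist. Segments connect it, and since coordinates never vanish their signs separate
    it from the rest. *)
Theorem split_torus_component : split_torus [set` S] ->
  exists q : seq (mxpoly K n), let A := sa_points idfun [:: (S, q)] in
    sa_component V 1%:M = A /\ torus_component A.
Proof.
move=> [[_ S1 SM _] [r [phi [psi [fT hT hfC fhC fMC]]]]].
pose f (s : 'M[K]_n) : 'rV[K]_r := \row_i ev s (phi i).
pose h (t : 'rV[K]_r) : 'M[K]_n :=
  \matrix_(i, j) mmap idfun (fun k => with_inv t 0 k) (psi i j).
have rcf s : \row_i eval_mx rc (map_mx rc s) (phi i) = map_mx rc (f s).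
  by apply/rowP => i; rewrite !mxE (eval_mx_map (i := idfun) (f := rc)).
have rch t : (\matrix_(i, j) mmap rc
        (fun k => row_mx (map_mx rc t) (map_mx GRing.inv (map_mx rc t)) 0 k) (psi i j)) =
     map_mx rc (h t).
  apply/matrixP => i j; rewrite !mxE -(mmap_rmorph (f := rc) (j := rc)) //.
  congr mmap; apply/funext => k; rewrite /with_inv.
  case: (split_ordP k) => l ->; rewrite ?row_mxEl ?row_mxEr !mxE //.
  by rewrite fmorphV.
have f0 s : V s -> forall i, f s 0 i != 0.
  move=> /geom_real/fT H i; have := H i; rewrite rcf mxE.
  by rewrite fmorph_eq0.
have nzrc (t : 'rV[K]_r) : (forall i, t 0 i != 0) -> torus_points (map_mx rc t).
  by move=> t0 i; rewrite mxE fmorph_eq0.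
have hV (t : 'rV[K]_r) : (forall i, t 0 i != 0) -> V (h t).
  by move=> /nzrc/hT; rewrite rch => /geom_real.
have rcI (a b : nat) : injective (map_mx rc : 'M[K]_(a, b) -> 'M[C]_(a, b)).
  exact: map_mx_inj.
have hf s : V s -> h (f s) = s.
  by move=> /geom_real/hfC; rewrite rcf rch => /rcI.
have fh (t : 'rV[K]_r) : (forall i, t 0 i != 0) -> f (h t) = t.
  by move=> /nzrc/fhC; rewrite rch rcf => /rcI.
have fM s s' : V s -> V s' -> forall i, f (s *m s') 0 i = f s 0 i * f s' 0 i.
  move=> /geom_real Vs /geom_real Vs' i; have := fMC _ _ Vs Vs' i.
  by rewrite -map_mxM !rcf !mxE -rmorphM => /complexI.
have VM s s' : V s -> V s' -> V (s *m s').
  by move=> /geom_real Vs /geom_real Vs'; apply/geom_real; rewrite map_mxM; apply: SM.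
have V1 : V 1%:M by apply/geom_real; rewrite map_mx1.
have f1 i : f 1%:M 0 i = 1.
  have := fM _ _ V1 V1 i; rewrite mulmx1 => E; apply: (mulfI (f0 _ V1 i)).
  by rewrite mulr1 -E.
pose q := [seq phi i | i <- enum 'I_r]; exists q => A.
have AE s : A s <-> V s /\ forall i, 0 < f s 0 i.
  split=> [[c] |[Vs fs]].
    rewrite inE => /eqP -> [/= H1 H2]; split=> // i; rewrite mxE; apply: H2.
    by rewrite map_f // mem_enum.
  exists (S, q); rewrite ?inE //; split=> // _ /mapP[i _ ->].
  by have := fs i; rewrite mxE.
have gt_n0 (t : 'rV[K]_r) : (forall i, 0 < t 0 i) -> forall i, t 0 i != 0.
  by move=> t0 i; rewrite gt_eqF.
split; last split.
- apply/seteqP; split=> y.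
  + move=> [D [[d Ed] conD DV D1 Dy]].
    (* Either all coordinates are positive or some coordinate is negative: as none vanishes on the
       torus, both conditions are closed in [D], and [1%:M] satisfies the first. *)
    have [] := conD (D `&` [set s | forall p, p \in q -> 0 < ev s p])
        (D `&` [set s | exists2 p, p \in q & 0 < ev s (- p)]).
    * exists [seq (c.1, q ++ c.2) | c <- d]; rewrite Ed; apply/seteqP; split=> s.
        move=> [[c cd [H1 H2]] H3]; exists (c.1, q ++ c.2); first by apply/mapP; exists c.
        by split=> // p; rewrite mem_cat => /orP[/H3|/H2].
      move=> [_ /mapP[c cd ->] [/= H1 H2]]; split; last first.
        by move=> p pq; apply: H2; rewrite mem_cat pq.
      by exists c => //; split=> // p pc; apply: H2; rewrite mem_cat pc orbT.
    * exists [seq (c.1, - p :: c.2) | c <- d, p <- q]; rewrite Ed; apply/seteqP; split=> s.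
        move=> [[c cd [H1 H2]] [p pq sp]]; exists (c.1, - p :: c.2).
          by apply/allpairsP; exists (c, p).
        by split=> // p'; rewrite inE => /orP[/eqP->|/H2].
      move=> [_ /allpairsP[[c p] [/= cd pq ->]] [/= H1 H2]]; split; last first.
        by exists p => //; apply: H2; rewrite mem_head.
      by exists c => //; split=> // p' pc; apply: H2; rewrite inE pc orbT.
    * exists [set s | forall p, p \in q -> 0 <= ev s p].
        elim: (q) => [|p l IH].
          by rewrite (_ : [set _ | _] = setT) ?closedT //; apply/seteqP; split.
        have -> : [set s : 'M[K]_n | forall p0, p0 \in p :: l -> 0 <= ev s p0] =
          [set s | 0 <= ev s p] `&` [set s | forall p, p \in l -> 0 <= ev s p].
          apply/seteqP; split=> s H.
            by split=> [|p' pl]; apply: H; rewrite inE ?eqxx ?pl ?orbT.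
          by case: H => H1 H2 p'; rewrite inE => /orP[/eqP->|/H2].
        by apply: closedI => //; apply: closed_eval_ge.
      apply/seteqP; split=> s [Ds H]; split=> // p pq; first exact/ltW/H.
      rewrite lt0r H // andbT; case/mapP: pq => i _ ->.
      by have := f0 s (DV s Ds) i; rewrite mxE.
    * exists [set s | exists2 p, p \in q & 0 <= ev s (- p)].
        elim: (q) => [|p l IH].
          have -> : [set s : 'M[K]_n | exists2 p : mxpoly K n, p \in [::] & 0 <= ev s (- p)] = set0.
            by apply/seteqP; split=> // s [].
          exact: closed0.
        have -> : [set s : 'M[K]_n | exists2 p0, p0 \in p :: l & 0 <= ev s (- p0)] =
          [set s | 0 <= ev s (- p)] `|` [set s | exists2 p, p \in l & 0 <= ev s (- p)].
          apply/seteqP; split=> s.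
            by move=> [p']; rewrite inE => /orP[/eqP->|pl H]; [left|right; exists p'].
          by case=> [H|[p' pl H]]; [exists p|exists p'] => //; rewrite inE ?eqxx ?pl ?orbT.
        by apply: closedU => //; apply: closed_eval_ge.
      apply/seteqP; split=> s [Ds [p pq H]]; split=> //; exists p => //; first exact/ltW.
      rewrite lt0r H // andbT; case/mapP: pq => i _ ->.
      by have := f0 s (DV s Ds) i; rewrite mxE /eval_mx rmorphN oppr_eq0.
    * apply/seteqP; split=> s; first by case=> -[].
      move=> Ds; have [H|H] := pselect (exists2 p, p \in q & 0 < ev s (- p)).
        by right.
      left; split=> // p pq; have [//|le] := ltP 0 (ev s p); case: H; exists p => //.
      rewrite /eval_mx rmorphN oppr_gt0 lt_neqAle le andbT; case/mapP: pq => i _ ->.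
      by have := f0 s (DV s Ds) i; rewrite mxE.
    * apply/seteqP; split=> // s [[_ H] [_ [p pq]]].
      by rewrite /eval_mx rmorphN oppr_gt0 => /(lt_trans (H p pq)); rewrite ltxx.
    * move=> E; apply/AE; split; first exact: DV.
      have [_ H] : (D `&` [set s | forall p, p \in q -> 0 < ev s p]) y by rewrite E.
      by move=> i; rewrite mxE; apply: H; rewrite map_f // mem_enum.
    * move=> E; have [_ [p]] :
        (D `&` [set s | exists2 p, p \in q & 0 < ev s (- p)]) 1%:M by rewrite E.
      case/mapP => i _ ->; rewrite /eval_mx rmorphN oppr_gt0 => H.
      have {}H : ev 1%:M (phi i) < 0 := H.
      by have := f1 i; rewrite mxE => E1; move: H; rewrite E1 ltr10.
  + move=> Ay; exists A; split=> //; first by exists [:: (S, q)].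
    * move=> C1 C2 sC1 sC2 cC1 cC2 CU CI.
      have [[x Cx]|no] := pselect (exists x, C1 x); last first.
        right; rewrite -CU; apply/seteqP; split=> s; first by right.
        by case=> // Cs; case: no; exists s.
      have [[z Cz]|no] := pselect (exists x, C2 x); last first.
        left; rewrite -CU; apply/seteqP; split=> s; first by left.
        by case=> // Cs; case: no; exists s.
      have [Vx fx] : V x /\ forall i, 0 < f x 0 i by apply/AE; rewrite -CU; left.
      have [Vz fz] : V z /\ forall i, 0 < f z 0 i by apply/AE; rewrite -CU; right.
      (* The segment between the coordinates of [x] and [z] stays in the orthant; powers of the
         product of the [ti] are the denominators of its image under [h]. *)
      pose ti i : {poly K} := (f x 0 i)%:P + (f z 0 i - f x 0 i)%:P * 'X.
      have tiE i t : (ti i).[t] = f x 0 i + (f z 0 i - f x 0 i) * t by rewrite !hornerE.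
      have ti0 i (t : K) : 0 <= t <= 1 -> 0 < (ti i).[t].
        rewrite tiE => /andP[t0 t1].
        have [t_0|] := eqVneq t 0; first by rewrite t_0 mulr0 addr0.
        move=> tn0; have {}t0 : 0 < t by rewrite lt0r tn0.
        have -> : f x 0 i + (f z 0 i - f x 0 i) * t = (1 - t) * f x 0 i + t * f z 0 i by ring.
        by rewrite ltr_wpDl ?mulr_ge0 ?mulr_gt0 ?subr_ge0 // ltW.
      pose gam (t : K) := h (\row_i (ti i).[t]).
      have [] : C1 (gam 0) <-> C1 (gam 1).
        apply: (@sa_path K (\prod_i ti i) _ n gam _ A C1 C2) => //.
        - by move=> t t01; rewrite horner_prod; apply: prodr_gt0 => i _; apply: ti0.
        - move=> i j; have -> : (fun t => gam t i j) =
              fun t => mmap idfun (fun k => with_inv (\row_l (ti l).[t]) 0 k) (psi i j).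
            by apply/funext => t; rewrite mxE.
          apply: ratfun_mmap => k; rewrite /with_inv; case: (split_ordP k) => l ->.
            by exists 0%N, (ti l) => t _; rewrite row_mxEl mxE expr0 mulr1.
          exists 1%N, (\prod_(j | j != l) ti j) => t t01; rewrite row_mxEr !mxE expr1.
          rewrite (bigD1 l) //= hornerM mulKf // gt_eqF //; exact: ti0.
        - move=> t t01; apply/AE; have t0 i : (\row_i (ti i).[t]) 0 i != 0.
            by rewrite mxE gt_eqF // ti0.
          by split=> [|i]; [apply: hV|rewrite fh // mxE ti0].
      have -> : gam 0 = x.
        by rewrite /gam -[RHS]hf //; congr h; apply/rowP => i; rewrite mxE tiE mulr0 addr0.
      have -> : gam 1 = z.
        by rewrite /gam -[RHS]hf //; congr h; apply/rowP => i; rewrite mxE tiE mulr1 subrKC.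
      move=> /(_ Cx) C1z _; have : (C1 `&` C2) z by [].
      by rewrite CI.
    * by move=> s /AE[].
    * by apply/AE; split=> // i; rewrite f1.
- by apply/AE; split=> // i; rewrite f1.
- move=> s t /AE[Vs fs] /AE[Vt ft]; apply/AE; split=> [|i]; first exact: VM.
  by rewrite fM // mulr_gt0.
- move=> s /AE[Vs fs]; pose t : 'rV[K]_r := \row_i Num.sqrt (f s 0 i).
  have t0 i : 0 < t 0 i by rewrite mxE sqrtr_gt0.
  have Vt := hV t (gt_n0 t t0).
  exists (h t); first by apply/AE; split=> // i; rewrite fh //; apply: gt_n0.
  rewrite -[LHS]hf // -[RHS]hf; last exact: VM.
  congr h; apply/rowP => i; rewrite fM // fh; last exact: gt_n0.
  have -> : t 0 i = Num.sqrt (f s 0 i) by rewrite [LHS]mxE.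
  by rewrite -expr2 sqr_sqrtr // ltW.
- move=> s Vs; apply/AE; split=> [|i]; first exact: VM.
  by rewrite fM // -expr2 exprn_even_gt0 //= f0.
(* A polynomial on the torus is a combination of characters; those that agree on the orthant have
   equal exponents by [zexp_inj], so vanishing spreads from the orthant to [z]. *)
move=> p pA s Ss; rewrite -(hfC s Ss); set z := (\row_i _).
have z0 : nonzero z by apply: fT.
pose P := mmap (@mpolyC (r + r) K) (fun l => mxvec (\matrix_(i, j) psi i j) 0 l) p.
have PE (L : fieldType) (i : {rmorphism K -> L}) v :
    mmap i v P = eval_mx i (\matrix_(a, b) mmap i v (psi a b)) p.
  by rewrite mmap_comp_mx; congr eval_mx; apply/matrixP => a b; rewrite !mxE.
rewrite -PE /mmap.
pose sq := [seq (rc (mcoeff m P), m) | m <- msupp P].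
transitivity (\sum_(w <- sq) w.1 * mmap1 (fun k => with_inv z 0 k) w.2).
  by rewrite [RHS]big_map.
pose mulT (x y : 'rV[K]_r) : 'rV[K]_r := \row_i (x 0 i * y 0 i).
pose chi (m : multinom (r + r)) (y : 'rV[K]_r) : C := rc (mmap1 (fun k => with_inv y 0 k) m).
apply: (@indep_chars C _ [set t : 'rV[K]_r | forall i, 0 < t 0 i] mulT (const_mx 1) _ _ _ chi).
- by move=> i; rewrite mxE.
- by move=> x y x0 y0 i; rewrite mxE mulr_gt0.
- move=> m; rewrite /chi mmap1_with_inv => [|i]; last by rewrite mxE oner_eq0.
  by rewrite /zexp big1 ?rmorph1 // => i _; rewrite mxE exp1rz.
- move=> m x y; rewrite /chi -rmorphM /mmap1 -big_split; congr rc; apply: eq_bigr => k _ /=.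
  rewrite -exprMn; congr (_ ^+ _); rewrite /with_inv.
  by case: (split_ordP k) => l ->; rewrite ?row_mxEl ?row_mxEr !mxE ?invfM.
- move=> t t0.
  have : mmap idfun (fun k => with_inv t 0 k) P = 0.
    rewrite PE; apply: pA; apply/AE.
    by split=> [|i]; [apply/hV/gt_n0|rewrite fh //; apply: gt_n0].
  move=> /(congr1 rc); rewrite rmorph0 => H; rewrite -[RHS]H /mmap rmorph_sum [LHS]big_map.
  by apply: eq_bigr => m _; rewrite rmorphM.
- move=> m1 m2 E; rewrite !mmap1_with_inv //; congr zexp; apply: zexp_inj => t t0.
  have := E t t0; rewrite /chi => /(fmorph_inj rc).
  by rewrite !mmap1_with_inv // => i; rewrite gt_eqF.
Qed.

End SplitTorus.

(** * The real exponential *)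

Section RealExponential.
Variables (R : realType) (n : nat).
Implicit Types (X : 'M[R]_n).

Lemma exp_trunc_entry m (t : R) X a b :
  exp_trunc m (t *: X) a b = \sum_(0 <= k < m) t ^+ k * (X ^+ k) a b / k`!%:R.
Proof.
rewrite /exp_trunc summxE big_mkord; apply: eq_bigr => k _.
by rewrite mxE expmxZ mxE mulrC.
Qed.

Lemma expmx_qdiag (Q : 'M[R]_n) d : Q *m Q^T = 1%:M ->
  expmx (Q^T *m diag_mx d *m Q) = Q^T *m diag_mx (map_mx expR d) *m Q.
Proof.
move=> QQ; have QQ' : Q^T *m Q = 1%:M by apply: mulmx1C.
have powE k : (Q^T *m diag_mx d *m Q) ^+ k = Q^T *m diag_mx (\row_l d 0 l ^+ k) *m Q.
  elim: k => [|k IH].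
    rewrite expr0 (_ : \row_l _ = const_mx 1) ?diag_const_mx ?mulmx1 ?QQ' //.
    by apply/rowP => l; rewrite !mxE.
  rewrite exprS IH -mulmxE !mulmxA -[_ *m Q *m Q^T]mulmxA QQ mulmx1.
  rewrite -[Q^T *m diag_mx d *m _]mulmxA mulmx_diag; congr (_ *m diag_mx _ *m _).
  by apply/rowP => l; rewrite !mxE exprS.
apply/matrixP => a b; rewrite mxE; apply: cvg_lim => //.
have entry (z : 'rV[R]_n) : (Q^T *m diag_mx z *m Q) a b = \sum_l Q l a * z 0 l * Q l b.
  by rewrite mxE; apply: eq_bigr => l _; rewrite mul_mx_diag !mxE.
rewrite entry.
have -> : (fun m => exp_trunc m (Q^T *m diag_mx d *m Q) a b) =
    fun m => \sum_l Q l a * series (exp_coeff (d 0 l)) m * Q l b.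
  apply/funext => m; rewrite -[X in exp_trunc m X]scale1r exp_trunc_entry.
  under [RHS]eq_bigr do rewrite /series /= mulr_sumr mulr_suml.
  rewrite exchange_big /=; apply: eq_bigr => k _; rewrite expr1n mul1r powE entry mulr_suml.
  by apply: eq_bigr => l _; rewrite mxE /exp_coeff /=; ring.
elim: (index_enum _) => [|l r IH].
  by under eq_fun do rewrite big_nil; rewrite big_nil; apply: cvg_cst.
under eq_fun do rewrite big_cons; rewrite big_cons; apply: cvgD IH.
apply: cvgM; last exact: cvg_cst.
apply: cvgM; first exact: cvg_cst.
by rewrite mxE; apply: is_cvg_series_exp_coeff.
Qed.

Lemma expmx_nilp X : X ^+ n = 0 -> expmx X = exp_nilp X.
Proof.
move=> X0; apply/matrixP => a b; rewrite mxE; apply: cvg_lim => //.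
apply: cvg_near_cst; exists n => // m /= nm.
rewrite /exp_nilp /exp_trunc -(subnKC nm) big_split_ord /= [X in _ + X]big1 ?addr0 //.
by move=> k _; rewrite exprD X0 mul0r scaler0.
Qed.

Let bnd X := \sum_a \sum_b `|X a b|.

Lemma exp_mx_bound X k a b : `|(X ^+ k) a b| <= bnd X ^+ k.
Proof.
elim: k a b => [|k IH] a b; first by rewrite !expr0 mxE; case: eqP; rewrite ?normr1 ?normr0.
rewrite exprS -mulmxE mxE exprS; apply: (le_trans (ler_norm_sum _ _ _)).
have B0 : 0 <= bnd X by apply: sumr_ge0 => ? _; apply: sumr_ge0.
apply: le_trans (_ : (\sum_c `|X a c|) * bnd X ^+ k <= _).
  by rewrite mulr_suml; apply: ler_sum => c _; rewrite normrM ler_wpM2l.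
rewrite ler_wpM2r ?exprn_ge0 // /bnd [X in _ <= X](bigD1 a) //= lerDl.
by apply: sumr_ge0 => ? _; apply: sumr_ge0.
Qed.

(** The tail of the series is at most [t ^+ 2] times the exponential series of the bound, because
    [t] is at most one in absolute value. *)
Lemma expmx_second_order X (t : R) a b : `|t| <= 1 ->
  `|expmx (t *: X) a b - (1%:M : 'M[R]_n) a b - t * X a b| <= t ^+ 2 * expR (bnd X).
Proof.
move=> t1; have B0 : 0 <= bnd X by apply: sumr_ge0 => ? _; apply: sumr_ge0.
pose u k := t ^+ k * (X ^+ k) a b / k`!%:R.
have ule k : `|u k| <= exp_coeff (bnd X) k.
  rewrite /u /exp_coeff /= normrM [X in _ * X]ger0_norm ?invr_ge0 ?ler0n // ler_wpM2r ?invr_ge0 ?ler0n //.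
  rewrite normrM normrX -[X in _ <= X]mul1r ler_pM ?exprn_ge0 ?normr_ge0 ?exp_mx_bound //.
  exact: exprn_ile1.
have cu : cvgn (series u).
  apply: normed_cvg; apply: series_le_cvg (is_cvg_series_exp_coeff (bnd X)) => k //=.
  exact: exp_coeff_ge0.
have EE : (fun m => exp_trunc m (t *: X) a b) = series u.
  by apply/funext => m; rewrite exp_trunc_entry.
have -> : expmx (t *: X) a b = limn (series u) by rewrite mxE EE.
pose w := fun m => `|series u m - (1%:M : 'M[R]_n) a b - t * X a b|.
have cw : w @ \oo --> `|limn (series u) - (1%:M : 'M[R]_n) a b - t * X a b|.
  by apply: cvg_norm; apply: cvgB; [apply: cvgB => //|]; apply: cvg_cst.
have wle : \forall m \near \oo, w m <= t ^+ 2 * expR (bnd X).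
  exists 2%N => // m /= m2; rewrite /w /series /=.
  rewrite big_ltn ?(ltn_trans _ m2) // big_ltn //.
  have -> : u 0%N = (1%:M : 'M[R]_n) a b by rewrite /u !expr0 mul1r divr1.
  have -> : u 1%N = t * X a b by rewrite /u !expr1 divr1.
  set x := (1%:M : 'M[R]_n) a b; set s := \sum_(2 <= i < m) u i.
  have -> : x + (t * X a b + s) - x - t * X a b = s by ring.
  apply: (le_trans (ler_norm_sum _ _ _)).
  apply: le_trans (_ : t ^+ 2 * \sum_(2 <= k < m) exp_coeff (bnd X) k <= _).
    rewrite mulr_sumr big_nat_cond [X in _ <= X]big_nat_cond.
    apply: ler_sum => k /andP[/andP[k2 _] _].
    rewrite /u /exp_coeff /= mulrA normrM.
    rewrite [X in _ * X <= _]ger0_norm ?invr_ge0 ?ler0n // ler_wpM2r ?invr_ge0 ?ler0n //.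
    rewrite normrM normrX ler_pM ?exprn_ge0 ?normr_ge0 ?exp_mx_bound //.
    rewrite -[X in _ <= X]ger0_norm ?sqr_ge0 // normrX.
    by rewrite -(subnKC k2) exprD -[X in _ <= X]mulr1 ler_wpM2l ?exprn_ge0 ?exprn_ile1.
  rewrite ler_wpM2l ?sqr_ge0 //.
  apply: le_trans (_ : series (exp_coeff (bnd X)) m <= _).
    rewrite /series /= [X in _ <= X](@big_cat_nat _ _ _ 2%N) //= lerDr.
    by apply: sumr_ge0 => k _; apply: exp_coeff_ge0.
  apply: nondecreasing_cvgn_le; last exact: is_cvg_series_exp_coeff.
  by apply: nondecreasing_series => k _ _; apply: exp_coeff_ge0.
exact: (cvgr_to_le cw wle).
Qed.

(** Traces against [c] are the linear forms on matrices. A form that vanishes along the curve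
    vanishes on its tangent, by the second order estimate. *)
Lemma expmx_linear_part (c : 'M[R]_n) X : \tr c = 0 ->
  (forall t : R, \tr (c *m expmx (t *: X)) = 0) -> \tr (c *m X) = 0.
Proof.
move=> c1 cE.
have trE Y : \tr (c *m Y) = \sum_a \sum_b c a b * Y b a.
  by rewrite /mxtrace; apply: eq_bigr => a _; rewrite mxE.
pose C := (\sum_a \sum_b `|c a b|) * expR (bnd X).
have C0 : 0 <= C.
  by rewrite mulr_ge0 ?expR_ge0 //; apply: sumr_ge0 => ? _; apply: sumr_ge0.
have main (t : R) : `|t| <= 1 -> `|t * \tr (c *m X)| <= t ^+ 2 * C.
  move=> t1; have -> : t * \tr (c *m X) =
      - \tr (c *m (expmx (t *: X) - 1%:M - t *: X)).
    rewrite !mulmxBr !linearB /= cE mulmx1 c1 -scalemxAr linearZ /=; ring.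
  rewrite normrN trE; apply: (le_trans (ler_norm_sum _ _ _)).
  rewrite /C mulrA [t ^+ 2 * _]mulrC -mulrA mulr_suml; apply: ler_sum => a _.
  apply: (le_trans (ler_norm_sum _ _ _)); rewrite mulr_suml; apply: ler_sum => b _.
  by rewrite normrM ler_wpM2l // !mxE; have := expmx_second_order X b a t1; rewrite !mxE.
apply/eqP; apply: contraT; rewrite -normr_gt0; set y := \tr _ => y0.
have s0 : 0 < C + 1 + `|y| by lra.
(* [t] is chosen so that [t * C] falls below the norm of [y], against the estimate divided by
   [t]. *)
pose t := `|y| / (C + 1 + `|y|); have t0 : 0 < t by rewrite divr_gt0.
have t1 : t <= 1 by rewrite ler_pdivrMr // mul1r; lra.
have := main t; rewrite [X in X <= 1 -> _]ger0_norm ?(ltW t0) // => /(_ t1).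
rewrite normrM [X in X * _ <= _]ger0_norm ?(ltW t0) // expr2 -mulrA ler_pM2l // => H.
have : t * C < `|y|.
  rewrite /t mulrAC ltr_pdivrMr // -subr_gt0.
  have -> : `|y| * (C + 1 + `|y|) - `|y| * C = `|y| * (1 + `|y|) by ring.
  by rewrite mulr_gt0 //; lra.
by rewrite ltNge H.
Qed.

End RealExponential.

(** * Extensions of definable sets *)

Section DefinableSets.
Variables (K : rcfType) (n : nat).

Lemma definable_map (I : finType) (P : relfun K I n) (L : rcfType) (i : {rmorphism K -> L})
    (V : I -> 'M[K]_n) :
  definable P -> (P L i (fun c => map_mx i (V c)) <-> P K idfun V).
Proof.
move=> [s Hs]; apply: Hs => p _; rewrite -[RHS](rcf_rmorph_sgz i).
rewrite -(mmap_rmorph (i := idfun) (f := i) (j := i)) //; congr (sgz (mmap _ _ _)).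
by apply/funext => j; rewrite /point mxE.
Qed.

(** No map between [R] and [F] is given: the statement descends to [K] and rises from there. *)
Theorem transfer_from (I : finType) (P : relfun K I n) (R F : rcfType)
    (iR : {rmorphism K -> R}) (iF : {rmorphism K -> F}) :
  definable P -> (forall V, P R iR V) -> forall V, P F iF V.
Proof.
move=> dP PR V; apply: transfer => // W; apply/(definable_map iR W dP); exact: PR.
Qed.

(** By transfer, formulas with the same points over [L] have the same points over [F], so any of
    them computes the extension. *)
Lemma extension_sa (L F : rcfType) (iL : {rmorphism K -> L}) (iF : {rmorphism K -> F})
    (d : sa_formula K n) :
  extension iL iF (sa_points iL d) = sa_points iF d.
Proof.
apply/seteqP; split=> [M [d' E]|M Md]; last by exists d.
have Vv := @mxpol_var K unit n tt.
have dP := def_impl (def_sa d' Vv) (def_sa d Vv).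
have := transfer_from iF dP (R := L) (iR := iL) _ (fun=> M); apply=> V.
by rewrite E.
Qed.

Lemma mxpolX (I : finType) (f : mxpolyfun K I n) k : is_mxpol f ->
  is_mxpol (fun L i V => f L i V ^+ k).
Proof.
move=> Hf; elim: k => [|k IH].
  have [B HB] := mxpol_const I (1%:M : 'M[K]_n); exists B => L i V.
  by rewrite -HB expr0 map_mx1.
have [B HB] := mxpolM Hf IH; exists B => L i V.
by rewrite exprS -HB.
Qed.

Lemma mxpol_exp (I : finType) (f : mxpolyfun K I n) : is_mxpol f ->
  is_mxpol (fun L i V => exp_nilp (f L i V)).
Proof.
move=> Hf; have [B HB] := mxpol_sum (enum 'I_n)
  (fun k : 'I_n => mxpolZ (k`!%:R)^-1 (mxpolX k Hf)).
exists B => L i V; rewrite -HB /exp_nilp /exp_trunc big_enum.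
by apply: eq_bigr => k _; rewrite fmorphV rmorph_nat.
Qed.

Lemma pol_mxpoly (f : polyfun K unit n) : is_pol f ->
  exists p : mxpoly K n, forall (L : rcfType) (i : {rmorphism K -> L}) M,
    eval_mx i M p = f L i (fun=> M).
Proof.
move=> [b Hb].
pose w (j : 'I_(nvar unit n)) : mxpoly K n :=
  let t := enum_val j in mpolyX K (mnm1 (mxvec_index t.2.1 t.2.2)).
exists (mmap (@mpolyC _ _) w b) => L i M.
rewrite Hb /eval_mx [X in mmap _ _ X]/mmap rmorph_sum [RHS]/mmap.
apply: eq_bigr => a _; rewrite rmorphM /= mmapC; congr (_ * _).
rewrite /mmap1 rmorph_prod; apply: eq_bigr => l _; rewrite rmorphXn.
by rewrite /w /= mmapX mmap1U mxvecE.
Qed.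

Lemma pols_formula (J : eqType) (r : seq J) (f : J -> polyfun K unit n) :
  (forall j, is_pol (f j)) ->
  exists l : seq (mxpoly K n), forall (L : rcfType) (i : {rmorphism K -> L}) M,
    zeros i [set` l] M <-> (forall j, j \in r -> f j L i (fun=> M) = 0).
Proof.
move=> Hf; have [p Hp] := boolp.choice (fun j => pol_mxpoly (Hf j)).
exists [seq p j | j <- r] => L i M; split=> H.
  by move=> j jr; rewrite -Hp; apply: H; rewrite /= map_f.
by move=> _ /mapP[j jr ->]; rewrite Hp H.
Qed.

Lemma sa_points_zeros (L : rcfType) (i : K -> L) (l : seq (mxpoly K n)) :
  sa_points i [:: (l, [::])] = zeros i [set` l].
Proof.
apply/seteqP; split=> M; first by move=> [c]; rewrite inE => /eqP-> [].
by move=> H; exists (l, [::]); rewrite ?inE.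
Qed.

(** Prepares a definition of root spaces over [K]: a weight condition on the entries together with a
    polynomial condition on the exponential. *)
Lemma exp_formula (G : seq (mxpoly K n)) (Q Q' : 'M[K]_n) (P : rel 'I_n) :
  exists d : sa_formula K n, forall (L : rcfType) (i : {rmorphism K -> L}) (X : 'M[L]_n),
    sa_points i d X <->
    (forall a b, ~~ P a b -> (map_mx i Q *m X *m map_mx i Q') a b = 0) /\
    zeros i [set` G] (exp_nilp X).
Proof.
have Vv := @mxpol_var K unit n tt.
have [l1 H1] := @pols_formula _ [seq ab <- enum {: 'I_n * 'I_n} | ~~ P ab.1 ab.2]
  _ (fun ab => pol_entry ab.1 ab.2 (mxpolM (mxpolM (mxpol_const _ Q) Vv) (mxpol_const _ Q'))).
have [l2 H2] := @pols_formula _ G _ (fun p => pol_eval p (mxpol_exp Vv)).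
exists [:: (l1 ++ l2, [::])] => L i X; rewrite sa_points_zeros; split=> [H|[HP HG] p].
  have [h1 h2] : zeros i [set` l1] X /\ zeros i [set` l2] X.
    by split=> p pl; apply: H; rewrite /= mem_cat pl ?orbT.
  split; last by move=> p pG; apply: (proj1 (H2 L i X) h2).
  by move=> a b nP; apply: (proj1 (H1 L i X) h1 (a, b)); rewrite mem_filter nP mem_enum.
rewrite /= mem_cat => /orP[]; [apply: (proj2 (H1 L i X))|exact: (proj2 (H2 L i X))].
by move=> [a b]; rewrite mem_filter => /andP[nP _]; apply: HP.
Qed.

End DefinableSets.

(** * Points of the torus over extensions, and their real powers *)

Section TorusPowers.
Variables (K : rcfType) (n : nat) (Q : 'M[K]_n) (S q : seq (mxpoly K n)).
Hypothesis QQ : Q *m Q^T = 1%:M.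
Local Notation A i := (sa_points i [:: (S, q)]).
Hypothesis HA : torus_component S (A idfun).
Hypothesis AQ : forall s, A idfun s -> exists d, Q *m s *m Q^T = diag_mx d.
Hypothesis A_unit : forall s, A idfun s -> s \in unitmx.

(** Over [K] every point of [A] is the square of an invertible diagonalized one, so its eigenvalues
    are positive; vanishing of the off-diagonal entries and positivity of the others are
    transferred. *)
Lemma torus_qdiag (L : rcfType) (i : {rmorphism K -> L}) s : A i s ->
  exists2 y, s = qdg Q i y & forall j, 0 < y 0 j.
Proof.
have Vv := @mxpol_var K unit n tt.
have dQ := mxpolM (mxpolM (mxpol_const unit Q) Vv) (mxpol_const unit Q^T).
pose P1 : relfun K unit n := fun L i V => A i (V tt) -> 
  forall ab, ab \in [seq ab <- enum {: 'I_n * 'I_n} | ab.1 != ab.2] ->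
    (map_mx i Q *m V tt *m map_mx i Q^T) ab.1 ab.2 = 0.
have D1 : definable P1.
  apply: def_impl; first exact: def_sa.
  by apply: def_allseq => ab _; apply/def_eq0/pol_entry.
have D2 : definable (fun L i V => A i (V tt) ->
    forall a, 0 < (map_mx i Q *m V tt *m map_mx i Q^T) a a).
  apply: def_impl; first exact: def_sa.
  by apply: def_all => a; apply/def_gt0/pol_entry.
have idQ : map_mx idfun Q = Q by apply/matrixP => a b; rewrite mxE.
have idQT : map_mx idfun Q^T = Q^T by apply/matrixP => a b; rewrite mxE.
have H1 V : P1 K idfun V.
  move=> /AQ[d Hd] [a b]; rewrite mem_filter => /andP[/= ab _].
  by rewrite idQ idQT Hd mxE (negbTE ab).
have H2 (V : unit -> 'M[K]_n) : A idfun (V tt) ->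
    forall a, 0 < (map_mx idfun Q *m V tt *m map_mx idfun Q^T) a a.
  move=> AV a; rewrite idQ idQT; have [_ _ Asq _ _] := HA.
  have [t At Et] := Asq _ AV; have [d Hd] := AQ At.
  have Ed : Q *m V tt *m Q^T = diag_mx (\row_j (d 0 j * d 0 j)).
    rewrite -mulmx_diag -Hd Et !mulmxA -[_ *m Q^T *m Q]mulmxA.
    by rewrite (mulmx1C QQ) mulmx1.
  rewrite Ed mxE eqxx mxE lt0r mulr1n -expr2 sqr_ge0 andbT.
  have : \det (diag_mx d) != 0.
    rewrite -Hd !det_mulmx !mulf_neq0 //.
    - by have /mulmx1_unit[] := QQ; rewrite unitmxE unitfE.
    - by have := A_unit At; rewrite unitmxE unitfE.
    - by have /mulmx1_unit[] := QQ; rewrite !unitmxE !unitfE.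
  by rewrite det_diag => /prodf_neq0/(_ a isT) da; rewrite expf_neq0.
move=> As; exists (\row_j qconj Q i s j j).
  apply: qdg_diag => // a b ab.
  have /= := transfer D1 H1 i (fun=> s) As (a, b); rewrite /qconj map_trmx; apply.
  by rewrite mem_filter ab mem_enum.
by move=> j; have := transfer D2 H2 i (fun=> s) As j; rewrite mxE /qconj map_trmx.
Qed.

Lemma torus_mul (L : rcfType) (i : {rmorphism K -> L}) s t : A i s -> A i t -> A i (s *m t).
Proof.
have V1 := @mxpol_var K bool n true; have V2 := @mxpol_var K bool n false.
have D := def_impl (def_sa [:: (S, q)] V1) (def_impl (def_sa [:: (S, q)] V2)
  (def_sa [:: (S, q)] (mxpolM V1 V2))).
have [_ AM _ _ _] := HA.
by have := transfer D (fun V => AM _ _) i (fun b => if b then s else t).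
Qed.

Lemma torus_sqr (L : rcfType) (i : {rmorphism K -> L}) s :
  zeros i [set` S] s -> A i (s *m s).
Proof.
have V1 := @mxpol_var K unit n tt.
have D := def_impl (def_zeros S V1) (def_sa [:: (S, q)] (mxpolM V1 V1)).
have [_ _ _ AV _] := HA.
by have := transfer D (fun V => AV _) i (fun=> s).
Qed.

(* The equations of [S] hold at all natural powers of [y], hence, by independence
   of the characters of [nat], at all real ones; halving [t] gives positivity. *)
Lemma torus_pow (R : realType) (iR : {rmorphism K -> R}) (y : 'rV[R]_n) :
  (forall j, 0 < y 0 j) -> A iR (qdg Q iR y) ->
  forall t : R, A iR (qdg Q iR (\row_j (y 0 j `^ t))).
Proof.
move=> y0 Ay.
have Sz t : zeros iR [set` S] (qdg Q iR (\row_j (y 0 j `^ t))).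
  move=> p pS; have [g Hg] := eval_qdg Q p; rewrite Hg.
  have Yk k : A iR (qdg Q iR (\row_j (y 0 j ^+ k))).
    elim: k => [|k IH].
      have -> : qdg Q iR (\row_j (y 0 j ^+ 0)) = map_mx iR 1%:M.
        by rewrite map_mx1 -(qdg1 QQ iR); congr (qdg _ _ _); apply/rowP => j; rewrite !mxE.
      have V1 := mxpol_const unit (1%:M : 'M[K]_n).
      have := transfer (def_sa [:: (S, q)] V1) (fun V => _) iR (fun=> 0); apply=> V.
      by have [A1 _ _ _ _] := HA; rewrite map_mx1.
    have -> : qdg Q iR (\row_j (y 0 j ^+ k.+1)) = qdg Q iR y *m qdg Q iR (\row_j (y 0 j ^+ k)).
      by rewrite (qdgM QQ iR); congr (qdg _ _ _); apply/rowP => j; rewrite !mxE exprS.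
    exact: torus_mul.
  rewrite /mmap.
  pose sq := [seq (iR (mcoeff m g), m) | m <- msupp g].
  transitivity (\sum_(w <- sq) w.1 * mmap1 (fun j => (\row_j (y 0 j `^ t)) 0 j) w.2).
    by rewrite [RHS]big_map.
  pose chi (m : multinom n) (k : nat) : R := (mmap1 (fun j => y 0 j) m) ^+ k.
  have mp (f : R -> R) (m : multinom n) : f 1 = 1 ->
      (forall a b, 0 < a -> 0 < b -> f (a * b) = f a * f b) ->
      mmap1 (fun j => (\row_j f (y 0 j)) 0 j) m = f (mmap1 (fun j => y 0 j) m).
    move=> f1 fM; rewrite /mmap1.
    suff [] : 0 < \prod_j y 0 j ^+ m j /\
       \prod_j (\row_j f (y 0 j)) 0 j ^+ m j = f (\prod_j y 0 j ^+ m j) by [].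
    elim: (index_enum _) => [|j r [IH1 IH2]]; first by rewrite !big_nil f1.
    rewrite !big_cons mulr_gt0 ?exprn_gt0 //; split=> //.
    rewrite fM ?exprn_gt0 // IH2; congr (_ * _); rewrite mxE.
    elim: (m j) => [|e IH]; first by rewrite !expr0 f1.
    by rewrite !exprS IH fM ?exprn_gt0.
  apply: (@indep_chars R nat setT addn 0%N _ _ _ chi) => //.
  - by move=> m a b; rewrite /chi exprD.
  - move=> k _; have := (Yk k); rewrite /sa_points /= => -[c]; rewrite inE => /eqP -> [/= + _].
    move=> /(_ p pS); rewrite Hg /mmap => H; rewrite -[RHS]H [LHS]big_map.
    apply: eq_bigr => m _; congr (_ * _) => /=.
    rewrite /chi (mp (fun x => x ^+ k)) ?expr1n // => a b _ _; exact: exprMn.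
  - move=> m1 m2 /(_ 1%N I); rewrite /chi !expr1 => E.
    rewrite !(mp (fun x => x `^ t)) ?E ?powR1 // => a b a0 b0; exact: powRM (ltW a0) (ltW b0).
move=> t; have := torus_sqr (Sz (t / 2)); rewrite (qdgM QQ iR) => H.
have -> : \row_j (y 0 j `^ t) = \row_j ((\row_j (y 0 j `^ (t / 2))) 0 j * (\row_j (y 0 j `^ (t / 2))) 0 j).
  apply/rowP => j; rewrite !mxE -powRD; last by rewrite (gt_eqF (y0 j)) implybT.
  by congr (_ `^ _); field.
exact: H.
Qed.

End TorusPowers.

(** * Weights and roots *)

Section DualBasis.
Variables (F : fieldType) (V : vectType F).
Local Notation dual := 'Hom(V, F^o).

(** Independent forms take prescribed values simultaneously, as the matrix of their values on a
    basis has full column rank. *)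
Lemma free_dual_point (D : seq dual) : free D ->
  exists H : V, forall d, d \in D -> d H = 1.
Proof.
move=> fD; pose k := size D; pose B := vbasis (fullv : {vspace V}).
pose M : 'M[F]_(\dim (fullv : {vspace V}), k) := \matrix_(i, j) (D`_j (B`_i) : F).
have rM : row_free M^T.
  apply: inj_row_free => v vM.
  have /freeP fD' : free (in_tuple D) by [].
  have sum0 : \sum_(j < k) v 0 j *: (in_tuple D)`_j = 0.
    apply/lfunP => x; rewrite [in RHS]lfunE /=.
    rewrite (coord_vbasis (memvf x)) linear_sum /= big1 // => i _.
    rewrite linearZ /= sum_lfunE.
    have /rowP/(_ i) := vM; rewrite !mxE => E.
    rewrite (_ : \sum_j _ = 0) ?scaler0 // -[RHS]E.
    by apply: eq_bigr => j _; rewrite !mxE scale_lfunE.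
  by apply/rowP => j; rewrite mxE (fD' (fun j => v 0 j) sum0).
have : row_full M by rewrite /row_full -mxrank_tr.
move=> /(submx_full (const_mx 1 : 'rV_k))/submxP[w Ew].
exists (\sum_i w 0 i *: B`_i) => d dD; pose j := Ordinal (let H := dD in
  eq_ind _ is_true H _ (esym (index_mem d D))).
have -> : d = D`_j by rewrite nth_index.
have /rowP/(_ j) := Ew; rewrite !mxE => ->.
by rewrite linear_sum /=; apply: eq_bigr => i _; rewrite linearZ /= !mxE.
Qed.

End DualBasis.

Section LieTorus.
Variables (K : rcfType) (R : realType) (iR : {rmorphism K -> R}).
Variables (n : nat) (Q : 'M[K]_n) (S q : seq (mxpoly K n)).
Hypothesis QQ : Q *m Q^T = 1%:M.
Local Notation A := (sa_points iR [:: (S, q)]).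
Hypothesis HA : torus_component S (sa_points idfun [:: (S, q)]).
Hypothesis AQ : forall s, sa_points idfun [:: (S, q)] s ->
  exists d, Q *m s *m Q^T = diag_mx d.
Hypothesis A_unit : forall s, sa_points idfun [:: (S, q)] s -> s \in unitmx.
Variable a : {vspace 'M[R]_n}.
Hypothesis a_lie : [set` a] = lie_algebra A.
Local Notation qd := (qdg Q iR).
Local Notation qc := (qconj Q iR).
Local Notation dual := 'Hom(subvs_of a, R^o).

(** Real powers of a point of [A] stay in [A], which gives one direction. For the other,
    off-diagonal coordinates are linear forms vanishing along the one-parameter group, hence on its
    generator. *)
Lemma lie_torusP X : X \in a <-> exists2 x, X = qd x & A (qd (map_mx expR x)).
Proof.
have expd (t : R) x : expmx (t *: qd x) = qd (\row_j (expR (x 0 j) `^ t)).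
  have -> : t *: qd x = qd (t *: x).
    by rewrite /qdg linearZ /= -scalemxAr -scalemxAl.
  rewrite /qdg expmx_qdiag ?map_orth //; congr (_ *m diag_mx _ *m _).
  by apply/rowP => j; rewrite !mxE mulrC expRM.
have inA : X \in a <-> lie_algebra A X by rewrite -a_lie.
split=> [/inA LX|[x Ex Ax]]; last first.
  apply/inA => t; rewrite Ex expd.
  have -> : \row_j (expR (x 0 j) `^ t) = \row_j ((map_mx expR x) 0 j `^ t).
    by apply/rowP => j; rewrite !mxE.
  by apply: (torus_pow QQ HA) => // j; rewrite mxE expR_gt0.
have dX : X = qd (\row_j qc X j j).
  apply: qdg_diag => // i j ij.
  (* The trace against [c] is the coordinate [(i, j)] in the basis given by [Q]. *)
  pose c : 'M[R]_n := (map_mx iR Q)^T *m delta_mx j i *m map_mx iR Q.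
  have trc M : \tr (c *m M) = qc M i j.
    rewrite /c -!mulmxA mxtrace_mulC -!mulmxA [map_mx iR Q *m _]mulmxA -/(qc M).
    have -> : delta_mx j i *m qc M = \matrix_(k, l) (if k == j then qc M i l else 0).
      apply/matrixP => k l; rewrite [LHS]mxE [RHS]mxE (bigD1 i) //= mxE eqxx andbT big1 ?addr0.
        by case: eqP; rewrite ?mul1r ?mul0r.
      by move=> m /negbTE mi; rewrite mxE mi andbF mul0r.
    rewrite /mxtrace (bigD1 j) //= mxE eqxx big1 ?addr0 // => k /negbTE kj.
    by rewrite mxE kj.
  rewrite -trc; apply: expmx_linear_part.
    by rewrite -[c]mulmx1 trc qconj1 // mxE (negbTE ij).
  move=> t; rewrite trc; have [y -> _] := torus_qdiag QQ HA AQ A_unit (LX t).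
  by rewrite qconj_qdg // mxE (negbTE ij).
exists (\row_j qc X j j) => //; have := LX 1; rewrite {1}dX expd.
have -> // : \row_j expR ((\row_j qc X j j) 0 j) `^ 1 = map_mx expR (\row_j qc X j j).
by apply/rowP => j; rewrite !mxE powRr1 // expR_ge0.
Qed.

(** The weights of [a] on the standard representation. *)
Definition wt_fun j (H : subvs_of a) : R^o := qc (vsval H) j j.

Lemma wt_linear j : linear (wt_fun j).
Proof.
move=> c x y; rewrite /wt_fun /qconj.
have -> : vsval (c *: x + y) = c *: vsval x + vsval y by rewrite linearP.
by rewrite mulmxDr mulmxDl -scalemxAr -scalemxAl [LHS]mxE [X in X + _]mxE.
Qed.

HB.instance Definition _ j :=
  GRing.isLinear.Build R (subvs_of a) R^o *:%R (wt_fun j) (wt_linear j).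

Definition wt j : dual := linfun (wt_fun j).

Lemma wtE j H : wt j H = qc (vsval H) j j.
Proof. by rewrite lfunE. Qed.

Lemma vsval_qd (H : subvs_of a) : vsval H = qd (\row_j wt j H).
Proof.
have /lie_torusP[x Hx _] := subvsP H; rewrite {1}Hx; congr (qdg _ _ _).
by apply/rowP => j; rewrite mxE wtE Hx qconj_qdg // mxE eqxx.
Qed.

(** In the coordinates of [Q] the bracket with [H] multiplies the entry [(i, j)] by the difference
    of the weights [i] and [j], so a weight condition is a condition on the support. *)
Lemma weight_spaceP (alpha : dual) (X : 'M[R]_n) :
  (forall H : subvs_of a, vsval H *m X - X *m vsval H = (alpha H : R) *: X) <->
  (forall i j, qc X i j != 0 -> wt i - wt j = alpha).
Proof.
have E (H : subvs_of a) i j : qc (vsval H *m X - X *m vsval H) i j =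
    (wt i H - wt j H) * qc X i j.
  rewrite qconjB !qconjM // vsval_qd qconj_qdg // mul_diag_mx mul_mx_diag !mxE.
  by rewrite mulrBl; congr (_ - _); rewrite mulrC.
split=> [HX i j ij|HX H].
  apply/lfunP => H; apply: (mulIf ij); rewrite add_lfunE opp_lfunE.
  by rewrite -[LHS](E H i j) HX qconjZ mxE.
apply: (can_inj (qconjK QQ iR)); apply/matrixP => i j; rewrite E qconjZ [RHS]mxE.
have [->|ij] := eqVneq (qc X i j) 0; first by rewrite !mulr0.
by rewrite -(HX i j ij) add_lfunE opp_lfunE.
Qed.

Variables (g : set 'M[R]_n) (Delta : seq dual).
Hypothesis Delta_basis : root_basis g Delta.

(** Where all simple roots equal one, a root takes the sum of its coefficients as value, and these
    all have one sign. *)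
Lemma regular_element : exists H : subvs_of a, forall alpha, is_root g alpha ->
  (alpha H : R) != 0 /\ (positive_root g Delta alpha <-> 0 < (alpha H : R)).
Proof.
have [/andP[_ fD] _ Hpm] := Delta_basis.
have [H HD] := free_dual_point fD; exists H => alpha ra.
have muln (beta : dual) k : (beta *+ k) H = beta H *+ k.
  by elim: k => [|k IH]; rewrite ?mulr0n ?lfunE // !mulrS add_lfunE IH.
have pos beta : beta != 0 -> nonneg_comb Delta beta -> 0 < (beta H : R).
  move=> b0 [c Ec]; have E : beta H = \sum_(i < size Delta) (c i)%:R :> R.
    rewrite {1}Ec sum_lfunE; apply: eq_bigr => i _.
    by rewrite muln HD ?mem_nth.
  rewrite E lt0r sumr_ge0 ?andbT; last by move=> i _; apply: ler0n.
  apply: contraNneq b0 => s0; rewrite Ec big1 // => i _.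
  have : (c i)%:R == 0 :> R.
    have := psumr_eq0P (F := fun i : 'I_(size Delta) => (c i)%:R : R).
    by move=> /(_ predT) -> // j _; apply: ler0n.
  by rewrite pnatr_eq0 => /eqP ->; rewrite mulr0n.
have a0 := ra.1.
case: (Hpm alpha ra) => [pa|na].
  have ha := pos _ a0 pa; split; first by rewrite gt_eqF.
  by split=> // _; split.
have ha : (alpha H : R) < 0.
  by have := pos _ _ na; rewrite oppr_eq0 opp_lfunE oppr_gt0; apply.
split; first by rewrite lt_eqF.
split=> [[_ pa]|h2]; first exact: pos.
by have := lt_trans ha h2; rewrite ltxx.
Qed.

End LieTorus.

(** * The real group *)

(** The condition on [w'] says that it is a function of [w]: an operator commuting with the first
    matrix preserves its eigenspaces, on which the second is scalar. *)
Lemma fun_comm (F : fieldType) n (O B : 'M[F]_n) (w w' : 'rV[F]_n) : O *m O^T = 1%:M ->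
  (forall i j, w 0 i = w 0 j -> w' 0 i = w' 0 j) ->
  B *m (O^T *m diag_mx w *m O) = (O^T *m diag_mx w *m O) *m B ->
  B *m (O^T *m diag_mx w' *m O) = (O^T *m diag_mx w' *m O) *m B.
Proof.
move=> OO ww; have OO' : O^T *m O = 1%:M by apply: mulmx1C.
have [B' EB] : exists B', B' = O *m B *m O^T by eexists.
have {EB} -> : B = O^T *m B' *m O.
  by rewrite EB !mulmxA OO' mul1mx -mulmxA OO' mulmx1.
have conj (x : 'rV[F]_n) : ((O^T *m B' *m O) *m (O^T *m diag_mx x *m O) =
    (O^T *m diag_mx x *m O) *m (O^T *m B' *m O)) <->
    (B' *m diag_mx x = diag_mx x *m B').
  have mid (M N : 'M[F]_n) : O^T *m M *m O *m (O^T *m N *m O) = O^T *m (M *m N) *m O.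
    by rewrite !mulmxA -[_ *m O *m O^T]mulmxA OO mulmx1.
  rewrite !mid; split=> [E|->//].
  have := congr1 (fun M => O *m M *m O^T) E.
  by rewrite !mulmxA OO !mul1mx -!mulmxA OO !mulmx1.
move=> /conj E; apply/conj/matrixP => i j; have /matrixP/(_ i j) := E.
rewrite !mul_mx_diag !mul_diag_mx ![_ i j]mxE !mxE => Eij.
have [->|b0] := eqVneq (B' i j) 0; first by rewrite mul0r mulr0.
rewrite (ww i j) 1?mulrC //.
by apply: (mulIf b0); rewrite -Eij mulrC.
Qed.

Section RealGroup.
Variables (K : rcfType) (R : realType) (iR : {rmorphism K -> R}).
Variables (n : nat) (Q : 'M[K]_n) (S q G : seq (mxpoly K n)).
Hypothesis QQ : Q *m Q^T = 1%:M.
Local Notation A := (sa_points iR [:: (S, q)]).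
Hypothesis HA : torus_component S (sa_points idfun [:: (S, q)]).
Hypothesis AQ : forall s, sa_points idfun [:: (S, q)] s ->
  exists d, Q *m s *m Q^T = diag_mx d.
Hypothesis A_unit : forall s, sa_points idfun [:: (S, q)] s -> s \in unitmx.
Variable a : {vspace 'M[R]_n}.
Hypothesis a_lie : [set` a] = lie_algebra A.
Local Notation ZG := (zeros iR [set` G]).
Hypotheses (G1 : ZG 1%:M) (GM : forall x y, ZG x -> ZG y -> ZG (x *m y))
  (GT : forall x, ZG x -> ZG x^T) (GV : forall x y, x *m y = 1%:M -> ZG x -> ZG y)
  (AG : forall s, A s -> ZG s).
Local Notation g := (lie_algebra ZG).
Variable Delta : seq 'Hom(subvs_of a, R^o).
Hypothesis Delta_basis : root_basis g Delta.
Variable H0 : subvs_of a.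
Hypothesis H0_regular : forall alpha, is_root g alpha ->
  (alpha H0 : R) != 0 /\ (positive_root g Delta alpha <-> 0 < (alpha H0 : R)).
Local Notation wt := (@wt K R iR n Q a).
Local Notation h := (fun j : 'I_n => (wt j H0 : R)).
Local Notation qd := (qdg Q iR).
Local Notation qc := (qconj Q iR).
Local Notation qcV := (qconjV Q iR).
Local Notation Gh := (fun y => ZG (qcV y)).

Lemma G_stab : exists d (E : 'M[R]_(tdim (unit + 'I_n * 'I_n)%type d)),
  forall y, ZG (qcV y) <-> stablemx E (rho d y).
Proof.
have [d [E HE]] := zeros_stabilizer G1 GM.
have rr : rho d (map_mx iR Q) *m rho d (map_mx iR Q)^T = 1%:M.
  by rewrite -rhoM map_orth // rho1.
have rr' : rho d (map_mx iR Q)^T *m rho d (map_mx iR Q) = 1%:M by apply: mulmx1C.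
exists d, (E *m rho d (map_mx iR Q)^T) => y.
apply: iff_trans (HE _) _; rewrite /qconjV !rhoM.
split=> [/(submxMr (rho d (map_mx iR Q)^T))|/(submxMr (rho d (map_mx iR Q)))].
  by rewrite -!mulmxA rr mulmx1.
by rewrite -!mulmxA rr' mulmx1 !mulmxA.
Qed.

Lemma exp_torus_G (H : subvs_of a) : ZG (qd (\row_j expR (wt j H))).
Proof.
have /(lie_torusP QQ HA AQ A_unit a_lie)[x Ex Ax] := subvsP H; apply: AG.
rewrite (_ : \row_j _ = map_mx expR x) //; apply/rowP => j; rewrite !mxE.
by rewrite wtE Ex qconj_qdg // mxE eqxx.
Qed.

Lemma cell_mem y u l : Gh y -> unip h u -> blockd h l -> l \in unitmx ->
  y *m y^T = u *m l *m u^T -> Gh u /\ Gh l.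
Proof.
move=> Gy uu bl ul E; have [d [EE HE]] := G_stab.
have Gyy : Gh (y *m y^T) by rewrite /= qconjVM // qconjVT; apply: GM => //; exact: GT.
have [u1 u2] := unipP uu; have [unu _] := unip_inv uu.
have Gu : Gh u.
  apply/HE.
  (* Off its diagonal [u] lowers the weights, and [l *m u^T] never does; the grading is given by the
     exponential of [H0], a point of the group. *)
  apply: (@rho_bigcell R n d (\row_j expR (h j)) _ EE u (l *m u^T)) => //.
  - by move=> j; rewrite mxE expR_gt0.
  - by apply/HE; rewrite -qdgE; apply: exp_torus_G.
  - by rewrite unitmx_mul ul unitmx_tr.
  - by move=> i j /u1[->|hij]; [left|right; rewrite !mxE ltr_expR].
  - move=> i j /mulmx_entry_neq0[k /bl hik]; rewrite mxE => /u1[->|hkj];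
      by rewrite !mxE ler_expR hik // ltW.
  - by apply/HE; rewrite mulmxA -E.
split=> //.
have ex v : v \in unitmx -> Gh v -> Gh (invmx v).
  by move=> uv Gv /=; apply: GV Gv; rewrite -qconjVM // mulmxV // qconjV1.
have -> : l = invmx u *m (y *m y^T) *m invmx u^T.
  by rewrite E !mulmxA mulVmx // mul1mx mulmxK // unitmx_tr.
rewrite /= !qconjVM //; apply: (GM); last by apply: ex; rewrite ?unitmx_tr //= qconjVT; apply: GT.
by apply: (GM); [apply: ex|rewrite -qconjVM].
Qed.

Local Notation mask alpha X :=
  (\matrix_(i, j) (if wt i - wt j == alpha then X i j else 0)).

Section Stabilizer.
Variables (d : nat) (E : 'M[R]_(tdim (unit + 'I_n * 'I_n)%type d)).
Hypothesis HE : forall y, ZG (qcV y) <-> stablemx E (rho d y).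

Lemma mask_stable (X : 'M[R]_n) i0 j0 : stablemx E (drho d X) ->
  stablemx E (drho d (mask (wt i0 - wt j0) X)).
Proof.
move=> sX; pose Z : set 'rV[R]_n := [set z | exists H : subvs_of a, z = \row_j expR (wt j H)].
have := @drho_weight _ _ _ E Z X i0 j0 _ _ sX.
have -> : (\matrix_(i, j) (if `[< forall z : 'rV_n, Z z -> z 0 j / z 0 i = z 0 j0 / z 0 i0 >]
   then X i j else 0)) = mask (wt i0 - wt j0) X.
  apply/matrixP => i j; rewrite !mxE; congr (if _ then _ else _).
  apply/asboolP/eqP => [HZ|eqw z [H ->]].
    apply/lfunP => H; have := HZ _ (ex_intro _ H erefl).
    rewrite !mxE -!expRB => /expR_inj EH; rewrite !add_lfunE !opp_lfunE.
    by rewrite -[LHS]opprB EH opprB.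
  rewrite !mxE -!expRB; congr expR; have := congr1 (fun f : 'Hom(_, _) => (f H : R)) eqw.
  by rewrite !add_lfunE !opp_lfunE => EH; rewrite -[LHS]opprB EH opprB.
apply; first by move=> z j [H ->]; rewrite mxE gt_eqF // expR_gt0.
by move=> z [H ->]; apply/HE; rewrite -qdgE; apply: exp_torus_G.
Qed.

(** Some [H] makes [alpha H] positive, and then [X] is strictly triangular for the order given by
    [H]. *)
Lemma weight_nilp (alpha : 'Hom(subvs_of a, R^o)) (X : 'M[R]_n) : alpha != 0 ->
  (forall i j, X i j != 0 -> wt i - wt j = alpha) -> X ^+ n = 0.
Proof.
move=> a0 HX; have [H aH] : exists H : subvs_of a, 0 < (alpha H : R).
  have [H aH] : exists H : subvs_of a, (alpha H : R) != 0.
    apply: contrapT => no; case/eqP: a0; apply/lfunP => H; rewrite [RHS]lfunE /=.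
    by apply/eqP; apply: contraT => aH; case: no; exists H.
  have [|le] := ltP 0 (alpha H : R); first by exists H.
  by exists (- H); rewrite linearN oppr_gt0 lt_neqAle aH.
apply: (@sup_nilpotent _ n (fun j : 'I_n => (wt j H : R))) => i j /HX Ea.
by rewrite -subr_gt0 -[wt j H]/(_ H) -opp_lfunE -add_lfunE Ea.
Qed.

(** Infinitesimal stability integrates to the one-parameter group, its value at time one lies in the
    group, and polynomial dependence on the time leads back. For these [X] the real Lie algebra thus
    becomes an algebraic condition. *)
Lemma root_spaceP (alpha : 'Hom(subvs_of a, R^o)) (X : 'M[R]_n) : alpha != 0 ->
  (forall i j, X i j != 0 -> wt i - wt j = alpha) ->
  (stablemx E (drho d X) <-> root_space g alpha (qcV X)) /\
  (stablemx E (drho d X) <-> ZG (exp_nilp (qcV X))).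
Proof.
move=> a0 HX; have nX := weight_nilp a0 HX.
have nXt (t : R) : (t *: X) ^+ n = 0 by rewrite expmxZ nX scaler0.
have expE t : expmx (t *: qcV X) = qcV (exp_nilp (t *: X)).
  have -> : t *: qcV X = qcV (t *: X) by rewrite /qconjV -scalemxAr -scalemxAl.
  by rewrite expmx_nilp ?qconjV_exp // qconjVX // nXt qconjV0.
have P12 : stablemx E (drho d X) -> root_space g alpha (qcV X).
  move=> sX; split; last by apply/(weight_spaceP QQ HA AQ A_unit a_lie) => i j; rewrite qconjVK //; apply: HX.
  by move=> t; rewrite expE; apply/HE/drho_exp.
have P23 : root_space g alpha (qcV X) -> ZG (exp_nilp (qcV X)).
  by move=> [/(_ 1)]; rewrite expE scale1r qconjV_exp.
have P31 : ZG (exp_nilp (qcV X)) -> stablemx E (drho d X).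
  by rewrite qconjV_exp // => /HE; apply: exp_drho.
by split; split; auto.
Qed.

Lemma weight_root (X : 'M[R]_n) i0 j0 : stablemx E (drho d X) -> X i0 j0 != 0 ->
  wt i0 != wt j0 :> 'Hom(subvs_of a, R^o) -> is_root g (wt i0 - wt j0).
Proof.
move=> sX x0 ne; have a0 : wt i0 - wt j0 != 0 :> 'Hom(subvs_of a, R^o) by rewrite subr_eq0.
split=> //; pose X' := mask (wt i0 - wt j0) X; exists (qcV X').
  apply: contraNneq x0 => /(congr1 qc); rewrite qconjVK // => /matrixP/(_ i0 j0).
  by rewrite mxE eqxx => ->; rewrite /qconj mulmx0 mul0mx mxE.
apply: (proj1 (root_spaceP a0 _).1); last exact: mask_stable.
by move=> i j; rewrite mxE; case: ifP => [/eqP //|_]; rewrite eqxx.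
Qed.

End Stabilizer.

(** With [X] the logarithm of [c], [drho d X] is a function of the diagonalizable [rho d (c *m c)],
    so it stabilizes [E]. A nonzero weight occurring in [X] would be a root; as [X] is block
    diagonal, this root would vanish at [H0]. So [X] has weight zero and commutes with [a]. *)
Lemma centralizes (c O : 'M[R]_n) (w : 'rV[R]_n) : O *m O^T = 1%:M -> c = O^T *m diag_mx w *m O ->
  (forall j, 0 < w 0 j) -> blockd h c -> Gh (c *m c) ->
  forall s, A s -> c *m qc s = qc s *m c.
Proof.
move=> OO Ec w0 bc Gcc; have OO' : O^T *m O = 1%:M by apply: mulmx1C.
have [d [E HE]] := G_stab.
pose lw : 'rV[R]_n := \row_j ln (w 0 j).
have [X EX] : exists X : 'M[R]_n, X = O^T *m diag_mx lw *m O by eexists.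
have roO : rho d O^T *m rho d O = 1%:M by rewrite -rhoM OO' rho1.
have [uO vO] := mulmx1_unit roO.
have iO : rho d O = invmx (rho d O^T).
  by apply: (can_inj (mulKmx uO)); rewrite mulmxV.
have sX : stablemx E (drho d X).
  have drX : drho d X = rho d O^T *m drho d (diag_mx lw) *m invmx (rho d O^T).
    rewrite (@drho_conj _ _ _ _ _ X) -?mulmxA ?mulmxV ?mulmx1 //.
    by rewrite EX -!mulmxA OO mulmx1.
  rewrite drX drho_diag.
  (* The logarithm is halved because [c *m c], and not [c], is known to lie in the group. *)
  have -> : \row_s \sum_k kval0 lw (tix s k) =
     map_mx (fun x => ln x / 2) (\row_s \prod_k kval (\row_j (w 0 j * w 0 j)) (tix s k)) :> 'rV[R]_(tdim _ d).
    apply/rowP => s; rewrite !mxE.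
    suff [_ ->] : 0 < \prod_k kval (\row_j (w 0 j * w 0 j)) (tix s k) /\
       ln (\prod_k kval (\row_j (w 0 j * w 0 j)) (tix s k)) = (\sum_k kval0 lw (tix s k)) *+ 2.
      by rewrite -[X in _ = X / _]mulr_natr mulfK // pnatr_eq0.
    elim: (index_enum _) => [|k r [IH1 IH2]]; first by rewrite !big_nil ltr01 ln1 mul0rn.
    have kv : 0 < kval (\row_j (w 0 j * w 0 j)) (tix s k) /\
        ln (kval (\row_j (w 0 j * w 0 j)) (tix s k)) = kval0 lw (tix s k) *+ 2.
      case: (tix s k) => [_|[_ j]] /=; first by rewrite ltr01 ln1 mul0rn.
      by rewrite !mxE mulr_gt0 // lnM ?posrE // mulr2n.
    rewrite !big_cons mulr_gt0 ?kv.1 //; split=> //.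
    by rewrite lnM ?posrE ?kv.1 // kv.2 IH2 mulrnDl.
  apply: stablemx_fun => //; rewrite -rho_diag -iO -!rhoM; apply/HE.
  have -> // : O^T *m diag_mx (\row_j (w 0 j * w 0 j)) *m O = c *m c.
  by rewrite -mulmx_diag Ec !mulmxA -[_ *m O *m O^T]mulmxA OO mulmx1.
have comX B : B *m c = c *m B -> B *m X = X *m B.
  rewrite Ec EX; apply: fun_comm => // i j Ew; by rewrite !mxE Ew.
have bX := blockd_comm bc comX.
have X0 i j : X i j != 0 -> wt i = wt j :> 'Hom(subvs_of a, R^o).
  move=> xij; apply/eqP; apply: contraT => ne.
  have [] := H0_regular (weight_root HE sX xij ne).
  by rewrite add_lfunE opp_lfunE (bX i j xij) subrr eqxx.
move=> s As; have [y Es y0] := torus_qdiag QQ HA AQ A_unit As.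
rewrite Es qconj_qdg //.
(* The logarithm of [s] lies in [a], so the equality of weights on the support of [X] can be
   evaluated at it. *)
have ya : qd (\row_j ln (y 0 j)) \in a.
  apply/(lie_torusP QQ HA AQ A_unit a_lie); exists (\row_j ln (y 0 j)) => //.
  have -> // : map_mx expR (\row_j ln (y 0 j)) = y; last by rewrite -Es.
  by apply/rowP => j; rewrite !mxE lnK // posrE.
have Xd : diag_mx y *m X = X *m diag_mx y.
  apply/matrixP => i j; rewrite mul_diag_mx mul_mx_diag !mxE.
  have [->|xij] := eqVneq (X i j) 0; first by rewrite mulr0 mul0r.
  have := congr1 (fun f : 'Hom(_, _) => (f (Subvs ya) : R)) (X0 i j xij).
  rewrite !wtE /= !qconj_qdg // !mxE !eqxx !mulr1n => Ey.
  rewrite mulrC; congr (_ * _); apply: ln_inj; rewrite ?posrE //; exact: Ey.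
rewrite Ec; apply/esym; move: Xd; rewrite EX; apply: fun_comm => // i j.
by rewrite !mxE => /ln_inj; apply; rewrite posrE.
Qed.

(** Replaces the real exponential in the definition of a root space by polynomial conditions, which
    make sense over every extension of [K]. *)
Lemma root_space_exp (alpha : 'Hom(subvs_of a, R^o)) Y : alpha != 0 ->
  root_space g alpha Y <->
  (forall i j, ~~ (wt i - wt j == alpha) -> qc Y i j = 0) /\ ZG (exp_nilp Y).
Proof.
move=> a0; have [d [E HE]] := G_stab.
have [Z ->] : exists Z, Y = qcV Z by exists (qc Y); rewrite qconjK.
rewrite (qconjVK QQ iR); split=> [rY|[HZ GY]]; last first.
  have HY i j : Z i j != 0 -> wt i - wt j = alpha.
    by move=> z0; apply/eqP; apply: contraNT z0 => ne; rewrite HZ.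
  by have [P1 P2] := root_spaceP HE a0 HY; apply/P1/P2.
have HY i j : Z i j != 0 -> wt i - wt j = alpha.
  by have [_ /(weight_spaceP QQ HA AQ A_unit a_lie)] := rY; rewrite (qconjVK QQ iR); apply.
split; last by have [P1 P2] := root_spaceP HE a0 HY; apply/P2/P1.
by move=> i j ne; apply/eqP; apply: contraNT ne => z0; apply/eqP/HY.
Qed.

(** The logarithm [N] is an infinitesimal stabilizer, and so are its weight components; on its
    support [h] decreases, so the roots that occur are positive. *)
Lemma unip_components (N : 'M[R]_n) i0 j0 : sup h N -> ZG (exp_nilp (qcV N)) ->
  ZG (exp_nilp (qcV (mask (wt i0 - wt j0) N))) /\
  (N i0 j0 != 0 -> positive_root g Delta (wt i0 - wt j0)).
Proof.
move=> sN GN; have [d [E HE]] := G_stab.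
have sdN : stablemx E (drho d N).
  by apply: exp_drho; [apply: sup_nilpotent sN|apply/HE; rewrite -qconjV_exp].
split; last first.
  move=> n0; have hij := sN _ _ n0.
  have ne : wt i0 != wt j0 :> 'Hom(subvs_of a, R^o).
    by apply: contraTneq hij => ->; rewrite ltxx.
  have [_ [_]] := H0_regular (weight_root HE sdN n0 ne); apply.
  by rewrite add_lfunE opp_lfunE subr_gt0.
have sM : sup h (mask (wt i0 - wt j0) N).
  by move=> i j; rewrite mxE; case: ifP => _; [apply: sN|rewrite eqxx].
rewrite qconjV_exp //; apply/HE; rewrite -[X in exp_nilp X]scale1r.
by apply: drho_exp; [apply: sup_nilpotent sM|apply: mask_stable].
Qed.

(** Infinitesimal stabilizers add up, and positivity of the roots makes the sum strictly triangular.
    The index type is finite so that the statement can be transferred. *)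
Lemma root_sum_G (I : finType) (r : I -> 'Hom(subvs_of a, R^o)) (V : I -> 'M[R]_n) :
  (forall k, positive_root g Delta (r k)) -> (forall k, root_space g (r k) (V k)) ->
  ZG (exp_nilp (\sum_k V k)) /\ sup h (qc (\sum_k V k)).
Proof.
move=> pr rV; have [d [E HE]] := G_stab.
have HX k i j : qc (V k) i j != 0 -> wt i - wt j = r k.
  by have [_ /(weight_spaceP QQ HA AQ A_unit a_lie)] := rV k; apply.
have qS : qc (\sum_k V k) = \sum_k qc (V k) by rewrite /qconj mulmx_sumr mulmx_suml.
have sS : sup h (qc (\sum_k V k)).
  rewrite qS; apply: sup_sum => k i j /HX Er.
  have [_ [+ _]] := H0_regular (pr k).1; move=> /(_ (pr k)).
  by rewrite -Er add_lfunE opp_lfunE subr_gt0.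
split=> //; rewrite -[\sum_k V k](qconjK QQ iR) qconjV_exp //; apply/HE.
rewrite -[X in exp_nilp X]scale1r; apply: drho_exp; first exact: sup_nilpotent sS.
rewrite qS drho_sum; rewrite mulmx_sumr; apply: summx_sub => k _.
apply: (proj2 (root_spaceP HE (pr k).1.1 (@HX k)).1).
by rewrite qconjK.
Qed.

End RealGroup.

(** * Descent and transfer *)

Section MoreDefinable.
Variables (K : rcfType) (I : finType) (n : nat).

Lemma def_iff (P P' : relfun K I n) : (forall L i V, P L i V <-> P' L i V) ->
  definable P -> definable P'.
Proof.
by move=> E [s Hs]; exists s => L i V V' /Hs H; rewrite -E H E.
Qed.

Lemma def_entries (P : rel 'I_n) (f : mxpolyfun K I n) : is_mxpol f ->
  definable (fun L i V => forall a b, f L i V a b != 0 -> P a b).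
Proof.
move=> Hf; pose l := [seq ab <- enum {: 'I_n * 'I_n} | ~~ P ab.1 ab.2].
apply: (@def_iff (fun L i V => forall ab, ab \in l -> f L i V ab.1 ab.2 = 0)); last first.
  by apply: def_allseq => ab _; apply/def_eq0/pol_entry.
move=> L i V; split=> H a; last by case: a => a b; rewrite mem_filter => /andP[/= nP _];
  apply/eqP; apply: contraNT nP => /H.
move=> b; apply: contra_neqT => nP; apply: (H (a, b)).
by rewrite mem_filter nP mem_enum.
Qed.

Lemma mxpol_qconj (Q : 'M[K]_n) (f : mxpolyfun K I n) : is_mxpol f ->
  is_mxpol (fun L i V => qconj Q i (f L i V)).
Proof.
move=> Hf; have [B HB] := mxpolM (mxpolM (mxpol_const I Q) Hf) (mxpol_const I Q^T).
by exists B => L i V; rewrite -HB /qconj map_trmx.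
Qed.

Lemma mxpol_qconjV (Q : 'M[K]_n) (f : mxpolyfun K I n) : is_mxpol f ->
  is_mxpol (fun L i V => qconjV Q i (f L i V)).
Proof.
move=> Hf; have [B HB] := mxpolM (mxpolM (mxpol_const I Q^T) Hf) (mxpol_const I Q).
by exists B => L i V; rewrite -HB /qconjV map_trmx.
Qed.

End MoreDefinable.

Lemma map_mx_idfun (K : fieldType) m n (M : 'M[K]_(m, n)) : map_mx idfun M = M.
Proof. by apply/matrixP => a b; rewrite mxE. Qed.

Lemma qconjV_map (K L : fieldType) n (Q : 'M[K]_n) (i : {rmorphism K -> L}) (s : 'M[K]_n) :
  map_mx i (qconjV Q idfun s) = qconjV Q i (map_mx i s).
Proof. by rewrite /qconjV map_mx_idfun !map_mxM map_trmx. Qed.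

Lemma qconj_map (K L : fieldType) n (Q : 'M[K]_n) (i : {rmorphism K -> L}) (s : 'M[K]_n) :
  map_mx i (qconj Q idfun s) = qconj Q i (map_mx i s).
Proof. by rewrite /qconj map_mx_idfun !map_mxM map_trmx. Qed.

Section GroupTransfer.
Variables (K : rcfType) (n : nat) (G : seq (mxpoly K n)).
Hypotheses (G_group : is_subgroup (geom [set` G]))
  (G_SL : forall g, geom [set` G] g -> \det g = 1)
  (G_selfadjoint : forall g, geom [set` G] g -> geom [set` G] g^T).
Variables (L : rcfType) (i : {rmorphism K -> L}).
Local Notation ZG := (zeros i [set` G]).

Lemma zeros_map (P : seq (mxpoly K n)) s : zeros i [set` P] (map_mx i s) <-> zeros idfun [set` P] s.
Proof. exact: definable_map i (fun=> s) (def_zeros P (@mxpol_var K unit n tt)). Qed.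

Lemma sa_map (d : sa_formula K n) s : sa_points i d (map_mx i s) <-> sa_points idfun d s.
Proof. exact: definable_map i (fun=> s) (def_sa d (@mxpol_var K unit n tt)). Qed.

Lemma group_one : ZG 1%:M.
Proof.
rewrite -(map_mx1 i); apply/zeros_map/geom_real; rewrite map_mx1.
by have [] := G_group.
Qed.

Lemma group_mul x y : ZG x -> ZG y -> ZG (x *m y).
Proof.
have V1 := @mxpol_var K bool n true; have V2 := @mxpol_var K bool n false.
have D := def_impl (def_zeros G V1) (def_impl (def_zeros G V2) (def_zeros G (mxpolM V1 V2))).
have := transfer D _ i (fun b => if b then x else y); apply=> V.
move=> /geom_real Gx /geom_real Gy; apply/geom_real; rewrite map_mxM.
by have [_ _ GM _] := G_group; apply: GM.
Qed.

Lemma group_tr x : ZG x -> ZG x^T.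
Proof.
have V1 := @mxpol_var K unit n tt.
have D := def_impl (def_zeros G V1) (def_zeros G (mxpolT V1)).
have := transfer D _ i (fun=> x); apply=> V.
by move=> /geom_real Gx; apply/geom_real; rewrite -map_trmx; apply: G_selfadjoint.
Qed.

(** The inverse is given by its equation, which is definable. *)
Lemma group_inv x y : x *m y = 1%:M -> ZG x -> ZG y.
Proof.
have V1 := @mxpol_var K bool n true; have V2 := @mxpol_var K bool n false.
have D := def_impl (def_mxeq (mxpolM V1 V2) (mxpol_const bool 1%:M))
  (def_impl (def_zeros G V1) (def_zeros G V2)).
move=> xy; have := transfer D _ i (fun b => if b then x else y); apply; last by rewrite map_mx1.
move=> V; rewrite map_mx1 => E /geom_real Gx; apply/geom_real.
have E' : map_mx (real_complex K) (V true) *m map_mx (real_complex K) (V false) = 1%:M.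
  by rewrite -map_mxM E map_mx1.
have [ux _] := mulmx1_unit E'.
have -> : map_mx (real_complex K) (V false) = invmx (map_mx (real_complex K) (V true)).
  by apply: (can_inj (mulKmx ux)); rewrite mulmxV.
by have [_ _ _ GV] := G_group; apply: GV.
Qed.

Lemma group_det x : ZG x -> \det x = 1.
Proof.
have V1 := @mxpol_var K unit n tt.
have D := def_impl (def_zeros G V1) (def_eq0 (polB (pol_det V1) (pol_const _ _ 1))).
move=> Gx; apply/eqP; rewrite -subr_eq0; apply/eqP.
rewrite -[X in _ - X](rmorph1 i).
have := transfer D _ i (fun=> x); apply=> // V.
move=> /geom_real/G_SL; rewrite det_map_mx => E; apply/eqP; rewrite subr_eq0; apply/eqP.
by apply: (fmorph_inj (real_complex K)); rewrite E !rmorph1.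
Qed.

Lemma group_unit x : ZG x -> x \in unitmx.
Proof. by move=> /group_det E; rewrite unitmxE E unitr1. Qed.

End GroupTransfer.

Lemma orth_diag_gt0 (L : rcfType) n (Q N : 'M[L]_n) (d : 'rV[L]_n) : Q *m Q^T = 1%:M ->
  N \in unitmx -> Q *m (N *m N^T) *m Q^T = diag_mx d -> forall j, 0 < d 0 j.
Proof.
move=> QQ uN E j; pose v := row j (Q *m N).
have Ev : d 0 j = (v *m v^T) 0 0.
  have /matrixP/(_ j j) := E; rewrite [RHS]mxE eqxx mulr1n => Ej; rewrite -[LHS]Ej.
  rewrite !mulmxA -mulmxA -trmx_mul [LHS]mxE [RHS]mxE.
  by apply: eq_bigr => k _; rewrite ![v _ _]mxE [v^T _ _]mxE ![v _ _]mxE [_^T _ _]mxE.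
rewrite Ev lt0r dot_ge0 andbT; apply: contraTneq uN => /dot_eq0 v0.
apply/negP => uN; have [uQ _] := mulmx1_unit QQ.
have : delta_mx 0 j = 0 :> 'rV[L]_n.
  have uQN : Q *m N \in unitmx by rewrite unitmx_mul uQ.
  by apply: (can_inj (mulmxK uQN)); rewrite -rowE mul0mx.
by move=> /matrixP/(_ 0 j)/eqP; rewrite !mxE !eqxx oner_eq0.
Qed.

Section Iwasawa.
Variables (K : rcfType) (R : realType) (iR : {rmorphism K -> R}).
Variables (n : nat) (G S q : seq (mxpoly K n)) (Q : 'M[K]_n).
Hypotheses (G_group : is_subgroup (geom [set` G]))
  (G_SL : forall g, geom [set` G] g -> \det g = 1)
  (G_selfadjoint : forall g, geom [set` G] g -> geom [set` G] g^T)
  (S_maximal : maximal_split_torus [set` G] [set` S])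
  (S_symmetric : forall s, geom [set` S] s -> s = s^T).
Hypothesis QQ : Q *m Q^T = 1%:M.
Local Notation A i := (sa_points i [:: (S, q)]).
Local Notation AK := (A (@idfun K)).
Hypothesis HA : torus_component S AK.
Hypothesis AQ : forall s, AK s -> exists d, Q *m s *m Q^T = diag_mx d.
Variable a : {vspace 'M[R]_n}.
Hypothesis a_lie : [set` a] = lie_algebra (A iR).
Local Notation ZG i := (zeros i [set` G]).
Local Notation g := (lie_algebra (ZG iR)).
Variable Delta : seq 'Hom(subvs_of a, R^o).
Hypothesis Delta_basis : root_basis g Delta.
Variable H0 : subvs_of a.
Hypothesis H0_regular : forall alpha, is_root g alpha ->
  (alpha H0 : R) != 0 /\ (positive_root g Delta alpha <-> 0 < (alpha H0 : R)).
Local Notation wt := (@wt K R iR n Q a).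
Local Notation h := (fun j : 'I_n => (wt j H0 : R)).

Lemma torus_zeros s : AK s -> zeros idfun [set` S] s.
Proof. by move=> [c]; rewrite inE => /eqP-> []. Qed.

Lemma torus_group (L : rcfType) (i : {rmorphism K -> L}) s : A i s -> ZG i s.
Proof.
have V1 := @mxpol_var K unit n tt.
have := transfer (def_impl (def_sa [:: (S, q)] V1) (def_zeros G V1)) _ i (fun=> s).
apply=> V /torus_zeros/geom_real Ss; apply/geom_real.
by have [_ SG _] := S_maximal; apply: SG.
Qed.

Lemma torus_sym s : AK s -> s^T = s.
Proof.
move=> /torus_zeros/geom_real/S_symmetric E.
by apply/(@map_mx_inj _ _ (real_complex K)); rewrite -map_trmx -E.
Qed.

Lemma torus_unit s : AK s -> s \in unitmx.
Proof. by move=> /torus_group; apply: group_unit. Qed.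

(** Two symmetric matrices with symmetric product commute. *)
Lemma component_comm s t : AK s -> AK t -> s *m t = t *m s.
Proof.
move=> As At; have [_ AM _ _ _] := HA.
by rewrite -(torus_sym (AM s t As At)) trmx_mul !torus_sym.
Qed.

Lemma diag_root_unique (L : rcfType) (O s t : 'M[L]_n) (x y : 'rV[L]_n) : O *m O^T = 1%:M ->
  O *m s *m O^T = diag_mx x -> O *m t *m O^T = diag_mx y ->
  (forall j, 0 < x 0 j) -> (forall j, 0 < y 0 j) -> s *m s = t *m t -> s = t.
Proof.
move=> OO Es Et x0 y0 E; have OO' : O^T *m O = 1%:M by apply: mulmx1C.
have back M : M = O^T *m (O *m M *m O^T) *m O.
  by rewrite !mulmxA OO' mul1mx -mulmxA OO' mulmx1.
have sq M z : O *m M *m O^T = diag_mx z -> O *m (M *m M) *m O^T = diag_mx (\row_j (z 0 j * z 0 j)).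
  move=> Ez; rewrite -mulmx_diag -Ez !mulmxA -[_ *m O^T *m O]mulmxA OO' mulmx1.
  by [].
rewrite (back s) (back t) Es Et; congr (_ *m diag_mx _ *m _).
apply/rowP => j; have : diag_mx (\row_j (x 0 j * x 0 j)) = diag_mx (\row_j (y 0 j * y 0 j)).
  by rewrite -(sq s x Es) -(sq t y Et) E.
move=> /matrixP/(_ j j); rewrite !mxE eqxx !mulr1n -!expr2 => /eqP.
by rewrite eqrXn2 ?ltW // => /eqP.
Qed.

(* The squares make [e *m e] positive definite without a positivity hypothesis on [e]. *)
Lemma cell_base (y u e : 'M[K]_n) : ZG idfun (qconjV Q idfun y) -> unip h u -> e^T = e ->
  e \in unitmx -> blockd h e -> y *m y^T = u *m ((e *m e) *m (e *m e)) *m u^T ->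
  ZG idfun (qconjV Q idfun u) /\ AK (qconjV Q idfun (e *m e)).
Proof.
move=> Gy uu eT ue be E; set c := e *m e.
have G1R := group_one G_group iR.
have GMR := @group_mul _ _ _ G_group _ iR.
have GTR := @group_tr _ _ _ G_selfadjoint _ iR.
have GVR := @group_inv _ _ _ G_group _ iR.
have AGR := @torus_group R iR.
have bc : blockd h c by move=> i j /mulmx_entry_neq0[k /be -> /be].
have bcc : blockd h (c *m c) by move=> i j /mulmx_entry_neq0[k /bc -> /bc].
have bmap (M : 'M[K]_n) : blockd h M -> blockd h (map_mx iR M).
  by move=> bM i j; rewrite mxE fmorph_eq0; apply: bM.
have uc : c \in unitmx by rewrite unitmx_mul ue.
(* The matrices over [K] are viewed over [R], where the Lie algebra is, and membership returns by
   [zeros_map]. *)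
have [GuR GlR] : ZG iR (qconjV Q iR (map_mx iR u)) /\ ZG iR (qconjV Q iR (map_mx iR (c *m c))).
  apply: (cell_mem QQ HA AQ torus_unit a_lie G1R GMR GTR GVR AGR (y := map_mx iR y)).
  - by rewrite -qconjV_map; apply/zeros_map.
  - move=> i j; rewrite -(map_mx1 iR) -map_mxB mxE fmorph_eq0; exact: uu.
  - exact: bmap.
  - by rewrite map_unitmx unitmx_mul uc.
  - by rewrite !map_trmx -!map_mxM E.
have Gu : ZG idfun (qconjV Q idfun u) by apply/(zeros_map iR); rewrite qconjV_map.
have Gcc : ZG idfun (qconjV Q idfun (c *m c)) by apply/(zeros_map iR); rewrite qconjV_map.
split=> //.
have [T TT [w Ew]] := sym_fun_calculus eT.
have w0 j : w 0 j != 0.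
  have : \det e != 0 by move: ue; rewrite unitmxE unitfE.
  rewrite Ew !det_mulmx det_diag mulf_eq0 mulf_eq0 !negb_or => /andP[/andP[_ +] _].
  by move=> /prodf_neq0; apply.
pose w2 : 'rV[K]_n := \row_j (w 0 j * w 0 j).
have Ec : c = T^T *m diag_mx w2 *m T.
  rewrite /c Ew !mulmxA -[_ *m T *m T^T]mulmxA TT mulmx1.
  by rewrite -[T^T *m diag_mx w *m _]mulmxA mulmx_diag.
have comm s : AK s -> c *m qconj Q idfun s = qconj Q idfun s *m c.
  move=> As; apply: (@map_mx_inj _ _ iR); rewrite [LHS]map_mxM [RHS]map_mxM qconj_map.
  apply: (centralizes QQ HA AQ torus_unit a_lie G1R GMR AGR H0_regular
    (O := map_mx iR T) (w := map_mx iR w2)).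
  - by rewrite map_trmx -map_mxM TT map_mx1.
  - by rewrite map_trmx -map_diag_mx -!map_mxM -Ec.
  - by move=> j; rewrite mxE rcf_rmorph_gt0 mxE -expr2 exprn_even_gt0 //= w0.
  - exact: bmap.
  - by rewrite -map_mxM.
  - exact/sa_map.
pose c' := qconjV Q idfun c; pose e' := qconjV Q idfun e.
have e'T : e'^T = e' by rewrite /e' -qconjVT // eT.
have Ec' : c' = e' *m e'^T by rewrite e'T /c' qconjVM.
have ue' : e' \in unitmx.
  have : \det e' != 0.
    by rewrite -(qconj_det QQ idfun) qconjVK //; move: ue; rewrite unitmxE unitfE.
  by rewrite unitmxE unitfE.
have c'T : c'^T = c' by rewrite Ec' trmx_mul trmxK.
have comm' s : AK s -> c' *m s = s *m c'.
  move=> As; apply: (can_inj (qconjK QQ idfun)); rewrite [LHS]qconjM // [RHS]qconjM // qconjVK //.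
  exact: comm.
(* A new basis is needed: [c'] commutes with [A] but need not be diagonal in the basis given by
   [Q]. *)
have [|Q' QQ' HQ'] := @comm_sym_codiag K n [set s | AK s \/ s = c'].
  split=> [s [/torus_sym//|->//]|s t [As|->] [At|->]] //.
  - exact: component_comm.
  - by rewrite comm'.
  - by rewrite comm'.
have [d Ed] := HQ' c' (or_intror erefl).
have d0 : forall j, 0 < d 0 j by apply: (orth_diag_gt0 QQ' ue'); rewrite -Ec'.
have [A1 AM Asq AV dens] := HA.
have back M z : Q' *m M *m Q'^T = diag_mx z -> M = Q'^T *m diag_mx z *m Q'.
  by move=> <-; rewrite !mulmxA (mulmx1C QQ') mul1mx -mulmxA (mulmx1C QQ') mulmx1.
have Apos s : AK s -> exists2 z, Q' *m s *m Q'^T = diag_mx z & forall j, 0 < z 0 j.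
  move=> As; have [z Ez] := HQ' s (or_introl As); exists z => //.
  have [t At Et] := Asq s As.
  apply: (orth_diag_gt0 QQ' (torus_unit At)); rewrite torus_sym // -Et; exact: Ez.
have Sc' : geom [set` S] (map_mx (real_complex K) c').
  apply: (@maximal_torus_mem K n Q' QQ' G S AK c' 2) => //.
  - by move=> s /Apos[z /back Ez z0]; exists z.
  - by move=> s /torus_zeros/geom_real.
  - by exists d; [apply: back|].
  - by apply/geom_real; rewrite expr2 -mulmxE -qconjVM.
(* [c'] lies in the torus and its square in [A]; the root of this square in [A] is [c'], both being
   positive in the basis given by [Q']. *)
have [t At Et] := Asq _ (AV _ (proj1 (geom_real _ _) Sc')).
have [z Ez z0] := Apos t At.
by rewrite -/c' (diag_root_unique QQ' Ed Ez d0 z0 Et).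
Qed.

Section Ext.
Variables (F : rcfType) (iF : {rmorphism K -> F}).
Local Notation GF := (ZG iF).
Local Notation AF := (A iF).
Local Notation qc := (qconj Q iF).
Local Notation qcV := (qconjV Q iF).
Local Notation U := (unipotent_part g iR iF Delta).

Lemma cell_ext (y u e : 'M[F]_n) : GF (qcV y) -> unip h u -> e^T = e ->
  e \in unitmx -> blockd h e -> y *m y^T = u *m ((e *m e) *m (e *m e)) *m u^T ->
  GF (qcV u) /\ AF (qcV (e *m e)).
Proof.
pose o0 : 'I_3 := inord 0; pose o1 : 'I_3 := inord 1; pose o2 : 'I_3 := inord 2.
have Vy := @mxpol_var K 'I_3 n o0; have Vu := @mxpol_var K 'I_3 n o1.
have Ve := @mxpol_var K 'I_3 n o2; have V1 := mxpol_const 'I_3 (1%:M : 'M[K]_n).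
have Vee := mxpolM Ve Ve.
(* Invertibility of [e] is written as positivity of the squared determinant. *)
have D := def_impl (def_zeros G (mxpol_qconjV Q Vy))
  (def_impl (def_entries (fun i j => h j < h i) (mxpolB Vu V1))
  (def_impl (def_mxeq (mxpolT Ve) Ve)
  (def_impl (def_gt0 (polM (pol_det Ve) (pol_det Ve)))
  (def_impl (def_entries (fun i j => h i == h j) Ve)
  (def_impl (def_mxeq (mxpolM Vy (mxpolT Vy)) (mxpolM (mxpolM Vu (mxpolM Vee Vee)) (mxpolT Vu)))
  (def_and (def_zeros G (mxpol_qconjV Q Vu)) (def_sa [:: (S, q)] (mxpol_qconjV Q Vee)))))))).
pose V (k : 'I_3) := if val k == 0%N then y else if val k == 1%N then u else e.
have V0E : V o0 = y by rewrite /V /= inordK.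
have V1E : V o1 = u by rewrite /V /= !inordK.
have V2E : V o2 = e by rewrite /V /= !inordK.
move=> Gy uu eT ue be E.
have := transfer D _ iF V; rewrite V0E V1E V2E; apply=> //.
- move=> W Gy' uu' eT' ue' be' E'; apply: (cell_base Gy' _ eT' _ _ E').
  + by move=> i j ij; apply: uu'; move: ij; rewrite map_mx1.
  + rewrite unitmxE unitfE; apply: contraTneq ue' => ->.
    by rewrite mul0r ltxx.
  + by move=> i j /be'/eqP.
- by rewrite map_mx1.
- rewrite -expr2 exprn_even_gt0 //=; move: ue; by rewrite unitmxE unitfE.
- by move=> i j /be ->.
Qed.

Lemma root_space_formula (alpha : 'Hom(subvs_of a, R^o)) : alpha != 0 ->
  exists2 d : sa_formula K n, root_space g alpha = sa_points iR d &
  forall X : 'M[F]_n, extension iR iF (root_space g alpha) X <->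
    (forall i j, ~~ (wt i - wt j == alpha) -> qc X i j = 0) /\ GF (exp_nilp X).
Proof.
move=> a0; have [d Hd] := exp_formula G Q Q^T (fun i j => wt i - wt j == alpha).
have E : root_space g alpha = sa_points iR d.
  apply/seteqP; split=> X.
    move=> /(root_space_exp QQ HA AQ torus_unit a_lie (group_one G_group iR)
      (@group_mul _ _ _ G_group _ iR) _ a0) [H1 H2].
    by apply/Hd; split=> // i j /H1; rewrite /qconj map_trmx.
  move=> /Hd[H1 H2]; apply/(root_space_exp QQ HA AQ torus_unit a_lie (group_one G_group iR)
      (@group_mul _ _ _ G_group _ iR) _ a0); split=> //.
  by move=> i j /H1; rewrite /qconj map_trmx.
exists d => // X; rewrite E extension_sa.
apply: iff_trans (Hd F iF X) _; split=> -[H1 H2]; split=> // i j /H1;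
  by rewrite /qconj map_trmx.
Qed.

(** The logarithm of an element with unipotent pattern is taken directly over [F]. What is
    transferred from [R] is the behaviour of its weight components and, for the other direction, of
    a finite family of root vectors. *)
Lemma unipotent_partP X : U X <-> GF X /\ unip h (qc X).
Proof.
have G1R := group_one G_group iR.
have GMR := @group_mul _ _ _ G_group _ iR.
have AGR := @torus_group R iR.
split=> [[r [Y [ur pr HY ->]]]|[GX uX]].
  pose I := 'I_(size r).
  have rI (k : I) : positive_root g Delta r`_k by apply: pr; rewrite mem_nth.
  have Vk k := @mxpol_var K I n k.
  have Vs := mxpol_sum (enum I) Vk.
  have dk (k : I) : exists d : sa_formula K n, root_space g r`_k = sa_points iR d.
    by have [d] := root_space_formula (rI k).1.1; exists d.
  have [d Hd] := boolp.choice dk.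
  have D := def_impl (def_all (fun k => def_sa (d k) (Vk k)))
   (def_and (def_zeros G (mxpol_exp Vs))
     (def_entries (fun i j => h j < h i) (mxpol_qconj Q Vs))).
  have -> : \sum_(al <- r) Y al = \sum_(k <- enum I) Y r`_k.
    by rewrite big_enum (big_nth 0) big_mkord.
  have [|k|GX sX] := transfer_from iF D (R := R) (iR := iR) _ (fun k : I => Y r`_k).
  - move=> V HV; rewrite big_enum.
    apply: (root_sum_G QQ HA AQ torus_unit a_lie G1R GMR H0_regular (r := fun k : I => r`_k)) => // k.
    by rewrite Hd.
  - have := HY _ (mem_nth 0 (ltn_ord k)).
    by rewrite Hd extension_sa.
  split=> //.
  have -> : qc (exp_nilp (\sum_(k <- enum I) Y r`_k)) = exp_nilp (qc (\sum_(k <- enum I) Y r`_k)).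
    by apply: (can_inj (qconjVK QQ iF)); rewrite qconjK // -qconjV_exp // qconjK.
  exact: exp_nilp_unip.
have [N sN EN] := exp_nilp_surj uX.
have XN : X = exp_nilp (qcV N) by rewrite qconjV_exp // EN qconjK.
have Vv := @mxpol_var K unit n tt.
have comp i0 j0 : GF (exp_nilp (qcV (\matrix_(i, j) (if wt i - wt j == wt i0 - wt j0
      then N i j else 0)))) /\ (N i0 j0 != 0 -> positive_root g Delta (wt i0 - wt j0)).
  (* That a weight is a positive root does not depend on the field; it is encoded as a condition on
     the entry of [N] at [(i0, j0)]. *)
  have D := def_impl (def_entries (fun i j => h j < h i) Vv)
   (def_impl (def_zeros G (mxpol_exp (mxpol_qconjV Q Vv)))
    (def_and (def_zeros G (mxpol_exp (mxpol_qconjV Q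
       (mxpol_mask (fun i j => wt i - wt j == wt i0 - wt j0) Vv))))
     (def_entries (fun i j => ((i == i0) && (j == j0)) ==> `[< positive_root g Delta (wt i0 - wt j0) >]) Vv))).
  have [||GM Hp] := transfer_from iF D (R := R) (iR := iR) _ (fun=> N) sN.
  - move=> V sV GV.
    have [Gm Hp] := unip_components QQ HA AQ torus_unit a_lie G1R GMR AGR H0_regular i0 j0 sV GV.
    split=> // i j Vij; apply/implyP => /andP[/eqP Ei /eqP Ej]; apply/asboolP/Hp.
    by rewrite -Ei -Ej.
  - by rewrite -XN.
  split=> // /Hp; rewrite !eqxx => /asboolP; exact.
pose r := undup [seq wt ij.1 - wt ij.2 | ij <- enum {: 'I_n * 'I_n} &
  `[< positive_root g Delta (wt ij.1 - wt ij.2) >]].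
pose Y (al : 'Hom(subvs_of a, R^o)) : 'M[F]_n :=
  \matrix_(i, j) (if wt i - wt j == al then N i j else 0).
exists r, (fun al => qcV (Y al)); split.
- exact: undup_uniq.
- move=> al; rewrite mem_undup => /mapP[[i j]]; rewrite mem_filter => /andP[/asboolP H _].
  by move=> ->.
- move=> al; rewrite mem_undup => /mapP[[i j]]; rewrite mem_filter => /andP[/asboolP H _] ->.
  have [d _ Hd] := root_space_formula H.1.1; apply/Hd; split; last exact: (comp i j).1.
  by move=> i' j' ne; rewrite qconjVK // mxE (negbTE ne).
rewrite XN; congr exp_nilp.
have -> : \sum_(al <- r) qcV (Y al) = qcV (\sum_(al <- r) Y al).
  by rewrite /qconjV mulmx_sumr mulmx_suml.
congr qcV; apply/matrixP => i j; rewrite summxE.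
have [n0|n0] := eqVneq (N i j) 0.
  by rewrite big1 // => al _; rewrite mxE n0 if_same.
have rij : wt i - wt j \in r.
  rewrite mem_undup; apply/mapP; exists (i, j) => //.
  by rewrite mem_filter mem_enum andbT; apply/asboolP; apply: (comp i j).2.
rewrite (bigD1_seq _ rij) ?undup_uniq //= mxE eqxx big1 ?addr0 // => al ne.
by rewrite mxE eq_sym (negbTE ne).
Qed.

End Ext.
End Iwasawa.

(** * Integrality *)

Section Integrality.
Variables (F : rcfType) (O : {pred F}) (n : nat).
Hypotheses (O_subring : GRing.subring_closed O) (O_convex : order_convex O).
Local Notation intm := (fun M : 'M[F]_n => forall i j, M i j \in O).

Lemma mem_subring1 : 1 \in O. Proof. by have [] := O_subring. Qed.
Lemma mem_subringB x y : x \in O -> y \in O -> x - y \in O.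
Proof. by move=> Ox Oy; have [_ H _] := O_subring; apply: H. Qed.
Lemma mem_subring0 : 0 \in O. Proof. by rewrite -(subrr 1) mem_subringB ?mem_subring1. Qed.
Lemma mem_subringN x : x \in O -> - x \in O.
Proof. by move=> Ox; rewrite -[- x]add0r mem_subringB ?mem_subring0. Qed.
Lemma mem_subringD x y : x \in O -> y \in O -> x + y \in O.
Proof. by move=> Ox Oy; rewrite -[y]opprK mem_subringB ?mem_subringN. Qed.
Lemma mem_subringM x y : x \in O -> y \in O -> x * y \in O.
Proof. by move=> Ox Oy; have [_ _ H] := O_subring; apply: H. Qed.

Lemma integral_mul M N : intm M -> intm N -> intm (M *m N).
Proof.
move=> MO NO i j; rewrite mxE.
by elim/big_ind: _ => [|x y|k _]; [exact: mem_subring0|exact: mem_subringD|exact: mem_subringM].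
Qed.

Lemma integral_tr M : intm M -> intm M^T.
Proof. by move=> HM i j; rewrite mxE. Qed.

Lemma integral_orth k : k *m k^T = 1%:M -> intm k.
Proof.
move=> kk i j; apply: (O_convex (mem_subringN mem_subring1) mem_subring1).
have /matrixP/(_ i i) := kk; rewrite !mxE eqxx /= mulr1n => E.
rewrite -ler_norml -(@ler_pXn2r _ 2) ?nnegrE // expr1n real_normK ?num_real //.
rewrite -E (bigD1 j) //= mxE expr2 lerDl sumr_ge0 // => l _.
by rewrite mxE -expr2 sqr_ge0.
Qed.

Lemma integral_diag (d : 'rV[F]_n) : (forall j, d 0 j \in O) -> intm (diag_mx d).
Proof. by move=> Od i j; rewrite mxE; case: eqP => [->|_]; rewrite ?mulr1n ?mulr0n ?mem_subring0. Qed.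

(** With product one, the inverse of an entry is the product of the others. *)
Lemma integral_diag_inv (d : 'rV[F]_n) : (forall j, d 0 j \in O) -> \prod_j d 0 j = 1 ->
  forall j, (d 0 j)^-1 \in O.
Proof.
move=> Od d1 j; have -> : (d 0 j)^-1 = \prod_(l | l != j) d 0 l.
  have d0 : d 0 j != 0.
    by apply: contra_eq_neq d1 => dj; rewrite (bigD1 j) //= dj mul0r eq_sym oner_eq0.
  by apply: (mulfI d0); rewrite divff // -[LHS]d1 (bigD1 j).
elim/big_ind: _ => [|x y|l _]; [exact: mem_subring1|exact: mem_subringM|exact: Od].
Qed.

End Integrality.

Lemma iwasawa_unique (R : realDomainType) n (h : 'I_n -> R) (F : rcfType)
    (u u' k k' : 'M[F]_n) (D D' : 'rV[F]_n) : unip h u -> unip h u' ->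
  (forall j, 0 < D 0 j) -> (forall j, 0 < D' 0 j) -> k *m k^T = 1%:M -> k' *m k'^T = 1%:M ->
  u *m diag_mx D *m k = u' *m diag_mx D' *m k' -> [/\ u = u', D = D' & k = k'].
Proof.
move=> uu uu' D0 D0' kk kk' E.
have [un iu] := unip_inv uu; have [un' iu'] := unip_inv uu'.
pose sq (d : 'rV[F]_n) : 'rV[F]_n := \row_j (d 0 j * d 0 j).
have gram (v : 'M[F]_n) d (l : 'M[F]_n) : l *m l^T = 1%:M ->
    (v *m diag_mx d *m l) *m (v *m diag_mx d *m l)^T = v *m diag_mx (sq d) *m v^T.
  move=> ll; rewrite !trmx_mul tr_diag_mx !mulmxA -[_ *m l *m l^T]mulmxA ll mulmx1.
  by rewrite -[v *m _ *m diag_mx d]mulmxA mulmx_diag.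
have Eg : u *m diag_mx (sq D) *m u^T = u' *m diag_mx (sq D') *m u'^T.
  by rewrite -(gram u D k kk) -(gram u' D' k' kk') E.
(* The Gram matrices no longer involve [k] and [k']; comparing the unipotent factors by [w] gives
   the equation of [unip_block_eq1]. *)
have [w Ew] : exists w, w = invmx u' *m u by eexists.
have uw : unip h w by rewrite Ew; apply: unipM.
have iw : invmx w = invmx u *m u'.
  have [unw _] := unip_inv uw; apply: (can_inj (mulKmx unw)).
  by rewrite mulmxV // Ew !mulmxA mulmxK // mulVmx.
have [] := @unip_block_eq1 R n h F w (sq D) (sq D') _ uw.
- by move=> j; rewrite mxE mulf_neq0 // gt_eqF.
- rewrite iw trmx_mul Ew -mulmxA.
  apply: (can_inj (mulKmx un')); rewrite !mulmxA mulmxV // mul1mx.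
  have unT : u^T \in unitmx by rewrite unitmx_tr.
  apply: (can_inj (mulmxK unT)); rewrite Eg -!mulmxA; congr (_ *m (_ *m _)).
  by rewrite -trmx_mul mulmxV // trmx1 mulmx1.
move=> w1 Esq.
have Eu : u = u' by rewrite -[u](mulKVmx un') -Ew w1 mulmx1.
have ED : D = D'.
  apply/rowP => j; move/rowP/(_ j): Esq; rewrite !mxE -!expr2 => /eqP.
  by rewrite eqrXn2 ?ltW // => /eqP.
split=> //; move: E; rewrite -Eu -ED.
have ud : u *m diag_mx D \in unitmx.
  rewrite unitmx_mul un unitmxE det_diag unitfE; apply/prodf_neq0 => j _.
  by rewrite gt_eqF.
exact: (can_inj (mulKmx ud)).
Qed.

Theorem corollary4p20 (K : rcfType) (R : realType) (F : rcfType)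
    (iR : {rmorphism K -> R}) (iF : {rmorphism K -> F})
    (O : {pred F}) (O_subring : GRing.subring_closed O)
    (O_convex : order_convex O) (O_proper : exists x : F, x \notin O)
    (n : nat)
    (G : seq (mxpoly K n))
    (G_group : is_subgroup (geom [set` G]))
    (G_SL : forall g, geom [set` G] g -> \det g = 1)
    (G_connected : zariski_connected (geom [set` G]))
    (G_semisimple : semisimple_group (geom [set` G]))
    (G_selfadjoint : forall g, geom [set` G] g -> geom [set` G] g^T)
    (S : seq (mxpoly K n))
    (S_maximal : maximal_split_torus [set` G] [set` S])
    (S_symmetric : forall s, geom [set` S] s -> s = s^T)
    (a : {vspace 'M[R]_n}) :
  let G_F := zeros iF [set` G] in
  let G_R := zeros iR [set` G] in
  let A_K := sa_component (zeros idfun [set` S]) 1%:M in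
  let A_F := extension idfun iF A_K in
  let A_R := extension idfun iR A_K in
  let K_F := G_F `&` SO F n in
  let g := lie_algebra G_R in
  forall (a_lie : [set` a] = lie_algebra A_R)
    (Delta : seq 'Hom(subvs_of a, R^o)) (Delta_basis : root_basis g Delta),
  let U_F := unipotent_part g iR iF Delta in
  [/\ integral_points O G_F =
        [set ua *m k | ua in [set u *m b | u in integral_points O U_F
                                          & b in integral_points O A_F]
                     & k in K_F],
      K_F = integral_points O K_F &
      forall x, integral_points O G_F x ->
        exists! uak : 'M[F]_n * 'M[F]_n * 'M[F]_n,
          [/\ integral_points O U_F uak.1.1,
              integral_points O A_F uak.1.2,
              K_F uak.2 &
              x = uak.1.1 *m uak.1.2 *m uak.2]].
Proof.
move=> G_F G_R A_K A_F A_R K_F g a_lie Delta Delta_basis U_F.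
have [splS _ _] := S_maximal.
have [q [EA HA]] := split_torus_component splS.
have EAF : A_F = sa_points iF [:: (S, q)].
  by rewrite /A_F /A_K EA (extension_sa idfun iF).
have EAR : A_R = sa_points iR [:: (S, q)].
  by rewrite /A_R /A_K EA (extension_sa idfun iR).
rewrite EAR in a_lie.
have sym := torus_sym S_symmetric; have comm := component_comm S_symmetric HA.
have [|Q QQ AQ] := @comm_sym_codiag K n (sa_points idfun [:: (S, q)]).
  by split=> [s|s t]; [apply: sym|apply: comm].
have [H0 H0_regular] := regular_element Delta_basis.
pose h (j : 'I_n) : R := wt iR Q a j H0.
have UP X : U_F X <-> G_F X /\ unip h (qconj Q iF X).
  exact: (unipotent_partP G_group G_SL S_maximal QQ HA AQ a_lie H0_regular).
have AG s : A_F s -> G_F s by rewrite EAF; apply: (torus_group S_maximal).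
have AD s : A_F s -> exists2 y, s = qdg Q iF y & forall j, 0 < y 0 j.
  by rewrite EAF; apply: (torus_qdiag QQ HA AQ (torus_unit G_SL S_maximal)).
have GM := @group_mul _ _ _ G_group _ iF.
have GV := @group_inv _ _ _ G_group _ iF.
have GU := @group_unit _ _ _ G_SL _ iF.
have Gdet := @group_det _ _ _ G_SL _ iF.
have Korth k : K_F k -> k *m k^T = 1%:M by move=> [_ []].
have Kint k : K_F k -> forall i j, k i j \in O.
  by move=> /Korth; apply: integral_orth.
pose QF := map_mx iF Q.
(* [Q] is orthogonal, so its change of coordinates preserves integrality in both directions. *)
have OQ : forall i j, QF i j \in O by apply: integral_orth => //; apply: map_orth.
have OQT := integral_tr OQ.
have mulO := @integral_mul F O n O_subring.
have Oqc (M : 'M[F]_n) : (forall i j, M i j \in O) -> forall i j, qconj Q iF M i j \in O.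
  by move=> OM'; exact: (mulO _ _ (mulO _ _ OQ OM') OQT).
have OqcV (M : 'M[F]_n) : (forall i j, M i j \in O) -> forall i j, qconjV Q iF M i j \in O.
  by move=> OM'; exact: (mulO _ _ (mulO _ _ OQT OM') OQ).
have qcorth k : k *m k^T = 1%:M -> qconj Q iF k *m (qconj Q iF k)^T = 1%:M.
  by move=> kk; rewrite -qconjT -qconjM // kk qconj1.
have decomp x : integral_points O G_F x -> exists u b k,
    [/\ integral_points O U_F u, integral_points O A_F b, K_F k & x = u *m b *m k].
  move=> [Gx Ox]; pose y := qconj Q iF x.
  have Gy : zeros iF [set` G] (qconjV Q iF y) by rewrite qconjK.
  have uy : y \in unitmx by rewrite unitmxE qconj_det // -unitmxE GU.
  have [u [e [uu eT ue be E]]] := block_cholesky_root h uy.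
  have [Gu Ab] := cell_ext G_group G_SL G_selfadjoint S_maximal S_symmetric QQ HA AQ
    a_lie H0_regular Gy uu eT ue be E.
  rewrite -EAF in Ab; have Gb := AG _ Ab.
  have [U EU] : exists U, U = qconjV Q iF u by eexists.
  have [b Eb] : exists b, b = qconjV Q iF (e *m e) by eexists.
  rewrite -EU in Gu; rewrite -Eb in Ab Gb.
  have uU : U \in unitmx := GU _ Gu; have ub : b \in unitmx := GU _ Gb.
  pose k := invmx b *m (invmx U *m x).
  have Ek : x = U *m b *m k by rewrite /k -[U *m b *m _]mulmxA !mulKVmx.
  have GVi v : v \in unitmx -> G_F v -> G_F (invmx v).
    by move=> uv; apply: GV; rewrite mulmxV.
  have Gk : G_F k by apply: (GM _ _ (GVi _ ub Gb)); apply: (GM _ _ (GVi _ uU Gu)).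
  have bT : b^T = b by rewrite Eb -qconjVT // trmx_mul eT.
  have Exx : x *m x^T = U *m (b *m b) *m U^T.
    rewrite -(qconjK QQ iF (x *m x^T)) qconjM // qconjT E !qconjVM // qconjVT.
    by rewrite EU Eb qconjVM.
  have kk : k *m k^T = 1%:M.
    have E1 : invmx U *m (x *m x^T) *m (invmx U)^T = b *m b.
      rewrite Exx !mulmxA mulVmx // mul1mx -[_ *m U^T *m _]mulmxA -trmx_mul mulVmx //.
      by rewrite trmx1 mulmx1.
    have -> : k *m k^T = invmx b *m (invmx U *m (x *m x^T) *m (invmx U)^T) *m (invmx b)^T.
      by rewrite /k !trmx_mul !mulmxA.
    by rewrite E1 trmx_inv bT !mulmxA mulVmx // mul1mx mulmxV.
  have Kk : K_F k by split=> //; split=> //; apply: Gdet.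
  have [D ED D0] := AD _ Ab.
  have [u1 u2] := unipP uu.
  (* Moving [k] to the other side leaves a product of integral matrices; its diagonal is [D], since
     [u] has diagonal one. *)
  have Oub : forall i j, (u *m diag_mx D) i j \in O.
    have -> : u *m diag_mx D = qconj Q iF (x *m k^T).
      have -> : x *m k^T = U *m b by rewrite {1}Ek -[_ *m k *m _]mulmxA kk mulmx1.
      rewrite qconjM // EU qconjVK //; congr (_ *m _).
      by rewrite -(qconj_qdg QQ iF) -ED.
    by apply: Oqc; apply: mulO => //; apply: integral_tr; apply: Kint.
  have OD' j : D 0 j \in O.
    by have := Oub j j; rewrite mul_mx_diag mxE u2 mul1r.
  have D1 : \prod_j D 0 j = 1.
    rewrite -det_diag -(Gdet _ Gb) -(qconj_det QQ iF); congr (\det _).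
    by rewrite ED qconj_qdg.
  have Oinv := integral_diag_inv O_subring OD' D1.
  exists U, b, k; split=> //.
  - split; first by apply/UP; split=> //; rewrite EU qconjVK.
    rewrite EU; apply: OqcV => i j; have := mulO _ _ Oub (integral_diag O_subring (d := map_mx GRing.inv D) _) i j.
    rewrite -mulmxA mulmx_diag (_ : \row__ _ = const_mx 1) ?diag_const_mx ?mulmx1.
      by apply=> l; rewrite mxE.
    by apply/rowP => l; rewrite !mxE mulfV // gt_eqF.
  - by split=> //; rewrite ED; apply: OqcV; apply: integral_diag.
split.
- apply/seteqP; split=> x.
    move=> /decomp[u [b [k [Uu Ab Kk ->]]]].
    by exists (u *m b); [exists u => //; exists b|exists k].
  move=> [_ [u [Uu Ou] [b [Ab Ob] <-]]] [k Kk <-].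
  split; last exact: (mulO _ _ (mulO _ _ Ou Ob) (Kint k Kk)).
  have [Gu _] := (UP u).1 Uu.
  by case: Kk => Gk _; apply: (GM _ _ (GM _ _ Gu (AG _ Ab)) Gk).
- apply/seteqP; split=> k; last by case.
  by move=> Kk; split=> //; apply: Kint.
move=> x /decomp[u [b [k [Uu Ab Kk Ex]]]].
exists (u, b, k); split=> // -[[u' b'] k'] [/= Uu' Ab' Kk' Ex'].
have [[Gu uu] [Gu' uu']] := ((UP u).1 Uu.1, (UP u').1 Uu'.1).
have [[D ED D0] [D' ED' D0']] := (AD _ Ab.1, AD _ Ab'.1).
have [Eu EDD Ek] : [/\ qconj Q iF u = qconj Q iF u', D = D' & qconj Q iF k = qconj Q iF k'].
  apply: (iwasawa_unique uu uu' D0 D0'); try by apply/qcorth/Korth.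
  by rewrite -!(qconj_qdg QQ iF) -ED -ED' -!qconjM // -Ex -Ex'.
have inj := can_inj (qconjK QQ iF).
by rewrite (inj _ _ Eu) (inj _ _ Ek) ED ED' EDD.
Qed.
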